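(* Let $R=\mathbf{k}[x,y,z]$ be a standard graded polynomial ring over a field $\mathbf{k}$, $U=R_1$ (so $R=\operatorname{Sym}_\bullet U$), $U_0$ the span of $y,z$, and $n$ a positive even integer. Let $\Phi_{2n-1}\in D_{2n-1}U^*$, $J=\operatorname{ann}_{\operatorname{Sym}_\bullet U}\Phi_{2n-1}$, and assume $J_{n-1}=0$ and that $x$ is a weak Lefschetz element on $R/J$. Let $I=\operatorname{ann}_{\operatorname{Sym}_\bullet U}x(\Phi_{2n-1})$. Let $N=\binom{n+1}2$, $m_1,\dots,m_N$ the ordered basis of $\operatorname{Sym}_{n-1}U$ and $m_{0,1},\dots,m_{0,n+1}$ the ordered basis of $\operatorname{Sym}_nU_0$ from the context, $\mathbf{p}=(\Phi_{2n-1}(xm_im_j))_{1\le i,j\le N}$ and $\mathbf{r}=(\Phi_{2n-1}(m_im_{0,j}))_{1\le i\le N,\,1\le j\le n+1}$. Then the following hold. (a) $I$ is a linearly presented grade three Gorenstein ideal; $\mathbf{p}$ is invertible, and the minimal homogeneous resolution of $R/I$ by free $R$-modules is $0\to R(-2n-1)\xrightarrow{b_3}R(-n-1)^{2n+1}\xrightarrow{b_2}R(-n)^{2n+1}\xrightarrow{b_1}R$, where $b_2=\begin{bmatrix}xA'&B\\-B^{\rm T}&D\end{bmatrix}$, $b_1$ is the row vector of signed maximal order Pfaffians of $b_2$, $b_3=b_1^{\rm T}$, and: $A_0$ is $\mathbf{r}^{\rm T}\mathbf{p}^{-1}\mathbf{r}$ with row $n+1$ and column $1$ deleted; $A'=A_0-A_0^{\rm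 T}$; $B_0$ is the right-most $n$ columns of $\mathbf{r}^{\rm T}\mathbf{p}^{-1}$; $B_1=[\,0_{n\times1}\mid B_0\text{ without row }n+1\,]-[\,B_0\text{ without row }1\mid0_{n\times1}\,]$; $B_2=[\,zI_n\mid0_{n\times1}\,]-[\,0_{n\times1}\mid yI_n\,]$; $B=xB_1+B_2$; $D_0=\begin{bmatrix}0_{n\times1}&Q\\0_{1\times1}&0_{1\times n}\end{bmatrix}$ with $Q$ the bottom-right $n\times n$ submatrix of $\mathbf{p}^{-1}$; $D=x(D_0-D_0^{\rm T})$. (b) For $1\le i\le 2n+1$ let $g_i$ be $(-1)^{i+1}$ times the Pfaffian of the submatrix of $b_2$ obtained by deleting row and column $i$. Then $g_{n+1},\dots,g_{2n+1}$ is part of a minimal generating set for $J$. (c) $J$ is quadratically presented if and only if the $n\times n$ matrix $A'$ is invertible. (d) If $J$ is quadratically presented, then $J=(g_{n+1},\dots,g_{2n+1})$ and the minimal homogeneous resolution of $R/J$ by free $R$-modules is $$0\to R(-2n-2)\xrightarrow{c_3}R(-n-2)^{n+1}\xrightarrow{c_2}R(-n)^{n+1}\xrightarrow{c_1}R,$$ where $c_2=B^{\rm T}(A')^{-1}B+xD$, $c_1$ is the row vector of signed maximal order Pfaffians of $c_2$, and $c_3=c_1^{\rm T}$.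
   Context: $D_iU^*=\operatorname{Hom}_{\mathbf{k}}(\operatorname{Sym}_iU,\mathbf{k})$; $\operatorname{Sym}_\bullet U$ acts on $D_\bullet U^*$ by $u(w)(v)=w(vu)$ for $u\in\operatorname{Sym}_iU$, $w\in D_jU^*$, $v\in\operatorname{Sym}_{j-i}U$; $\operatorname{ann}_{\operatorname{Sym}_\bullet U}\Phi=\{\mu\in R\mid\mu(\Phi)=0\}$. Ordered bases: monomials $x^ay^bz^c$ of degree $i$, with $x^ay^bz^c$ before $x^\alpha y^\beta z^\gamma$ iff $\alpha<a$, or $\alpha=a$ and $\beta<b$; for $\operatorname{Sym}_iU_0$: $y^i,y^{i-1}z,\dots,z^i$. $I_a$ is the identity, $0_{a\times b}$ the zero matrix. A standard graded Artinian algebra $A$ has $\ell\in A_1$ as a weak Lefschetz element if for every $i$ multiplication by $\ell$, $A_i\to A_{i+1}$, is injective or surjective. For an odd-size alternating matrix $M$, the signed maximal order Pfaffians are $M_j=(-1)^{j+1}\operatorname{Pf}(M$ with row and column $j$ deleted$)$. A homogeneous ideal is linearly (resp. quadratically) presented if the second differential of the minimal homogeneous free resolution of $R/$(ideal) has all entries linear (resp. quadratic) forms. Grade three Gorenstein: $R/I$ Gorenstein and $I$ contains a regular sequence of length three (maximal). *)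

(* Defs.v *)
From HB Require Import structures.
From mathcomp Require Import all_boot all_order all_algebra.
From mathcomp Require Import mpoly.

Set Implicit Arguments.
Unset Strict Implicit.
Unset Printing Implicit Defensive.

Import Order.TTheory GRing.Theory.
Local Open Scope ring_scope.

(* R = k[x,y,z]; variables x = var 0, y = var 1, z = var 2. *)
Notation poly3 k := {mpoly k[3]}.

Section Defs.
Variable k : fieldType.
Local Notation R := (poly3 k).

Definition var (i : nat) : R := 'X_(inord i).

Definition mxf {T : nmodType} {a b : nat} (A : 'M[T]_(a, b)) (i j : nat) : T :=
  match (insub i : option 'I_a), (insub j : option 'I_b) with
  | Some i', Some j' => A i' j'
  | _, _ => 0
  end.

Definition skip2 (j p : nat) : nat := if (p < j)%N then p.+1 else p.+2.
Definition del (j p : nat) : nat := if (p < j)%N then p else p.+1.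

Fixpoint pf {T : comNzRingType} (N : nat) (a : nat -> nat -> T) {struct N} : T :=
  match N with
  | 0 => 1
  | 1 => 0
  | N'.+2 => \sum_(j < N'.+1)
       (-1) ^+ j * a 0%N j.+1 * pf N' (fun p q => a (skip2 j p) (skip2 j q))
  end.

Definition Pf {T : comNzRingType} {N : nat} (A : 'M[T]_N) : T := pf N (mxf A).

(* Row vector of signed maximal order Pfaffians of a square matrix:
   entry j (0-indexed) is (-1)^j Pf(A with row and column j deleted),
   i.e. (-1)^(j+1) with 1-indexing as in the paper. *)
Definition signed_pfaffians {T : comNzRingType} {N : nat} (A : 'M[T]_N) : 'rV[T]_N :=
  \row_(j < N) ((-1) ^+ j * pf N.-1 (fun p q => mxf A (del j p) (del j q))).

Definition in_ideal (s : seq R) (p : R) : Prop :=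
  exists c : 'I_(size s) -> R, p = \sum_(i < size s) c i * s`_i.

Definition rem_at (s : seq R) (i : nat) : seq R := take i s ++ drop i.+1 s.

Definition min_gen_set (J : R -> Prop) (s : seq R) : Prop :=
  (forall i : 'I_(size s), exists d : nat, s`_i \is d.-homog) /\
  (forall p, J p <-> in_ideal s p) /\
  (forall i : 'I_(size s), ~ in_ideal (rem_at s i) s`_i).

Definition part_of_min_gen_set (J : R -> Prop) (s : seq R) : Prop :=
  exists t : seq R, min_gen_set J (s ++ t).

(* An element of D_d U^* = Hom_k(Sym_d U, k) is given by its values
   phi m on the monomials m of degree d. *)
Definition dual_eval (d : nat) (phi : 'X_{1..3} -> k) (p : R) : k :=
  \sum_(m <- msupp p | mdeg m == d) phi m * p@_m.

Definition contract (d : nat) (u : R) (phi : 'X_{1..3} -> k) : 'X_{1..3} -> k :=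
  fun m => dual_eval d phi ('X_[m] * u).

Definition ann (d : nat) (phi : 'X_{1..3} -> k) (mu : R) : Prop :=
  forall v : R, dual_eval d phi (v * mu) = 0.

Definition weak_lefschetz (J : R -> Prop) (l : R) : Prop :=
  forall i : nat,
    (forall f : R, f \is i.-homog -> J (l * f) -> J f) \/
    (forall g : R, g \is i.+1.-homog -> exists f : R, f \is i.-homog /\ J (g - l * f)).

(* entry of a graded map R(-ds) -> R(-dt) lying in the maximal ideal *)
Definition graded_entry (p : R) (dt ds : nat) : Prop :=
  p = 0 \/ ((dt < ds)%N /\ p \is (ds - dt)%N.-homog).

Definition min_presentation (J : R -> Prop) (a b : nat)
    (dg : 'I_a -> nat) (dM : 'I_b -> nat) (g : 'M[R]_(1, a)) (M : 'M[R]_(a, b)) : Prop :=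
  (forall j, graded_entry (g 0 j) 0 (dg j)) /\
  (forall i j, graded_entry (M i j) (dg i) (dM j)) /\
  (forall p, J p <-> exists v : 'cV[R]_a, p = (g *m v) 0 0) /\
  g *m M = 0 /\
  (forall v : 'cV[R]_a, g *m v = 0 -> exists w : 'cV[R]_b, v = M *m w).

Definition presented_in_degree (e : nat) (J : R -> Prop) : Prop :=
  exists (a b : nat) (dg : 'I_a -> nat) (dM : 'I_b -> nat)
         (g : 'M[R]_(1, a)) (M : 'M[R]_(a, b)),
    min_presentation J dg dM g M /\ (forall i j, M i j \is e.-homog).

Definition linearly_presented := presented_in_degree 1.
Definition quadratically_presented := presented_in_degree 2.

(* minimal homogeneous free resolution of R/I of the form
   0 -> F3 --f3--> F2 --f2--> F1 --f1--> R,  F_i = (+)_j R(-d_i j) *)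
Definition min_free_res3 (I : R -> Prop) (r1 r2 r3 : nat)
    (d1 : 'I_r1 -> nat) (d2 : 'I_r2 -> nat) (d3 : 'I_r3 -> nat)
    (f1 : 'M[R]_(1, r1)) (f2 : 'M[R]_(r1, r2)) (f3 : 'M[R]_(r2, r3)) : Prop :=
  (forall j, graded_entry (f1 0 j) 0 (d1 j)) /\
  (forall i j, graded_entry (f2 i j) (d1 i) (d2 j)) /\
  (forall i j, graded_entry (f3 i j) (d2 i) (d3 j)) /\
  (forall p, I p <-> exists v : 'cV[R]_r1, p = (f1 *m v) 0 0) /\
  f1 *m f2 = 0 /\ f2 *m f3 = 0 /\
  (forall v : 'cV[R]_r1, f1 *m v = 0 -> exists w : 'cV[R]_r2, v = f2 *m w) /\
  (forall v : 'cV[R]_r2, f2 *m v = 0 -> exists w : 'cV[R]_r3, v = f3 *m w) /\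
  (forall v : 'cV[R]_r3, f3 *m v = 0 -> v = 0).

Definition regular_seq3 (f1 f2 f3 : R) : Prop :=
  (forall g : R, f1 * g = 0 -> g = 0) /\
  (forall g : R, in_ideal [:: f1] (f2 * g) -> in_ideal [:: f1] g) /\
  (forall g : R, in_ideal [:: f1; f2] (f3 * g) -> in_ideal [:: f1; f2] g) /\
  ~ in_ideal [:: f1; f2; f3] 1.

Definition grade_three (I : R -> Prop) : Prop :=
  ~ I 1 /\ exists f1 f2 f3 : R, I f1 /\ I f2 /\ I f3 /\ regular_seq3 f1 f2 f3.

Definition in_socle (I : R -> Prop) (f : R) : Prop :=
  I (var 0 * f) /\ I (var 1 * f) /\ I (var 2 * f).

(* R/I (Artinian, graded local) is Gorenstein: its socle is 1-dimensional *)
Definition gorenstein_quotient (I : R -> Prop) : Prop :=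
  exists s : R, ~ I s /\ in_socle I s /\
    forall f : R, in_socle I f -> exists c : k, I (f - c%:MP * s).

Definition grade_three_gorenstein (I : R -> Prop) : Prop :=
  grade_three I /\ gorenstein_quotient I.

Variable n : nat.
Variable phi : 'X_{1..3} -> k.

Definition Jann : R -> Prop := ann (n.*2.-1) phi.
Definition Iann : R -> Prop := ann (n.*2 - 2) (contract (n.*2.-1) (var 0) phi).

Definition mon3 (a b c : nat) : R := var 0 ^+ a * var 1 ^+ b * var 2 ^+ c.

(* ordered monomial basis of Sym_d U: x^a y^b z^c before x^al y^be z^ga
   iff al < a, or al = a and be < b *)
Definition basis_seq (d : nat) : seq R :=
  flatten [seq [seq mon3 (d - i) (i - j) j | j <- iota 0 i.+1] | i <- iota 0 d.+1].

Definition NN : nat := 'C(n.+1, 2).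
Definition mb (i : nat) : R := nth 0 (basis_seq n.-1) i.    (* m_{i+1} *)
Definition m0 (j : nat) : R := mon3 0 (n - j) j.             (* m_{0,j+1} *)

Definition pmat : 'M[k]_NN :=
  \matrix_(i < NN, j < NN) dual_eval (n.*2.-1) phi (var 0 * mb i * mb j).
Definition rmat : 'M[k]_(NN, n.+1) :=
  \matrix_(i < NN, j < n.+1) dual_eval (n.*2.-1) phi (mb i * m0 j).
Definition pinv : 'M[k]_NN := invmx pmat.

Definition liftk {a b : nat} (A : 'M[k]_(a, b)) : 'M[R]_(a, b) :=
  map_mx (fun c : k => c%:MP) A.

Definition rpr : 'M[k]_(n.+1) := rmat^T *m pinv *m rmat.
Definition A0 : 'M[k]_n := \matrix_(i < n, j < n) mxf rpr i j.+1.
Definition Ap : 'M[k]_n := A0 - A0^T.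
Definition rp : 'M[k]_(n.+1, NN) := rmat^T *m pinv.
Definition B0 : 'M[k]_(n.+1, n) := \matrix_(i < n.+1, j < n) mxf rp i (NN - n + j).
Definition B1 : 'M[k]_(n, n.+1) :=
  \matrix_(i < n, j < n.+1)
    ((if j == 0 :> nat then 0 else mxf B0 i j.-1)
     - (if j == n :> nat then 0 else mxf B0 i.+1 j)).
Definition B2 : 'M[R]_(n, n.+1) :=
  \matrix_(i < n, j < n.+1)
    ((if j == i :> nat then var 2 else 0) - (if j == i.+1 :> nat then var 1 else 0)).
Definition Bm : 'M[R]_(n, n.+1) := var 0 *: liftk B1 + B2.
Definition Qm : 'M[k]_n := \matrix_(i < n, j < n) mxf pinv (NN - n + i) (NN - n + j).
Definition D0 : 'M[k]_(n.+1) :=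
  \matrix_(i < n.+1, j < n.+1) (if ((i < n) && (0 < j))%N then mxf Qm i j.-1 else 0).
Definition Dm : 'M[R]_(n.+1) := var 0 *: liftk (D0 - D0^T).

Definition b2 : 'M[R]_(n + n.+1) := block_mx (var 0 *: liftk Ap) Bm (- Bm^T) Dm.
Definition b1 : 'M[R]_(1, n + n.+1) := signed_pfaffians b2.
Definition b3 : 'M[R]_(n + n.+1, 1) := b1^T.

Definition gJ : seq R := [seq mxf b1 0%N t | t <- iota n n.+1].

Definition c2 : 'M[R]_(n.+1) := Bm^T *m liftk (invmx Ap) *m Bm + var 0 *: Dm.
Definition c1 : 'M[R]_(1, n.+1) := signed_pfaffians c2.
Definition c3 : 'M[R]_(n.+1, 1) := c1^T.

End Defs.

(* Main.v *)
Require Import Defs.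
From HB Require Import structures.
From mathcomp Require Import all_boot all_order all_algebra.
From mathcomp Require Import mpoly.
From mathcomp Require Import ring zify.
From Stdlib Require Import Classical_Prop.

Set Implicit Arguments.
Unset Strict Implicit.
Unset Printing Implicit Defensive.

Import Order.TTheory GRing.Theory.
Local Open Scope ring_scope.

(** Write [E] for the functional [Phi], [m_l] for the monomials of degree [n-1] and
    [ms_l] for the basis dual to them under the form [E(x f g)], which is nondegenerate
    by the Lefschetz hypothesis.  Let [G_j = m_{0,j} - x L_j] be the elements of [J_n]
    lifting the monomials of degree [n] in [y, z], and let [mus_c] be the [ms_l] for the
    [n] monomials [mum_c] free of [x].  The row [h = [x mus | G]] satisfies [h b2 = 0]:
    dividing each relation by [x] leaves a form of degree [n-1], which is determined by
    pairing it with all monomials.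

    Exactness at every spot is proved by [x]-adic descent: all maps are homogeneous and [x]
    is a nonzerodivisor, so it is enough to lift a cycle to a boundary modulo [x], where the
    matrices are explicit in [y] and [z].  Division with remainder by [G] gives
    [I = (x mus, G)] and [J = (x^2 mus, G)].  The signed Pfaffians of [b2] span the same
    rank one kernel as [h], so they agree with [h] up to a constant, which is nonzero by
    evaluation at the point [(0,0,1)].  If [A'] is invertible then [x^2 mus] is in [(G)] and
    eliminating the first block of [b2] gives [c2]; a kernel vector of [A'] is a linear
    syzygy among the minimal generators [G] of [J]. *)

(** * Pfaffians *)

(** Modulo [x] the matrix [b2] is block antidiagonal with blocks [B2] and its negative transpose,
    and [h] becomes [[0 | y^n, ..., z^n]]: the data of the Hilbert-Burch resolution of [(y,z)^n].
    This settles the kernels of [b2] and [c2], but not that of [h], whose first block dies modulo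
    [x] while [B2] is not onto there. The missing information comes from a genuine cycle: once its
    second block is made divisible by [x], cancelling [x] leaves [mus a + G g = 0], and pairing with
    [E], which kills multiples of the [G_j], forces [a] into the image of [B2] modulo [x].

    The Lefschetz hypothesis and [J_{n-1} = 0] act through the invertibility of [p]. No Pfaffian is
    computed over [R]: what matters is that the Pfaffian row annihilates its matrix, has entries of
    degree [n], and has a last entry that is nonzero at [(0,0,1)], where [B] becomes [[I | 0]]. The
    characteristic may be two, so alternating always means antisymmetric with zero diagonal, and
    both halves are carried along. *)

Section ListPfaffian.
Variables (T : comNzRingType) (S : Type) (a : S -> S -> T).

(* [pder x F l] is the sum over the positions [j] of [l] of
   [(-1)^j a x l_j F (l without position j)]. *)
Fixpoint pder (x : S) (F : seq S -> T) (l : seq S) : T :=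
  if l is y :: l' then a x y * F l' - pder x (fun t => F (y :: t)) l' else 0.

(** The Pfaffian of the submatrix indexed by a list, in list order; it is 0 if [N] is not the
    length. With lists, swapped and repeated indices become easy to express, unlike with the nested
    reindexing by [skip2] in [pf]. *)
Fixpoint pfl (N : nat) (l : seq S) {struct N} : T :=
  match N, l with
  | 0, [::] => 1
  | N'.+2, x :: l' => pder x (pfl N') l'
  | _, _ => 0
  end.

Lemma eq_pder x F1 F2 l : F1 =1 F2 -> pder x F1 l = pder x F2 l.
Proof. by elim: l F1 F2 => //= y l IH F1 F2 e; rewrite e (IH _ (fun t => F2 (y :: t))). Qed.

Lemma pderB x F1 F2 l : pder x (fun t => F1 t - F2 t) l = pder x F1 l - pder x F2 l.
Proof. by elim: l F1 F2 => [|y l IH] F1 F2 /=; rewrite ?subr0 // IH; ring. Qed.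

Lemma pderZ x c F l : pder x (fun t => c * F t) l = c * pder x F l.
Proof. by elim: l F => [|y l IH] F /=; rewrite ?mulr0 // IH; ring. Qed.

Lemma pder0 x F l : (forall t, F t = 0) -> pder x F l = 0.
Proof. by elim: l F => [|y l IH] F e //=; rewrite e IH ?mulr0 ?subr0. Qed.

Lemma pder_sum x F l y0 :
  pder x F l = \sum_(j < size l) (-1) ^+ j * a x (nth y0 l j) * F (take j l ++ drop j.+1 l).
Proof.
elim: l F => [|y l IH] F /=; first by rewrite big_ord0.
rewrite big_ord_recl /= drop0 expr0 mul1r IH -sumrN; congr (_ + _).
by apply: eq_bigr => i _; rewrite exprS; ring.
Qed.

(** [pder x] acts as contraction with the linear form [a x], and contractions anticommute whatever
    [a] is. *)
Lemma pder_pder x y F l : pder x (pder y F) l = - pder y (pder x F) l.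
Proof.
elim: l F => [|w l IH] F /=; first by rewrite oppr0.
by rewrite !pderB !pderZ IH; ring.
Qed.

(** Anticommutation alone does not give this in characteristic two. *)
Lemma pder_pder_same x F l : pder x (pder x F) l = 0.
Proof. by elim: l F => [|w l IH] F //=; rewrite !pderB !pderZ IH; ring. Qed.

Definition alternating_list (F : seq S -> T) :=
  (forall l1 x y l2, F (l1 ++ x :: y :: l2) = - F (l1 ++ y :: x :: l2)) /\
  (forall l1 x l2, F (l1 ++ x :: x :: l2) = 0).

Lemma alternating_pder w F : alternating_list F -> alternating_list (pder w F).
Proof.
move=> [Fs Fz]; split.
- move=> l1 x y l2; elim: l1 F Fs {Fz} => [|u l1 IH] F Fs /=.
    have -> : pder w (fun t => F [:: x, y & t]) l2 = - pder w (fun t => F [:: y, x & t]) l2.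
      rewrite -mulN1r -pderZ; apply: eq_pder => t.
      by rewrite (Fs [::] x y) mulN1r.
    by ring.
  rewrite Fs (IH (fun t => F (u :: t))); first by ring.
  by move=> l1' x' y' l2'; rewrite (Fs (u :: l1')).
- move=> l1 x l2; elim: l1 F Fs Fz => [|u l1 IH] F Fs Fz /=.
    by rewrite (@pder0 _ (fun t => F [:: x, x & t])) => [|t]; [ring | exact: (Fz [::])].
  rewrite Fz (IH (fun t => F (u :: t))) ?mulr0 ?subr0 //.
    by move=> l1' x' y' l2'; rewrite (Fs (u :: l1')).
  by move=> l1' x' l2'; rewrite (Fz (u :: l1')).
Qed.

Hypothesis aN : forall x y, a x y = - a y x.
Hypothesis a0 : forall x, a x x = 0.

Lemma pfl2 N x y l :
  pfl N.+2 (x :: y :: l) = a x y * pfl N l -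
    (if N is N'.+2 then pder x (pder y (pfl N')) l else 0).
Proof.
rewrite /=; case: N => [|[|N]] //=; rewrite ?(@pder0 _ (fun=> 0)) ?subr0 //.
Qed.

(** For the first two entries, both terms of [pfl2] change sign, the second one by anticommutation
    of contractions. A swap further right happens inside the list given to [pder], where induction
    applies. *)
Lemma alternating_pfl N : alternating_list (pfl N).
Proof.
elim/ltn_ind: N => -[|[|N]] IH.
- by split=> [[|u l1] x y l2|[|u l1] x l2]; rewrite /= ?oppr0.
- by split=> *; rewrite /= ?oppr0.
- split=> [[|u l1] x y l2|[|u l1] x l2].
  + rewrite !cat0s !pfl2 aN; case: N {IH} => [|[|N]]; try by ring.
    by rewrite pder_pder; ring.
  + by apply: (alternating_pder u (IH N _)).1.
  + by rewrite cat0s pfl2 a0; case: N {IH} => [|[|N]]; rewrite ?pder_pder_same; ring.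
  + by apply: (alternating_pder u (IH N _)).2.
Qed.

Lemma alternating_repeat F l1 x l2 l3 : alternating_list F ->
  F (l1 ++ x :: l2 ++ x :: l3) = 0.
Proof.
move=> [Fs Fz]; elim: l2 l1 => [|y l2 IH] l1; first exact: Fz.
by rewrite /= Fs -cat_rcons IH oppr0.
Qed.

End ListPfaffian.

Lemma eq_pder_in (T : comNzRingType) (S : Type) (a : S -> S -> T) x F1 F2 l :
  (forall t, (size t).+1 = size l -> F1 t = F2 t) -> pder a x F1 l = pder a x F2 l.
Proof.
elim: l F1 F2 => //= y l IH F1 F2 e; rewrite e // (IH _ (fun t => F2 (y :: t))) //.
by move=> t et; apply: e => /=; rewrite et.
Qed.

Lemma pf_ext (T : comNzRingType) N (a b : nat -> nat -> T) :
  (forall p q, (p < N)%N -> (q < N)%N -> a p q = b p q) -> pf N a = pf N b.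
Proof.
elim/ltn_ind: N a b => -[|[|N]] IH a b e //=.
apply: eq_bigr => j _; rewrite e //; last by rewrite ltnS ltn_ord.
congr (_ * _); apply: IH => // p q lp lq; apply: e; rewrite /skip2; case: ifP; lia.
Qed.

Lemma pf_pfl (T : comNzRingType) (S : Type) (a : S -> S -> T) (x0 : S) N l :
  size l = N -> pf N (fun p q => a (nth x0 l p) (nth x0 l q)) = pfl a N l.
Proof.
elim/ltn_ind: N l => -[|[|N]] IH [|x l] //= [sl].
rewrite (@eq_pder_in _ _ _ _ _ (fun t => pf N (fun p q => a (nth x0 t p) (nth x0 t q)))).
  rewrite (pder_sum _ _ _ _ x0) sl; apply: eq_bigr => j _; congr (_ * _).
  apply: pf_ext => p q _ _.
  (* Deleting positions [0] and [j+1] from [x :: l] amounts to deleting position [j] from [l]. *)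
  have H r : nth x0 (x :: l) (skip2 j r) = nth x0 (take j l ++ drop j.+1 l) r.
    rewrite /skip2 nth_cat size_take sl ltn_ord; case: ifP => lr /=.
      by rewrite nth_take.
    by rewrite nth_drop; congr nth; lia.
  by rewrite -!H.
by move=> t; rewrite sl => -[st]; rewrite IH.
Qed.

Lemma mxf_ord (T : nmodType) a b (A : 'M[T]_(a, b)) (i : 'I_a) (j : 'I_b) : mxf A i j = A i j.
Proof. by rewrite /mxf !valK. Qed.

Lemma mxf_alt (T : comNzRingType) N (A : 'M[T]_N) :
  A^T = - A -> (forall i, A i i = 0) ->
  (forall p q, mxf A p q = - mxf A q p) /\ (forall p, mxf A p p = 0).
Proof.
move=> AT A0; split=> [p q|p]; rewrite /mxf.
  case: insubP => [i _ _|_]; case: insubP => [j _ _|_]; rewrite ?oppr0 //.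
  by move/matrixP/(_ j i): AT; rewrite !mxE.
by case: insubP => [i _ _|].
Qed.

Lemma del_nth N j p : (j <= N)%N -> (p < N)%N ->
  del j p = nth 0%N (take j (iota 0 N.+1) ++ drop j.+1 (iota 0 N.+1)) p.
Proof.
move=> lj lp; rewrite nth_cat size_take size_iota /del.
have -> : (if (j < N.+1)%N then j else N.+1) = j by case: ifP; lia.
case: ifP => h; first by rewrite nth_take // nth_iota; lia.
by rewrite nth_drop nth_iota; lia.
Qed.

(** Entry [i] of the product is, up to sign, the expansion along its first index of the Pfaffian of
    the list [i, 0, ..., N]; it vanishes because [i] occurs twice. *)
Lemma signed_pfaffians_mul (T : comNzRingType) N (A : 'M[T]_N) :
  A^T = - A -> (forall i, A i i = 0) -> signed_pfaffians A *m A = 0.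
Proof.
move=> AT A0; have [aN a0] := mxf_alt AT A0.
case: N A AT A0 aN a0 => [|N] A AT A0 aN a0; first by apply/matrixP=> i [].
apply/rowP => i; rewrite !mxE.
transitivity (- pder (mxf A) i (pfl (mxf A) N) (iota 0 N.+1)).
  rewrite (pder_sum _ _ _ _ 0%N) size_iota -sumrN; apply: eq_bigr => j _.
  rewrite !mxE nth_iota // add0n -mulrA -[A j i]mxf_ord aN.
  have -> : pf N (fun p q => mxf A (del j p) (del j q)) =
    pfl (mxf A) N (take j (iota 0 N.+1) ++ drop j.+1 (iota 0 N.+1)).
    rewrite -(@pf_pfl _ _ _ 0%N) ?size_cat ?size_take ?size_drop ?size_iota ?ltn_ord; last first.
      by have := ltn_ord j; lia.
    apply: pf_ext => p q lp lq; rewrite (@del_nth N j p) ?(@del_nth N j q) //.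
    + by have := ltn_ord j; lia.
    + by have := ltn_ord j; lia.
  by ring.
have -> : pder (mxf A) i (pfl (mxf A) N) (iota 0 N.+1) = pfl (mxf A) N.+2 ((i : nat) :: iota 0 N.+1) by [].
have: (i : nat) \in iota 0 N.+1 by rewrite mem_iota /= add0n.
case/splitPr=> l1 l2.
have := alternating_repeat [::] (i : nat) l1 l2 (alternating_pfl aN a0 N.+2).
by rewrite cat0s => ->; rewrite oppr0.
Qed.

(** * Alternating forms in any characteristic *)

Section AlternatingForm.
Variables (T : comNzRingType) (S : Type) (a : S -> S -> T).
Hypothesis aN : forall x y, a x y = - a y x.
Hypothesis a0 : forall x, a x x = 0.

Lemma alternating_form0 (c : S -> T) l :
  \sum_(i <- l) c i * (\sum_(j <- l) a i j * c j) = 0.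
Proof.
elim: l => [|x l IH]; first by rewrite big_nil.
rewrite !big_cons a0 mul0r add0r.
rewrite [X in _ + X](eq_bigr (fun i => - (c x * (a x i * c i)) + c i * (\sum_(j <- l) a i j * c j))).
  by rewrite big_split /= IH addr0 sumrN mulr_sumr subrr.
by move=> i _; rewrite big_cons (aN i x); ring.
Qed.

End AlternatingForm.

(** Antisymmetry of a congruent matrix does not give a zero diagonal in characteristic two; this
    supplies it for the inverse of [A'] and for [c2]. *)
Lemma alt_congruence_diag (T : comNzRingType) l m (P : 'M[T]_(l, m)) (A : 'M[T]_m) i :
  A^T = - A -> (forall j, A j j = 0) -> (P *m A *m P^T) i i = 0.
Proof.
move=> AT A0; rewrite -mulmxA mxE.
have aN p q : A p q = - A q p by have /matrixP/(_ q p) := AT; rewrite !mxE.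
rewrite -[RHS](alternating_form0 aN A0 (P i) (index_enum _)); apply: eq_bigr => p _.
by rewrite mxE; congr (_ * _); apply: eq_bigr => q _; rewrite mxE.
Qed.

(** * Nonvanishing of the Pfaffian of a nondegenerate alternating form *)

Section PfaffianNonzero.
Variables (k : fieldType) (S : eqType) (a : S -> S -> k).
Hypothesis aN : forall x y, a x y = - a y x.
Hypothesis a0 : forall x, a x x = 0.

(** Injectivity of the Gram matrix indexed by [l]. Vectors are functions on all of [S], so that
    removing indices needs no renumbering. *)
Definition nondegenerate (l : seq S) := forall c : S -> k,
  (forall i, i \in l -> \sum_(j <- l) a i j * c j = 0) -> forall j, j \in l -> c j = 0.

Lemma nondegenerate_solve l (b : S -> k) : uniq l -> nondegenerate l ->
  exists c : S -> k, forall i, i \in l -> \sum_(j <- l) a i j * c j = b i.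
Proof.
case: l => [|x0 l0] ul nl; first by exists (fun=> 0).
move: (x0 :: l0) ul nl => l ul nl.
pose A := \matrix_(i < size l, j < size l) a (nth x0 l i) (nth x0 l j).
have ix (i : 'I_(size l)) : index (nth x0 l i) l = i by rewrite index_uniq.
have Au : A \in unitmx.
  rewrite -unitmx_tr -row_free_unit; apply: inj_row_free => v vA.
  pose c x := mxf v 0%N (index x l).
  suff H : forall j, j \in l -> c j = 0.
    apply/rowP => j; rewrite !mxE -(H (nth x0 l j)) ?mem_nth //.
    by rewrite /c ix -(mxf_ord v ord0 j).
  apply: nl => i il; move/rowP/(_ (Ordinal (etrans (index_mem i l) il))): vA.
  rewrite !mxE => vi; rewrite -[RHS]vi (big_nth x0) big_mkord; apply: eq_bigr => j _.
  by rewrite !mxE /= nth_index // mulrC /c ix -[0%N]/(nat_of_ord (@ord0 0)) mxf_ord.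
have [w Aw] : exists w, A *m w = \col_(i < size l) b (nth x0 l i).
  by exists (invmx A *m \col_(i < size l) b (nth x0 l i)); rewrite mulKVmx.
exists (fun x => mxf w (index x l) 0%N) => i il.
move/colP/(_ (Ordinal (etrans (index_mem i l) il))): Aw.
rewrite !mxE /= nth_index // => wi; rewrite -[RHS]wi (big_nth x0) big_mkord; apply: eq_bigr => j _.
by rewrite ix -[0%N]/(nat_of_ord (@ord0 0)) mxf_ord !mxE /= nth_index.
Qed.

Lemma alternating_formC (c d : S -> k) l :
  \sum_(i <- l) d i * (\sum_(j <- l) a i j * c j) =
  - \sum_(i <- l) c i * (\sum_(j <- l) a i j * d j).
Proof.
under eq_bigr do rewrite mulr_sumr.
rewrite exchange_big /= -sumrN; apply: eq_bigr => j _.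
by rewrite mulr_sumr -sumrN; apply: eq_bigr => i _; rewrite (aN i j); ring.
Qed.

Lemma sum_delta (c : S -> k) l x : uniq l -> x \in l ->
  \sum_(i <- l) c i * (i == x)%:R = c x.
Proof.
move=> ul xl; rewrite (bigD1_seq x) //= eqxx mulr1 big1 ?addr0 // => i /negPf ->.
by rewrite mulr0.
Qed.

(** Here [c] is column [x] of the inverse Gram matrix, which is alternating, so its minor on [x, y]
    is [c y ^ 2]: an instance of the complementary minor identity. Concretely, a kernel vector of
    the smaller matrix, extended by zero, is a combination of columns [x] and [y] of the inverse,
    and its vanishing coordinates at [x] and [y] kill both coefficients. *)
Lemma nondegenerate_remove x y l : uniq l -> x \in l -> y \in l -> nondegenerate l ->
  forall c, (forall i, i \in l -> \sum_(j <- l) a i j * c j = (i == x)%:R) -> c y != 0 ->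
  nondegenerate (rem y (rem x l)).
Proof.
move=> ul xl yl nl cx Hx cxy.
have cxx : cx x = 0.
  rewrite -(alternating_form0 aN a0 cx l) -(sum_delta cx ul xl) big_seq [RHS]big_seq.
  by apply: eq_bigr => i il; rewrite Hx.
have nyx : y != x by apply: contraNneq cxy => ->; rewrite cxx.
have [cy Hy] := nondegenerate_solve (fun i => (i == y)%:R) ul nl.
have cyy : cy y = 0.
  rewrite -(alternating_form0 aN a0 cy l) -(sum_delta cy ul yl) big_seq [RHS]big_seq.
  by apply: eq_bigr => i il; rewrite Hy.
have cyx : cy x = - cx y.
  rewrite -(sum_delta cy ul xl) -(sum_delta cx ul yl) big_seq.
  under eq_bigr => i il do rewrite -Hx //.
  rewrite -big_seq alternating_formC big_seq.
  under eq_bigr => i il do rewrite Hy //.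
  by rewrite -big_seq.
have ylx : y \in rem x l by rewrite mem_rem_uniq // inE nyx.
have inR i : (i \in rem y (rem x l)) = [&& i != y, i != x & i \in l].
  by rewrite mem_rem_uniq ?rem_uniq // inE mem_rem_uniq // inE.
move=> v Hv j jl.
pose v' i := if (i == x) || (i == y) then 0 else v i.
have Sv i : \sum_(j <- l) a i j * v' j = \sum_(j <- rem y (rem x l)) a i j * v j.
  rewrite (big_rem x) //= (big_rem y) //= /v' !eqxx orbT !mulr0 !add0r /=.
  rewrite big_seq [RHS]big_seq; apply: eq_bigr => u.
  by rewrite inR => /and3P[/negPf-> /negPf-> _].
pose al := \sum_(j <- l) a x j * v' j; pose be := \sum_(j <- l) a y j * v' j.
have E i : i \in l -> v' i = al * cx i + be * cy i.
  move=> il; apply/eqP; rewrite -subr_eq0; apply/eqP.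
  apply: (nl (fun i => v' i - (al * cx i + be * cy i))) il => {}i il.
  under eq_bigr => u _ do rewrite mulrBr mulrDr mulrCA [X in _ - (_ + X)]mulrCA.
  rewrite sumrB big_split /= -!mulr_sumr Hx // Hy //.
  have [->|nix] := eqVneq i x; first by rewrite ?eqxx [x == y]eq_sym (negPf nyx) /al /=; ring.
  have [->|niy] := eqVneq i y; first by rewrite ?eqxx ?(negPf nyx) /be /=; ring.
  by rewrite Sv Hv ?inR ?nix ?niy //= !mulr0 addr0 subr0.
have Ex := E _ xl; have Ey := E _ yl.
move: Ex Ey; rewrite /v' !eqxx orbT /= cxx cyy cyx => /eqP Ex /eqP Ey.
move: Ex Ey; rewrite !mulr0 add0r addr0 mulrN eq_sym oppr_eq0 mulf_eq0 (negPf cxy) orbF => /eqP be0.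
rewrite eq_sym mulf_eq0 (negPf cxy) orbF => /eqP al0.
move: jl; rewrite inR => /and3P[jy jx jl].
by have := E _ jl; rewrite /v' (negPf jx) (negPf jy) /= al0 be0 !mul0r addr0.
Qed.

(** If the Pfaffian of [x :: l] vanished, the signed Pfaffians of [l] with one index removed, with 0
    at [x], would form a kernel vector: pairing with an index of [l] repeats that index, and pairing
    with [x] gives the Pfaffian itself. So all of them would vanish, while [nondegenerate_remove]
    and induction provide a nonzero one. *)
Lemma pfl_neq0 l : uniq l -> ~~ odd (size l) -> nondegenerate l -> pfl a (size l) l != 0.
Proof.
move sm: (size l) => m; elim/ltn_ind: m l sm => -[|[|N]] IH [|x l] //=.
- by move=> *; rewrite oner_eq0.
move=> [sl] /andP[xl ul] /negPn oN nl; apply/negP => /eqP P0.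
have ul' : uniq (x :: l) by rewrite /= xl.
have xx : x \in x :: l by rewrite inE eqxx.
have Hi i : i \in x :: l -> pder a i (pfl a N) l = 0.
  rewrite inE => /orP[/eqP->//|il].
  have [l1 [l2 ->]] : exists l1 l2, l = l1 ++ i :: l2 by case/splitPr: il => l1 l2; exists l1, l2.
  by have := alternating_repeat [::] i l1 l2 (alternating_pfl aN a0 N.+2); rewrite cat0s.
pose c w := if w == x then 0 else (-1) ^+ index w l * pfl a N (rem w l).
have c0 : forall j, j \in x :: l -> c j = 0.
  apply: nl => i il; rewrite big_cons {1}/c eqxx mulr0 add0r -[RHS](Hi i il).
  rewrite (pder_sum _ _ _ _ x) (big_nth x) big_mkord; apply: eq_bigr => j _.
  have njx : nth x l j != x by apply: contraNneq xl => <-; rewrite mem_nth.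
  rewrite /c (negPf njx) index_uniq // remE index_uniq //; ring.
have [d Hd] := nondegenerate_solve (fun i => (i == x)%:R) ul' nl.
have [y yl dy] : exists2 y, y \in l & d y != 0.
  apply/hasP; apply/negPn/negP => /hasPn H.
  have := Hd x xx; rewrite big_cons a0 mul0r add0r eqxx big_seq big1.
    by move/eqP; rewrite eq_sym oner_eq0.
  by move=> i /H; rewrite negbK => /eqP->; rewrite mulr0.
have yxl : y \in x :: l by rewrite inE yl orbT.
have := nondegenerate_remove ul' xx yxl nl Hd dy; rewrite /= eqxx => nr.
have := c0 y yxl; rewrite /c; case: eqP => [yx|_ /eqP]; first by rewrite -yx yl in xl.
rewrite mulf_eq0 signr_eq0 /=; apply/negP.
have sr : size (rem y l) = N by rewrite size_rem // sl.
by rewrite -{1}sr; apply: IH; rewrite ?rem_uniq ?sr //; apply/negP.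
Qed.

End PfaffianNonzero.

Lemma pf_neq0 (k : fieldType) N (A : 'M[k]_N) (a : nat -> nat -> k) :
  ~~ odd N -> A^T = - A -> (forall i, A i i = 0) -> A \in unitmx ->
  (forall i j : 'I_N, a i j = A i j) -> pf N a != 0.
Proof.
move=> oN AT A0 Au Ea; have [aN a0] := mxf_alt AT A0.
rewrite (@pf_ext _ _ a (fun p q => mxf A (nth 0%N (iota 0 N) p) (nth 0%N (iota 0 N) q))); last first.
  by move=> p q lp lq; rewrite !nth_iota // !add0n (Ea (Ordinal lp) (Ordinal lq)) -mxf_ord.
rewrite pf_pfl ?size_iota //; move: (@pfl_neq0 _ _ (mxf A) aN a0 (iota 0 N)).
rewrite size_iota; apply=> //; first exact: iota_uniq.
move=> c Hc j; rewrite mem_iota add0n /= => jN.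
have E : A *m (\col_(i < N) c i) = 0.
  apply/colP => i; rewrite !mxE -[RHS](Hc i); last by rewrite mem_iota add0n /=.
  have -> : iota 0 N = index_iota 0 N by rewrite /index_iota subn0.
  rewrite big_mkord.
  by apply: eq_bigr => u _; rewrite mxE mxf_ord.
have /colP/(_ (Ordinal jN)) : \col_(i < N) c i = 0 :> 'cV_N by rewrite -(mulKmx Au (\col_(i < N) c i)) E mulmx0.
by rewrite !mxE.
Qed.

Lemma rmorph_pf (T T' : comNzRingType) (f : {rmorphism T -> T'}) N (a : nat -> nat -> T) :
  f (pf N a) = pf N (fun p q => f (a p q)).
Proof.
elim/ltn_ind: N a => -[|[|N]] IH a /=; rewrite ?rmorph1 ?rmorph0 //.
rewrite rmorph_sum; apply: eq_bigr => j _.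
by rewrite !rmorphM rmorphXn rmorphN1 IH.
Qed.

(** * Monomial ideals of [k[x,y,z]] *)

Section Monomials.
Variable k : fieldType.
Local Notation R := (poly3 k).
Local Notation x := (var k 0).
Local Notation y := (var k 1).
Local Notation z := (var k 2).

Definition mn3 (a b c : nat) : 'X_{1..3} :=
  locked (U_(inord 0) *+ a + U_(inord 1) *+ b + U_(inord 2) *+ c)%MM.

Lemma mn3E a b c (i : 'I_3) : mn3 a b c i = nth 0%N [:: a; b; c] i.
Proof.
rewrite /mn3 -lock !mnmDE !mulmnE !mnm1E.
by case: i => [[|[|[|i]]] Hi] //=; rewrite -!val_eqE /= !inordK //= ?mul0n ?mul1n ?addn0 ?add0n.
Qed.

Lemma mn3E0 a b c : mn3 a b c (inord 0) = a. Proof. by rewrite mn3E inordK. Qed.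
Lemma mn3E1 a b c : mn3 a b c (inord 1) = b. Proof. by rewrite mn3E inordK. Qed.
Lemma mn3E2 a b c : mn3 a b c (inord 2) = c. Proof. by rewrite mn3E inordK. Qed.

Lemma mn3_eta (m : 'X_{1..3}) : m = mn3 (m (inord 0)) (m (inord 1)) (m (inord 2)).
Proof.
apply/mnmP => i; rewrite mn3E.
by case: i => [[|[|[|i]]] Hi] //=; congr (m _); apply/val_inj; rewrite /= inordK.
Qed.

Lemma mdeg_mn3 a b c : mdeg (mn3 a b c) = (a + b + c)%N.
Proof. by rewrite /mn3 -lock !mdegD !mdegMn !mdeg1 !mul1n. Qed.

Lemma mdeg3 (m : 'X_{1..3}) : mdeg m = (m (inord 0) + m (inord 1) + m (inord 2))%N.
Proof. by rewrite {1}[m]mn3_eta mdeg_mn3. Qed.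

Lemma mn3_inj a b c a' b' c' : mn3 a b c = mn3 a' b' c' -> [/\ a = a', b = b' & c = c'].
Proof.
move=> e; split.
- by rewrite -(mn3E0 a b c) e mn3E0.
- by rewrite -(mn3E1 a b c) e mn3E1.
- by rewrite -(mn3E2 a b c) e mn3E2.
Qed.

Lemma mn3D a b c a' b' c' : (mn3 a b c + mn3 a' b' c')%MM = mn3 (a + a') (b + b') (c + c').
Proof. by apply/mnmP => i; rewrite mnmDE !mn3E; case: i => [[|[|[|i]]] Hi]. Qed.

Lemma lem_mn3 a b c (m : 'X_{1..3}) :
  (mn3 a b c <= m)%MM = [&& a <= m (inord 0), b <= m (inord 1) & c <= m (inord 2)]%N.
Proof.
apply/mnm_lepP/and3P => [H|[H0 H1 H2] i].
  by have := H (inord 0); have := H (inord 1); have := H (inord 2); rewrite mn3E0 mn3E1 mn3E2.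
rewrite [m]mn3_eta !mn3E.
by case: i => [[|[|[|i]]] Hi].
Qed.

Lemma mon3E a b c : mon3 k a b c = 'X_[mn3 a b c].
Proof. by rewrite /mon3 /mn3 -lock !mpolyXD -!mpolyXn. Qed.

Lemma varx : x = 'X_[mn3 1 0 0]. Proof. by rewrite -mon3E /mon3 !expr0 !mulr1. Qed.
Lemma vary : y = 'X_[mn3 0 1 0]. Proof. by rewrite -mon3E /mon3 !expr0 mulr1 mul1r. Qed.
Lemma varz : z = 'X_[mn3 0 0 1]. Proof. by rewrite -mon3E /mon3 !expr0 !mul1r. Qed.

Lemma mcoeffXM (p : R) m u : ('X_[m] * p)@_(m + u) = p@_u.
Proof. by rewrite mulrC mcoeffMX. Qed.

Lemma mcoeffXM0 (p : R) m u : ~~ (m <= u)%MM -> ('X_[m] * p)@_u = 0.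
Proof.
move=> nmu; apply/eqP; apply: contraNT nmu; rewrite -mcoeff_msupp mulrC => /msuppM_le.
by case/allpairsP=> -[u1 u2] /= [_]; rewrite msuppX inE => /eqP-> ->; apply: lem_addl.
Qed.

Lemma in_ideal0 s : in_ideal s (0 : R).
Proof. by exists (fun=> 0); rewrite big1 // => i _; rewrite mul0r. Qed.

Lemma in_idealD s (p q : R) : in_ideal s p -> in_ideal s q -> in_ideal s (p + q).
Proof.
move=> [c ->] [d ->]; exists (fun i => c i + d i); rewrite -big_split /=.
by apply: eq_bigr => i _; rewrite mulrDl.
Qed.

Lemma in_idealM s (p q : R) : in_ideal s p -> in_ideal s (q * p).
Proof.
move=> [c ->]; exists (fun i => q * c i); rewrite mulr_sumr.
by apply: eq_bigr => i _; rewrite mulrA.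
Qed.

Lemma in_ideal_mem s (p : R) : p \in s -> in_ideal s p.
Proof.
move=> ps; have lt := ps; rewrite -index_mem in lt.
exists (fun i => (i == Ordinal lt)%:R); rewrite (bigD1 (Ordinal lt)) //= eqxx mul1r nth_index //.
by rewrite big1 ?addr0 // => i /negPf ->; rewrite mul0r.
Qed.

Lemma in_ideal_sum s (I : Type) (r : seq I) (P : pred I) (F : I -> R) :
  (forall i, P i -> in_ideal s (F i)) -> in_ideal s (\sum_(i <- r | P i) F i).
Proof.
move=> H; apply: (big_ind (in_ideal s)) => //; [exact: in_ideal0|exact: in_idealD].
Qed.

Lemma in_ideal_sub s t (p : R) : (forall q, q \in s -> in_ideal t q) -> in_ideal s p -> in_ideal t p.
Proof.
move=> H [c ->]; apply: in_ideal_sum => i _; apply: in_idealM; apply: H.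
by rewrite mem_nth.
Qed.

Lemma in_mono_idealP (s : seq 'X_{1..3}) (p : R) :
  in_ideal [seq 'X_[m] | m <- s] p <-> (forall m, p@_m != 0 -> has (fun u => (u <= m)%MM) s).
Proof.
split=> [[c ->] m|H].
  apply: contraR => /hasPn H; rewrite raddf_sum big1 //= => i _.
  have Hi : (i < size s)%N by case: i => i /= h; rewrite size_map in h.
  by rewrite (nth_map 0%MM) // mulrC mcoeffXM0 // H // mem_nth.
rewrite [p]mpolyE big_seq; apply: in_ideal_sum => m; rewrite mcoeff_msupp => /H /hasP[u us um].
rewrite -mul_mpolyC -(submK um) mpolyXD mulrA; apply/in_idealM/in_ideal_mem.
by apply/mapP; exists u.
Qed.

(** The hypothesis makes the monomial with exponent [u] a nonzerodivisor modulo the monomial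
    ideal. *)
Lemma in_mono_ideal_cancel (s : seq 'X_{1..3}) u (p : R) :
  (forall m v, v \in s -> (v <= u + m)%MM -> (v <= m)%MM) ->
  in_ideal [seq 'X_[m] | m <- s] ('X_[u] * p) -> in_ideal [seq 'X_[m] | m <- s] p.
Proof.
move=> H /in_mono_idealP Hp; apply/in_mono_idealP => m pm.
have := Hp (u + m)%MM; rewrite mcoeffXM => /(_ pm) /hasP[v vs vm].
by apply/hasP; exists v => //; apply: H.
Qed.

Lemma in_ideal_cons s (q p : R) : in_ideal (q :: s) p <-> exists r t, in_ideal s t /\ p = r * q + t.
Proof.
split=> [[c ->]|[r [t [st ->]]]].
  rewrite big_ord_recl /=; exists (c ord0), (\sum_(i < size s) c (lift ord0 i) * s`_i).
  by split=> //; exists (fun i => c (lift ord0 i)).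
apply: in_idealD; first by apply/in_idealM/in_ideal_mem; rewrite inE eqxx.
by apply: in_ideal_sub st => u us; apply: in_ideal_mem; rewrite inE us orbT.
Qed.

Lemma in_ideal_nil (p : R) : in_ideal [::] p <-> p = 0.
Proof. by split=> [[c ->]|->]; [rewrite big_ord0 | exact: in_ideal0]. Qed.

Lemma in_ideal1 (q p : R) : in_ideal [:: q] p <-> exists r, p = q * r.
Proof.
split=> [/in_ideal_cons[r [t [/in_ideal_nil-> ->]]]|[r ->]].
  by exists r; rewrite addr0 mulrC.
by apply/in_ideal_cons; exists r, 0; split; [exact: in_ideal0 | rewrite addr0 mulrC].
Qed.

Lemma in_ideal2 (q1 q2 p : R) : in_ideal [:: q1; q2] p <-> exists r1 r2, p = q1 * r1 + q2 * r2.
Proof.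
split=> [/in_ideal_cons[r [t [/in_ideal1[r2 ->] ->]]]|[r1 [r2 ->]]].
  by exists r, r2; rewrite mulrC.
apply/in_ideal_cons; exists r1, (q2 * r2); split; last by rewrite mulrC.
by apply/in_ideal1; exists r2.
Qed.

Lemma in_ideal3 (q1 q2 q3 p : R) : in_ideal [:: q1; q2; q3] p <->
  exists r1 r2 r3, p = q1 * r1 + q2 * r2 + q3 * r3.
Proof.
split=> [/in_ideal_cons[r [t [/in_ideal2[r2 [r3 ->]] ->]]]|[r1 [r2 [r3 ->]]]].
  by exists r, r2, r3; rewrite mulrC addrA.
apply/in_ideal_cons; exists r1, (q2 * r2 + q3 * r3); split; last by rewrite mulrC addrA.
by apply/in_ideal2; exists r2, r3.
Qed.

(** * Congruences modulo [x] *)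

(** Congruence modulo [x] is stated as divisibility in [R], which avoids passing to a quotient
    ring. *)
Definition dvx (p : R) := exists q, p = x * q.

Lemma dvx0 : dvx 0. Proof. by exists 0; rewrite mulr0. Qed.
Lemma dvxx p : dvx (x * p). Proof. by exists p. Qed.
Lemma dvxD p q : dvx p -> dvx q -> dvx (p + q).
Proof. by move=> [a ->] [b ->]; exists (a + b); rewrite mulrDr. Qed.
Lemma dvxN p : dvx p -> dvx (- p).
Proof. by move=> [a ->]; exists (- a); rewrite mulrN. Qed.
Lemma dvxB p q : dvx p -> dvx q -> dvx (p - q).
Proof. by move=> dp dq; apply/dvxD/dvxN. Qed.
Lemma dvxM p q : dvx p -> dvx (q * p).
Proof. by move=> [a ->]; exists (q * a); rewrite mulrCA. Qed.
Lemma dvx_sum (I : Type) (r : seq I) (P : pred I) (F : I -> R) :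
  (forall i, P i -> dvx (F i)) -> dvx (\sum_(i <- r | P i) F i).
Proof. by move=> H; apply: (big_ind dvx) => //; [exact: dvx0|exact: dvxD]. Qed.

Lemma dvxP p : dvx p <-> in_ideal [seq 'X_[m] | m <- [:: mn3 1 0 0]] p.
Proof. by rewrite /dvx varx in_ideal1. Qed.

Lemma dvx_cancel b c p : dvx (y ^+ b * z ^+ c * p) -> dvx p.
Proof.
move/dvxP => H; apply/dvxP; move: H.
have -> : y ^+ b * z ^+ c = 'X_[mn3 0 b c] by rewrite -mon3E /mon3 expr0 mul1r.
apply: in_mono_ideal_cancel => m v; rewrite inE => /eqP ->.
by rewrite !lem_mn3 !mnmDE mn3E0.
Qed.

Lemma dvx_cancely p : dvx (y * p) -> dvx p.
Proof. by move=> H; apply: (@dvx_cancel 1 0); rewrite expr1 expr0 mulr1. Qed.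
Lemma dvx_cancelz p : dvx (z * p) -> dvx p.
Proof. by move=> H; apply: (@dvx_cancel 0 1); rewrite expr1 expr0 mul1r. Qed.

Lemma modxz_cancel b p : (exists q, dvx (y ^+ b * p - z * q)) -> exists q, dvx (p - z * q).
Proof.
move=> [q [r e]].
have : in_ideal [seq 'X_[m] | m <- [:: mn3 1 0 0; mn3 0 0 1]] p.
  apply: (@in_mono_ideal_cancel _ (mn3 0 b 0)).
    by move=> m v; rewrite !inE => /orP[] /eqP ->; rewrite !lem_mn3 !mnmDE mn3E0 mn3E1 mn3E2.
  rewrite -mon3E /mon3 !expr0 mulr1 mul1r /= -varx -varz; apply/in_ideal2.
  by exists r, q; rewrite -e; ring.
rewrite /= -varx -varz => /in_ideal2[r1 [r2 ->]]; exists r2, r1; ring.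
Qed.

Lemma modxy_cancel c p : (exists q, dvx (z ^+ c * p - y * q)) -> exists q, dvx (p - y * q).
Proof.
move=> [q [r e]].
have : in_ideal [seq 'X_[m] | m <- [:: mn3 1 0 0; mn3 0 1 0]] p.
  apply: (@in_mono_ideal_cancel _ (mn3 0 0 c)).
    by move=> m v; rewrite !inE => /orP[] /eqP ->; rewrite !lem_mn3 !mnmDE mn3E0 mn3E1 mn3E2.
  rewrite -mon3E /mon3 !expr0 !mul1r /= -varx -vary; apply/in_ideal2.
  by exists r, q; rewrite -e; ring.
rewrite /= -varx -vary => /in_ideal2[r1 [r2 ->]]; exists r2, r1; ring.
Qed.

(** Hilbert-Burch for [(y,z)^n] modulo [x]. The coefficient of the pure power of [y] must be some
    [z u]; moving [y u] to the next coefficient and cancelling [z] lowers [n]. The end values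
    [U 0 = U (n+1) = 0] make the conclusion uniform, and the inner values are the coordinates of a
    preimage under the transpose of [B2]. *)
Lemma syzygy_yz n (g : nat -> R) :
  dvx (\sum_(t < n.+1) y ^+ (n - t) * z ^+ t * g t) ->
  exists U : nat -> R, [/\ U 0%N = 0, U n.+1 = 0 &
    forall t, (t <= n)%N -> dvx (g t - (z * U t.+1 - y * U t))].
Proof.
elim: n g => [|n IH] g H.
  exists (fun=> 0); split=> // -[|t] // _; move: H.
  by rewrite big_ord1 !mulr0 subrr subr0 subn0 !expr0 !mul1r.
have [u Hu] : exists u, dvx (g 0%N - z * u).
  apply: (@modxz_cancel n.+1).
  exists (- \sum_(t < n.+1) y ^+ (n - t) * z ^+ t * g t.+1).
  move: H; rewrite big_ord_recl /= subn0 expr0 mulr1 mulrN opprK mulr_sumr.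
  congr (dvx (_ + _)); apply: eq_bigr => i _.
  by rewrite /bump /= add1n subSS exprS; ring.
pose g' t := g t.+1 + (if t is 0 then y * u else 0).
have H' : dvx (\sum_(t < n.+1) y ^+ (n - t) * z ^+ t * g' t).
  apply: dvx_cancelz.
  have -> : z * (\sum_(t < n.+1) y ^+ (n - t) * z ^+ t * g' t) =
    (\sum_(t < n.+2) y ^+ (n.+1 - t) * z ^+ t * g t) - y ^+ n.+1 * (g 0%N - z * u).
    rewrite [in RHS]big_ord_recl /= subn0 expr0 mulr1.
    have -> : \sum_(i < n.+1) y ^+ (n.+1 - bump 0 i) * z ^+ bump 0 i * g (bump 0 i) =
              z * \sum_(t < n.+1) y ^+ (n - t) * z ^+ t * g t.+1.
      rewrite mulr_sumr; apply: eq_bigr => i _.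
      by rewrite /bump /= add1n subSS exprS; ring.
    rewrite /g' !big_ord_recl /=.
    under eq_bigr do rewrite addr0.
    by rewrite exprS subn0 expr0; ring.
  by apply: dvxB H _; apply: dvxM.
have [U [U0 Un HU]] := IH _ H'.
exists (fun t => if t is s.+1 then U s + (if s is 0 then u else 0) else 0); split=> //.
  by rewrite Un addr0.
move=> [|[|t]] lt.
- by rewrite U0 add0r mulr0 subr0.
- have := HU 0%N isT; rewrite /g' U0 /=; congr dvx; ring.
- by have := HU t.+1 lt; rewrite /g' /= !addr0.
Qed.

(** The kernel of [B2] modulo [x]. In the induction step the last relation reads
    [z^(n+1) f = y g_(n+1)] modulo [x], so [f] is a multiple of [y] there. *)
Lemma kernel_yz n (g : nat -> R) :
  (forall j, (j < n)%N -> dvx (z * g j - y * g j.+1)) ->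
  exists f, forall t, (t <= n)%N -> dvx (g t - y ^+ (n - t) * z ^+ t * f).
Proof.
elim: n => [|n IH] H.
  by exists (g 0%N) => -[|t] // _; rewrite !expr0 !mul1r subrr; apply: dvx0.
have [f Hf] := IH (fun j lj => H j (ltnW lj)).
have [f' Hf'] : exists q, dvx (f - y * q).
  apply: (@modxy_cancel n.+1); exists (g n.+1).
  have := dvxB (H n (leqnn _)) (dvxM z (Hf n (leqnn _))).
  by rewrite subnn expr0 exprS; congr dvx; ring.
exists f' => t; rewrite leq_eqVlt => /orP[/eqP->|lt].
  apply: dvx_cancely.
  have := dvxD (dvxN (dvxB (H n (leqnn _)) (dvxM z (Hf n (leqnn _))))) (dvxM (z ^+ n.+1) Hf').
  by rewrite !subnn expr0 exprS; congr dvx; ring.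
have := dvxD (Hf t lt) (dvxM (y ^+ (n - t) * z ^+ t) Hf').
by rewrite subSn // exprS; congr dvx; ring.
Qed.

(** The transpose of [B2] is injective modulo [x]: the system is triangular with [z] on the
    diagonal. *)
Lemma cokernel_yz n (a : nat -> R) :
  dvx (z * a 0%N) -> (forall t, (t.+1 < n)%N -> dvx (z * a t.+1 - y * a t)) ->
  forall t, (t < n)%N -> dvx (a t).
Proof.
move=> H0 H; elim=> [|t IH] lt; first exact: dvx_cancelz.
apply: dvx_cancelz; rewrite -[z * _](subrK (y * a t)).
by apply: dvxD (H _ lt) _; apply/dvxM/IH/ltnW.
Qed.

End Monomials.

(** * Homogeneous components and [x]-adic descent *)

Section Homogeneous.
Variable k : fieldType.
Local Notation R := (poly3 k).
Local Notation x := (var k 0).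

Definition hc (d : nat) (p : R) : R := pihomog mdeg d p.

Lemma hc_homog d p : hc d p \is d.-homog. Proof. exact: pihomogP. Qed.
Lemma hcD d p q : hc d (p + q) = hc d p + hc d q. Proof. exact: pihomogD. Qed.
Lemma hc0 d : hc d 0 = 0. Proof. exact: pihomog0. Qed.
Lemma hc_sum d (I : Type) (r : seq I) (P : pred I) (F : I -> R) :
  hc d (\sum_(i <- r | P i) F i) = \sum_(i <- r | P i) hc d (F i).
Proof. exact: raddf_sum. Qed.
Lemma hc_id d p : p \is d.-homog -> hc d p = p. Proof. exact: pihomog_dE. Qed.
Lemma hc_ne d e p : d != e -> p \is d.-homog -> hc e p = 0.
Proof. exact: pihomog_ne0. Qed.

Lemma hc_partition p : exists K, p = \sum_(d < K) hc d p.
Proof. by eexists; apply: (@pihomog_partitionE _ _ mdeg _ p); exact: leqnn. Qed.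

Lemma hcM q e p d : q \is e.-homog -> hc (e + d) (q * p) = q * hc d p.
Proof.
move=> hq; have [K {1 2}->] := hc_partition p; rewrite mulr_sumr !hc_sum mulr_sumr.
apply: eq_bigr => i _.
have [<-|ne] := eqVneq (i : nat) d; first by rewrite (hc_id (hc_homog _ _)) hc_id // dhomogM // hc_homog.
rewrite (@hc_ne i d) ?hc_homog // (@hc_ne (e + i)) ?mulr0 ?eqn_add2l //.
by rewrite dhomogM ?hc_homog.
Qed.

Lemma hcM_lt q e p d : q \is e.-homog -> (d < e)%N -> hc d (q * p) = 0.
Proof.
move=> hq lt; have [K ->] := hc_partition p; rewrite mulr_sumr hc_sum big1 // => i _.
by rewrite (@hc_ne (e + i)) ?dhomogM ?hc_homog //; lia.
Qed.

Lemma homog_var i : var k i \is 1.-homog.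
Proof. by rewrite /var dhomogX /= mdeg1. Qed.

Lemma homog_mon3 a b c : mon3 k a b c \is (a + b + c).-homog.
Proof. by rewrite mon3E dhomogX /= mdeg_mn3. Qed.

Lemma homog_C (c : k) : (c%:MP : R) \is 0.-homog.
Proof. by rewrite -[c%:MP]mulr1 mul_mpolyC dhomogZ // dhomog1. Qed.

Lemma homog_sum d (I : Type) (r : seq I) (P : pred I) (F : I -> R) :
  (forall i, P i -> F i \is d.-homog) -> \sum_(i <- r | P i) F i \is d.-homog.
Proof. by move=> H; apply: rpred_sum. Qed.

Lemma homog0_const (p : R) : p \is 0.-homog -> exists c : k, p = c%:MP.
Proof.
move=> /dhomogP hp; exists p@_0%MM; apply/mpolyP => m; rewrite mcoeffC.
have [->|nm] := eqVneq m 0%MM; first by rewrite mulr1.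
rewrite mulr0; apply/eqP; rewrite mcoeff_eq0; apply: contra nm => /hp /= /eqP.
by rewrite mdeg_eq0.
Qed.

Lemma var_neq0 i : var k i != 0.
Proof. by apply/eqP => /mpolyP /(_ U_(inord i)%MM); rewrite mcoeffX eqxx mcoeff0 => /eqP; rewrite oner_eq0. Qed.

Lemma x_inj (p q : R) : x * p = x * q -> p = q.
Proof. by apply: mulfI; apply: var_neq0. Qed.

Lemma homog_div_x d (p q : R) : p \is d.+1.-homog -> p = x * q -> p = x * hc d q.
Proof. by move=> hp e; rewrite -(hcM q d (homog_var 0)) -e hc_id. Qed.

Definition hcmx a b d (v : 'M[R]_(a, b)) : 'M[R]_(a, b) := map_mx (hc d) v.

Definition mx_homog e a b (M : 'M[R]_(a, b)) := forall i j, M i j \is e.-homog.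

Lemma hcmxM a b c (M : 'M[R]_(a, b)) (v : 'M[R]_(b, c)) e d :
  mx_homog e M -> hcmx (e + d) (M *m v) = M *m hcmx d v.
Proof.
move=> hM; apply/matrixP => i j; rewrite !mxE hc_sum; apply: eq_bigr => l _.
by rewrite mxE hcM.
Qed.

Lemma hcmxM_lt a b c (M : 'M[R]_(a, b)) (v : 'M[R]_(b, c)) e d :
  mx_homog e M -> (d < e)%N -> hcmx d (M *m v) = 0.
Proof.
move=> hM lt; apply/matrixP => i j; rewrite !mxE hc_sum big1 // => l _.
by rewrite (hcM_lt _ (hM i l)).
Qed.

Lemma hcmx_image a b c (M : 'M[R]_(a, b)) (v : 'M[R]_(b, c)) e d :
  mx_homog e M -> exists w, hcmx d (M *m v) = M *m w.
Proof.
move=> hM; have [le|lt] := leqP e d; last by exists 0; rewrite mulmx0 (hcmxM_lt _ hM).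
by exists (hcmx (d - e) v); rewrite -(hcmxM v _ hM) subnKC.
Qed.

Lemma hcmx_partition a b (v : 'M[R]_(a, b)) : exists K, v = \sum_(d < K) hcmx d v.
Proof.
pose K := (\max_i \max_j msize (v i j))%N; exists K.
apply/matrixP => i j; rewrite summxE.
under eq_bigr do rewrite mxE.
apply: pihomog_partitionE.
by apply: leq_trans (leq_bigmax i); apply: (leq_bigmax j).
Qed.

(** In [v = N w + x v'] the vector [v'] is again a cycle, because [M N = 0] and [x] cancels. Passing
    to homogeneous components, it has degree one less than [v], so the lifting modulo [x] can be
    iterated down to degree 0, where the term [x v'] has no component. *)
Lemma x_adic_exact a b c (M : 'M[R]_(a, b)) (N : 'M[R]_(b, c)) e e' :
  mx_homog e M -> mx_homog e' N -> M *m N = 0 ->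
  (forall v : 'cV_b, M *m v = 0 -> exists w v', v = N *m w + x *: v') ->
  forall v : 'cV_b, M *m v = 0 -> exists w, v = N *m w.
Proof.
move=> hM hN MN H.
have scx m d (v : 'cV[R]_m) : hcmx d.+1 (x *: v) = x *: hcmx d v.
  by apply/matrixP => i j; rewrite !mxE (hcM (v i j) d (homog_var 0)).
have hom d : forall v : 'cV_b, mx_homog d v -> M *m v = 0 -> exists w, v = N *m w.
  elim: d => [|d IH] v hv Mv; have [w [v' ev]] := H v Mv.
    have [u eu] := hcmx_image w 0 hN.
    exists u; rewrite -eu; apply/matrixP => i j.
    move/matrixP/(_ i j)/(congr1 (hc 0)): ev; rewrite !mxE hcD (hcM_lt _ (homog_var 0)) // addr0.
    by rewrite (hc_id (hv i j)).
  have [u eu] := hcmx_image w d.+1 hN.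
  have ev' : v = N *m u + x *: hcmx d v'.
    rewrite -eu -scx; apply/matrixP => i j.
    move/matrixP/(_ i j)/(congr1 (hc d.+1)): ev; rewrite (hc_id (hv i j)) => ->.
    by rewrite !mxE hcD.
  have [||u' eu'] := IH (hcmx d v').
  - by move=> i j; rewrite mxE hc_homog.
  - move: Mv; rewrite ev' mulmxDr mulmxA MN mul0mx add0r -scalemxAr => Mx.
    by apply/matrixP => i j; apply: x_inj; move/matrixP/(_ i j): Mx; rewrite !mxE => ->; rewrite mulr0.
  - by exists (u + x *: u'); rewrite mulmxDr -scalemxAr -eu'; exact: ev'.
move=> v Mv; have [K ->] := hcmx_partition v.
apply: (big_ind (fun v => exists w, v = N *m w)).
- by exists 0; rewrite mulmx0.
- by move=> v1 v2 [w1 ->] [w2 ->]; exists (w1 + w2); rewrite mulmxDr.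
move=> d _; apply: (hom d); first by move=> i j; rewrite mxE hc_homog.
by rewrite -(hcmxM v _ hM) Mv; apply/matrixP => i j; rewrite !mxE hc0.
Qed.

Lemma dvx_mx a b (v : 'M[R]_(a, b)) : (forall i j, dvx (v i j)) -> exists v', v = x *: v'.
Proof.
move=> H; have [f Hf] := fin_all_exists (fun ij : 'I_a * 'I_b => H ij.1 ij.2).
by exists (\matrix_(i, j) f (i, j)); apply/matrixP => i j; rewrite !mxE (Hf (i, j)).
Qed.

Lemma pf_homog N e (a : nat -> nat -> R) : (forall p q, a p q \is e.-homog) ->
  pf N.*2 a \is (e * N).-homog.
Proof.
elim: N a => [|N IH] a Ha; first by rewrite muln0 dhomog1.
rewrite doubleS /=; apply: homog_sum => j _; rewrite mulnS.
apply: dhomogM; last by apply: IH.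
by rewrite -signr_odd; case: odd; rewrite ?expr1 ?expr0 ?mulN1r ?mul1r ?dhomogN.
Qed.

Lemma mxf_homog e a b (M : 'M[R]_(a, b)) p q : mx_homog e M -> mxf M p q \is e.-homog.
Proof.
by move=> hM; rewrite /mxf; case: insub => [i|]; [case: insub => [j|]|]; rewrite ?dhomog0.
Qed.

End Homogeneous.

(** * Linear forms on the polynomial ring *)

Section DualEval.
Variable k : fieldType.
Local Notation R := (poly3 k).
Variables (d : nat) (phi : 'X_{1..3} -> k).

(** The defining sum runs over the support, which changes with the polynomial; a common index list
    is what linearity needs. *)
Lemma dual_eval_supp (p : R) (s : seq 'X_{1..3}) : uniq s -> {subset msupp p <= s} ->
  dual_eval d phi p = \sum_(m <- s | mdeg m == d) phi m * p@_m.
Proof.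
move=> us sub; rewrite /dual_eval [RHS](bigID (mem (msupp p))) /= [X in _ + X]big1 ?addr0; last first.
  by move=> m /andP[_]; rewrite -mcoeff_eq0 => /eqP->; rewrite mulr0.
rewrite -big_filter -[RHS]big_filter; apply: perm_big; apply: uniq_perm.
- by rewrite filter_uniq // msupp_uniq.
- by rewrite filter_uniq.
move=> m; rewrite !mem_filter; apply/andP/andP => [[dm mp]|[/andP[dm mp] _]] //.
by split; [apply/andP | exact: sub].
Qed.

Lemma dual_eval_is_linear : scalar (dual_eval d phi : R -> k).
Proof.
move=> c p q; pose s := undup (msupp p ++ msupp q ++ msupp (c *: p + q)).
rewrite !(@dual_eval_supp _ s) ?undup_uniq //; try by
  move=> m mp; rewrite mem_undup !mem_cat mp ?orbT.
rewrite mulr_sumr -big_split /=; apply: eq_bigr => m _.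
by rewrite mcoeffD mcoeffZ; ring.
Qed.

HB.instance Definition _ := GRing.isLinear.Build k R k *%R (dual_eval d phi) dual_eval_is_linear.

Lemma dual_evalZ c (p : R) : dual_eval d phi (c *: p) = c * dual_eval d phi p.
Proof. exact: linearZ. Qed.

Lemma dual_evalD (p q : R) : dual_eval d phi (p + q) = dual_eval d phi p + dual_eval d phi q.
Proof. exact: raddfD. Qed.

Lemma dual_evalB (p q : R) : dual_eval d phi (p - q) = dual_eval d phi p - dual_eval d phi q.
Proof. exact: raddfB. Qed.

Lemma dual_eval0 : dual_eval d phi 0 = 0.
Proof. exact: raddf0. Qed.

Lemma dual_eval_sum (I : Type) (r : seq I) (P : pred I) (F : I -> R) :
  dual_eval d phi (\sum_(i <- r | P i) F i) = \sum_(i <- r | P i) dual_eval d phi (F i).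
Proof. exact: raddf_sum. Qed.

Lemma dual_evalCM c (p : R) : dual_eval d phi (c%:MP * p) = c * dual_eval d phi p.
Proof. by rewrite mul_mpolyC dual_evalZ. Qed.

Lemma dual_evalX m : dual_eval d phi ('X_[m] : R) = if mdeg m == d then phi m else 0.
Proof. by rewrite /dual_eval msuppX big_mkcond big_seq1 mcoeffX eqxx mulr1. Qed.

Lemma dual_eval_ne e (p : R) : p \is e.-homog -> e != d -> dual_eval d phi p = 0.
Proof.
move=> /dhomogP hp ne; rewrite /dual_eval big_seq_cond big1 // => m /andP[/hp /= -> ].
by rewrite (negPf ne).
Qed.

Lemma dual_eval_mono (p : R) :
  dual_eval d phi p = \sum_(m <- msupp p) p@_m * dual_eval d phi 'X_[m].
Proof. by rewrite {1}[p]mpolyE raddf_sum; apply: eq_bigr => m _ /=; rewrite dual_evalZ. Qed.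

End DualEval.

(** * The ordered monomial basis *)

Definition bexp (d : nat) : seq 'X_{1..3} :=
  flatten [seq [seq mn3 (d - i) (i - j) j | j <- iota 0 i.+1] | i <- iota 0 d.+1].

Lemma basis_seqE (k : fieldType) d : basis_seq k d = [seq 'X_[m] | m <- bexp d].
Proof.
rewrite /basis_seq /bexp map_flatten -map_comp; congr flatten; apply: eq_map => i /=.
by rewrite mon3E -map_comp; congr cons; apply: eq_map => j /=; rewrite mon3E.
Qed.

Lemma uniq_bexp d : uniq (bexp d).
Proof.
rewrite /bexp; apply: (@allpairs_uniq_dep _ (fun _ : nat => nat) _ (fun i j : nat => mn3 (d - i) (i - j) j)).
- exact: iota_uniq.
- by move=> i _; exact: iota_uniq.
move=> u v /allpairsPdep[a [b [ai bj ->]]] /allpairsPdep[a' [b' [ai' bj' ->]]].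
move=> /=/mn3_inj[e1 e2 e3]; subst b'; suff -> : a = a' by [].
move: ai ai' bj bj'; rewrite !mem_iota; lia.
Qed.

Lemma mem_bexp d m : (m \in bexp d) = (mdeg m == d).
Proof.
apply/flatten_mapP/eqP => [[i]|<-].
  rewrite mem_iota => li /mapP[j]; rewrite mem_iota => lj ->; rewrite mdeg_mn3; lia.
rewrite mdeg3; exists (m (inord 1) + m (inord 2))%N; first by rewrite mem_iota; lia.
apply/mapP; exists (m (inord 2)); first by rewrite mem_iota; lia.
by rewrite {1}[m]mn3_eta; congr mn3; lia.
Qed.

Lemma size_bexp d : size (bexp d) = 'C(d.+2, 2).
Proof.
rewrite /bexp size_flatten /shape -map_comp -(eq_map (f := succn)); last first.
  by move=> i /=; rewrite size_map size_iota.
rewrite -triangular_sum sumnE big_map -{1}[d.+1]subn0 -/(index_iota 0 d.+1).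
by rewrite [RHS]big_nat_recl // add0n.
Qed.

(** The monomials without [x] close the ordered basis, which is why [B0] and [Q] are cut out of the
    last columns and rows. *)
Lemma bexp_last d c : (c <= d)%N -> nth 0%MM (bexp d) ('C(d.+1, 2) + c) = mn3 0 (d - c) c.
Proof.
move=> lc; rewrite /bexp -[iota 0 d.+1]/(iota 0 (1 + d)) addnC iotaD map_cat flatten_cat nth_cat.
have -> : size (flatten [seq [seq mn3 (d - i) (i - j) j | j <- iota 0 i.+1] | i <- iota 0 d]) = 'C(d.+1, 2).
  case: d {lc} => [|d] //; rewrite -size_bexp /bexp !size_flatten /shape -!map_comp.
  by congr sumn; apply: eq_map => i /=; rewrite !size_map.
rewrite ltnNge leq_addr addKn add0n.
have -> : flatten [seq [seq mn3 (d - i) (i - j) j | j <- iota 0 i.+1] | i <- iota d 1] =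
  [seq mn3 0 (d - j) j | j <- iota 0 d.+1] by rewrite /= cats0 subnn.
by rewrite (nth_map 0%N) ?size_iota // nth_iota.
Qed.

(** * The generators and their relations *)

Section Main.
Variables (k : fieldType) (n : nat) (phi : 'X_{1..3} -> k).
Hypothesis n0 : (0 < n)%N.
Local Notation R := (poly3 k).
Local Notation x := (var k 0).
Local Notation E := (dual_eval n.*2.-1 phi).
Local Notation N := (NN n).

Definition bm (i : nat) : 'X_{1..3} := nth 0%MM (bexp n.-1) i.
Definition mum (c : nat) : 'X_{1..3} := mn3 0 (n.-1 - c) c.

Lemma NN_size : size (bexp n.-1) = N. Proof. by rewrite size_bexp prednK. Qed.

Lemma mbE i : (i < N)%N -> mb k n i = 'X_[bm i].
Proof. by move=> li; rewrite /mb basis_seqE (nth_map 0%MM) ?NN_size. Qed.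

Lemma bm_deg i : (i < N)%N -> mdeg (bm i) = n.-1.
Proof. by move=> li; apply/eqP; rewrite -mem_bexp mem_nth // NN_size. Qed.

Lemma bm_onto m : mdeg m = n.-1 -> exists2 i, (i < N)%N & m = bm i.
Proof.
move=> dm; have ml : m \in bexp n.-1 by rewrite mem_bexp dm.
by exists (index m (bexp n.-1)); rewrite ?index_mem -?NN_size ?index_mem // /bm nth_index.
Qed.

Lemma bm_inj i j : (i < N)%N -> (j < N)%N -> bm i = bm j -> i = j.
Proof.
by move=> li lj /eqP; rewrite /bm nth_uniq ?NN_size ?uniq_bexp // => /eqP.
Qed.

Lemma NN_ge : NN n = ('C(n, 2) + n)%N.
Proof. by rewrite /NN binS bin1. Qed.

Lemma NN_subn : (N - n)%N = 'C(n, 2). Proof. by rewrite NN_ge addnK. Qed.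

Lemma NN_lt c : (c < n)%N -> (N - n + c < N)%N. Proof. by rewrite NN_subn NN_ge ltn_add2l. Qed.

Lemma bm_mum c : (c < n)%N -> bm (N - n + c) = mum c.
Proof.
move=> lc; rewrite NN_subn /bm /mum -{2}(prednK n0) bexp_last //.
by rewrite -ltnS prednK.
Qed.

Lemma mb_homog i : mb k n i \is n.-1.-homog.
Proof.
have [li|gi] := ltnP i N; first by rewrite mbE // dhomogX /= bm_deg.
by rewrite /mb nth_default ?dhomog0 // basis_seqE size_map NN_size.
Qed.

Lemma mum_onto m : mdeg m = n.-1 -> m (inord 0) = 0%N -> exists2 c, (c < n)%N & m = mum c.
Proof.
rewrite mdeg3 => dm m0; exists (m (inord 2)); first by lia.
by rewrite {1}[m]mn3_eta /mum m0; congr mn3; lia.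
Qed.

Lemma bm_x i : (i < N - n)%N -> exists m, bm i = (mn3 1 0 0 + m)%MM.
Proof.
move=> li; have liN : (i < N)%N by apply: leq_trans li (leq_subr _ _).
have [e|/eqP ne] := eqVneq (bm i (inord 0)) 0%N.
  have [c lc ec] := mum_onto (bm_deg liN) e; rewrite -bm_mum // in ec.
  by have := bm_inj liN (NN_lt lc) ec; lia.
exists (bm i - mn3 1 0 0)%MM; rewrite addmC submK // lem_mn3 !leq0n /= andbT; lia.
Qed.

Lemma homog_mpolyP d (f : R) : f \is d.-homog -> (forall m, mdeg m = d -> f@_m = 0) -> f = 0.
Proof.
move=> hf H; apply/mpolyP => m; rewrite mcoeff0.
have [/H//|ne] := eqVneq (mdeg m) d.
by apply: dhomog_nemf_coeff hf _.
Qed.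

Hypothesis pU : pmat n phi \in unitmx.

Definition ms (l : nat) : R := \sum_(s < N) mxf (pinv n phi) l s *: mb k n s.
Definition mus (c : nat) : R := ms (N - n + c).
(** The coefficients form row [j] of [r^T p^-1], so that [x L_j] and [m_{0,j}] pair equally with
    every form of degree [n-1]. *)
Definition L (j : nat) : R := \sum_(l < N) mxf (rp n phi) j l *: mb k n l.
Definition G (j : nat) : R := m0 k n j - x * L j.

Lemma ms_homog l : ms l \is n.-1.-homog.
Proof. by apply: homog_sum => s _; apply: dhomogZ; apply: mb_homog. Qed.

Lemma L_homog l : L l \is n.-1.-homog.
Proof. by apply: homog_sum => s _; apply: dhomogZ; apply: mb_homog. Qed.

Lemma xn1_homog f : f \is n.-1.-homog -> x * f \is n.-homog.
Proof. by move=> hf; have := dhomogM (homog_var k 0) hf; rewrite add1n prednK. Qed.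

Lemma m0_homog j : (j <= n)%N -> m0 k n j \is n.-homog.
Proof. by move=> lj; have := homog_mon3 k 0 (n - j) j; rewrite add0n subnK. Qed.

Lemma G_homog j : (j <= n)%N -> G j \is n.-homog.
Proof. by move=> lj; rewrite /G rpredB ?m0_homog ?xn1_homog ?L_homog. Qed.

Lemma E_ms_mb (l t : 'I_N) : E (x * ms l * mb k n t) = (l == t)%:R.
Proof.
have /matrixP/(_ l t) : pinv n phi *m pmat n phi = 1%:M by rewrite mulVmx.
rewrite !mxE => <-; rewrite /ms mulr_sumr mulr_suml raddf_sum; apply: eq_bigr => s _ /=.
by rewrite -scalerAr -scalerAl dual_evalZ mxf_ord mxE.
Qed.

(** Pairing with [x ms_l] reads off the coefficient of [m_l]. No homogeneity of [f] is assumed,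
    since the components of degree other than [n-1] contribute 0 to both sides. *)
Lemma E_ms (l : nat) f : (l < N)%N -> E (x * ms l * f) = f@_(bm l).
Proof.
move=> ll.
rewrite [f in LHS]mpolyE mulr_sumr raddf_sum [f in RHS]mpolyE raddf_sum.
apply: eq_bigr => m _ /=.
rewrite -scalerAr dual_evalZ mcoeffZ mcoeffX; congr (_ * _).
have [dm|ne] := eqVneq (mdeg m) n.-1.
  have [t lt ->] := bm_onto dm; rewrite -mbE // (E_ms_mb (Ordinal ll) (Ordinal lt)).
  rewrite eq_sym -val_eqE /=; congr (nat_of_bool _)%:R.
  by apply/eqP/eqP => [->//|]; exact: bm_inj.
rewrite (@dual_eval_ne _ _ _ (n + mdeg m)); last by lia.
- by case: eqP => // e; move: ne; rewrite e bm_deg // eqxx.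
- by rewrite dhomogM ?dhomogX // xn1_homog // ms_homog.
Qed.

Lemma test_zero f : f \is n.-1.-homog -> (forall m, mdeg m = n.-1 -> E (x * f * 'X_[m]) = 0) -> f = 0.
Proof.
move=> hf H; apply: (homog_mpolyP hf) => m dm; have [l ll ->] := bm_onto dm.
rewrite -E_ms // mulrAC mulr_sumr raddf_sum big1 //= => s _.
by rewrite -scalerAr dual_evalZ mbE // H ?mulr0 // bm_deg.
Qed.

(** The way each relation is proved: divisibility by [x] is an identity in [y] and [z], and what is
    left is seen by the form [E(x f g)]. *)
Lemma test_zero_x F : F \is n.-homog -> dvx F ->
  (forall m, mdeg m = n.-1 -> E (F * 'X_[m]) = 0) -> F = 0.
Proof.
move=> hF [f eF] H.
have {}eF : F = x * hc n.-1 f by apply: homog_div_x eF; rewrite prednK.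
by rewrite eF (@test_zero (hc n.-1 f)) ?mulr0 ?hc_homog // -eF.
Qed.

Lemma ms_expand f : f \is n.-1.-homog -> f = \sum_(l < N) E (x * f * mb k n l) *: ms l.
Proof.
move=> hf; apply/eqP; rewrite -subr_eq0; apply/eqP; apply: test_zero.
  by rewrite rpredB // homog_sum // => l _; apply/dhomogZ/ms_homog.
move=> m dm; have [t lt ->] := bm_onto dm; rewrite mulrBr mulrBl raddfB /= -mbE //.
have Hl c (l : 'I_N) : E (x * (c *: ms l) * mb k n t) = c * (l == Ordinal lt)%:R.
  by rewrite -(E_ms_mb l (Ordinal lt)) -dual_evalZ -scalerAr -scalerAl.
rewrite mulr_sumr mulr_suml dual_eval_sum (bigD1 (Ordinal lt)) // (Hl _ (Ordinal lt)) eqxx mulr1.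
by rewrite big1 /= ?addr0 ?subrr // => l ne; rewrite (Hl _ l) (negPf ne) mulr0.
Qed.

Lemma pmat_sym : (pmat n phi)^T = pmat n phi.
Proof. by apply/matrixP => i j; rewrite !mxE mulrAC. Qed.

Lemma pinv_sym : (pinv n phi)^T = pinv n phi.
Proof. by rewrite /pinv trmx_inv pmat_sym. Qed.

Lemma mxf_tr (T : nmodType) a b (A : 'M[T]_(a, b)) i j : mxf A^T i j = mxf A j i.
Proof. by rewrite /mxf; case: insub => [i'|]; case: insub => [j'|] //; rewrite mxE. Qed.

Lemma E_G j v : (j <= n)%N -> E (v * G j) = 0.
Proof.
rewrite -ltnS => lj; rewrite [v]mpolyE mulr_suml raddf_sum big1 //= => m _.
rewrite -scalerAl dual_evalZ; apply/eqP; rewrite mulf_eq0; apply/orP; right; apply/eqP.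
have [dm|ne] := eqVneq (mdeg m) n.-1; last first.
  apply: (@dual_eval_ne _ _ _ (mdeg m + n)); last by lia.
  by rewrite dhomogM ?dhomogX // G_homog.
have [t lt ->] := bm_onto dm; rewrite -mbE // /G mulrBr raddfB /=.
have /matrixP/(_ (Ordinal lj) (Ordinal lt)) : rp n phi *m pmat n phi = (rmat n phi)^T.
  by rewrite /rp /pinv mulmxKV.
rewrite [RHS]mxE [RHS]mxE /= => <-; apply/eqP; rewrite subr_eq0; apply/eqP.
rewrite mxE /L !mulr_sumr raddf_sum; apply: eq_bigr => l _ /=.
rewrite -!scalerAr dual_evalZ (mxf_ord _ (Ordinal lj)) [pmat _ _ _ _]mxE.
by congr (_ * E _); rewrite [RHS]mulrC.
Qed.

Lemma E_xL j q : (j <= n)%N -> E (x * L j * q) = E (m0 k n j * q).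
Proof.
move=> lj; apply/eqP; rewrite eq_sym -subr_eq0 -raddfB /= -mulrBl -/(G j) mulrC.
by rewrite E_G.
Qed.

Lemma L_coef j l : (l < N)%N -> (L j)@_(bm l) = mxf (rp n phi) j l.
Proof.
move=> ll; rewrite /L raddf_sum (bigD1 (Ordinal ll)) //= big1 ?addr0.
  by rewrite mcoeffZ mbE // mcoeffX eqxx mulr1.
move=> i; rewrite -val_eqE /= => ne; rewrite mcoeffZ mbE // mcoeffX.
case: eqP => [/bm_inj e|]; last by rewrite mulr0.
by rewrite e // eqxx in ne.
Qed.

Lemma split_basis (c : nat -> k) :
  dvx (\sum_(l < N) c l *: mb k n l - \sum_(t < n) c (N - n + t)%N *: 'X_[mum t]).
Proof.
have leN : (n <= N)%N by rewrite NN_ge leq_addl.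
rewrite -(big_mkord xpredT (fun l => c l *: mb k n l)) (big_cat_nat (n := (N - n)%N)) //; last exact: leq_subr.
rewrite -{2}[(N - n)%N]add0n big_addn subKn // [X in _ + X - _]big_mkord -addrA -sumrB.
rewrite [X in _ + X]big1 ?addr0; last first.
  by move=> t _; rewrite addnC mbE ?NN_lt // bm_mum // subrr.
rewrite big_nat; apply: dvx_sum => l /andP[_ ll].
rewrite mbE; last by apply: leq_trans ll (leq_subr _ _).
have [m ->] := bm_x ll; rewrite mpolyXD -varx -mul_mpolyC.
by apply/dvxM/dvxx.
Qed.

End Main.

(** * The linear relations between the [x mus_c] and the [G_j] *)

Section Relations.
Variables (k : fieldType) (n : nat).
Local Notation R := (poly3 k).
Local Notation x := (var k 0).
Local Notation y := (var k 1).
Local Notation z := (var k 2).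
Local Notation N := (NN n).
Local Notation mum := (mum n).
Local Notation m0 := (m0 k n).

Lemma m0E j : m0 j = 'X_[mn3 0 (n - j) j]. Proof. exact: mon3E. Qed.

Lemma z_mum c : (c < n)%N -> z * 'X_[mum c] = m0 c.+1.
Proof. by move=> lc; rewrite varz -mpolyXD mn3D m0E; congr 'X_[mn3 _ _ _]; lia. Qed.

Lemma y_mum c : (c < n)%N -> y * 'X_[mum c] = m0 c.
Proof. by move=> lc; rewrite vary -mpolyXD mn3D m0E; congr 'X_[mn3 _ _ _]; lia. Qed.

Lemma zy_m0 j : (j < n)%N -> z * m0 j = y * m0 j.+1.
Proof.
by move=> lj; rewrite varz vary !m0E -!mpolyXD !mn3D; congr 'X_[mn3 _ _ _]; lia.
Qed.

Variable phi : 'X_{1..3} -> k.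
Hypothesis n0 : (0 < n)%N.
Hypothesis pU : pmat n phi \in unitmx.
Local Notation E := (dual_eval n.*2.-1 phi).
Local Notation ms := (ms n phi).
Local Notation mus := (mus n phi).
Local Notation L := (L n phi).
Local Notation G := (G n phi).

(** The out-of-range default gives [mus n = 0], which lets [relation2] include the column
    [t = n]. *)
Lemma mus_out c : (n <= c)%N -> mus c = 0.
Proof.
move=> lc; rewrite /mus /ms big1 // => s _; rewrite /mxf insubF ?scale0r //.
by apply/negbTE; rewrite -leqNgt NN_subn NN_ge // leq_add2l.
Qed.

Lemma mus_homog c : mus c \is n.-1.-homog. Proof. exact: ms_homog. Qed.

Lemma E_mus c f : (c < n)%N -> E (x * mus c * f) = f@_(mum c).
Proof. by move=> lc; rewrite E_ms ?bm_mum // NN_lt. Qed.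

Lemma E_mus_mum c d : (c < n)%N -> E (x * mus c * 'X_[mum d]) = (c == d)%:R.
Proof.
move=> lc; rewrite E_mus // mcoeffX eq_sym; congr (nat_of_bool _)%:R.
by apply/eqP/eqP => [/mn3_inj[]|->].
Qed.

Lemma E_mus_x c m : (c < n)%N -> E (x * mus c * 'X_[mn3 1 0 0 + m]) = 0.
Proof.
move=> lc; rewrite E_mus // mcoeffX; case: eqP => // /(congr1 (fun m : 'X_{1..3} => m (inord 0))).
by rewrite mnmDE !mn3E0.
Qed.

Lemma mono_cases (P : 'X_{1..3} -> Prop) :
  (forall m, P (mn3 1 0 0 + m)%MM) -> (forall c, (c < n)%N -> P (mum c)) ->
  forall m, mdeg m = n.-1 -> P m.
Proof.
move=> Px Pm m dm; have [e|/eqP ne] := eqVneq (m (inord 0)) 0%N.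
  by have [c lc ->] := mum_onto n0 dm e; apply: Pm.
rewrite -(@submK _ (mn3 1 0 0) m) 1?addmC //.
by rewrite lem_mn3 !leq0n /= andbT; lia.
Qed.

Lemma L_modx j : (j <= n)%N -> dvx (L j - \sum_(t < n) mxf (B0 n phi) j t *: 'X_[mum t]).
Proof.
move=> lj; have := split_basis n0 (fun l => mxf (rp n phi) j l); congr (dvx (_ - _)).
apply: eq_bigr => t _; congr (_ *: _).
by have lj' : (j < n.+1)%N by []; rewrite [RHS](mxf_ord _ (Ordinal lj') t) mxE.
Qed.

Lemma mus_modx c : (c < n)%N -> dvx (mus c - \sum_(t < n) mxf (Qm n phi) c t *: 'X_[mum t]).
Proof.
move=> lc; have := split_basis n0 (fun l => mxf (pinv n phi) (N - n + c) l); congr (dvx (_ - _)).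
by apply: eq_bigr => t _; congr (_ *: _); rewrite [RHS](mxf_ord _ (Ordinal lc) t) mxE.
Qed.

Lemma G_modx j : dvx (G j - m0 j).
Proof. by rewrite /G addrAC subrr add0r; apply/dvxN/dvxx. Qed.

Lemma rpr_sym : (rpr n phi)^T = rpr n phi.
Proof. by rewrite /rpr !trmx_mul trmxK pinv_sym mulmxA. Qed.

Lemma E_L_m0 (j t : nat) : (j <= n)%N -> (t <= n)%N -> E (L j * m0 t) = mxf (rpr n phi) j t.
Proof.
move=> lej let'; have lj : (j < n.+1)%N := lej; have lt : (t < n.+1)%N := let'.
rewrite (mxf_ord _ (Ordinal lj) (Ordinal lt)) /rpr -/(rp n phi) mxE.
rewrite /L mulr_suml dual_eval_sum; apply: eq_bigr => l _.
by rewrite -scalerAl dual_evalZ (mxf_ord _ (Ordinal lj)) [rmat _ _ _ _]mxE.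
Qed.

Definition B1n (i t : nat) : k :=
  (if t == 0%N then 0 else mxf (B0 n phi) i t.-1) - (if t == n then 0 else mxf (B0 n phi) i.+1 t).

Lemma sum_m0_lift (c : nat -> k) :
  \sum_(t < n.+1) (if t == 0 :> nat then 0 else c t.-1) *: m0 t = z * \sum_(t < n) c t *: 'X_[mum t].
Proof.
rewrite big_ord_recl /= scale0r add0r mulr_sumr; apply: eq_bigr => t _.
by rewrite -scalerAr z_mum.
Qed.

Lemma sum_m0_widen (c : nat -> k) :
  \sum_(t < n.+1) (if t == n :> nat then 0 else c t) *: m0 t = y * \sum_(t < n) c t *: 'X_[mum t].
Proof.
rewrite big_ord_recr /= eqxx scale0r addr0 mulr_sumr; apply: eq_bigr => t _.
by rewrite -scalerAr y_mum // ltn_eqF.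
Qed.

(** [B1] is built so that both sides agree modulo [x]. Against a multiple [x m] the left side pairs
    to zero because [z m_{0,j} = y m_{0,j+1}]; against [mum_c] it gives entries [(j,c+1)] and
    [(j+1,c)] of the symmetric matrix [r^T p^-1 r], whose difference is [A'_{jc}]. *)
Lemma relation1 j : (j < n)%N ->
  z * L j - y * L j.+1 = \sum_(t < n.+1) B1n j t *: G t + x * \sum_(c < n) mxf (Ap n phi) j c *: mus c.
Proof.
move=> lj; have lj' := ltnW lj; apply/eqP; rewrite -subr_eq0 opprD addrA; apply/eqP.
have hz p i : p \is n.-1.-homog -> var k i * p \is n.-homog.
  by move=> hp; have := dhomogM (homog_var k i) hp; rewrite add1n prednK.
apply: (test_zero_x n0 pU).
- rewrite !rpredB ?hz ?L_homog //.
    by apply: homog_sum => t _; apply: dhomogZ; apply: G_homog => //; rewrite -ltnS.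
  by apply: homog_sum => c _; apply: dhomogZ; apply: mus_homog.
- apply: dvxB; last exact: dvxx.
  have H1 := dvxM z (L_modx lj'); have H2 := dvxM y (L_modx lj).
  have H3 : dvx (\sum_(t < n.+1) B1n j t *: G t - \sum_(t < n.+1) B1n j t *: m0 t).
    rewrite -sumrB; apply: dvx_sum => t _; rewrite -scalerBr -mul_mpolyC.
    by apply: dvxM; apply: G_modx.
  have e : \sum_(t < n.+1) B1n j t *: m0 t =
      z * (\sum_(t < n) mxf (B0 n phi) j t *: 'X_[mum t]) -
      y * (\sum_(t < n) mxf (B0 n phi) j.+1 t *: 'X_[mum t]).
    rewrite -sum_m0_lift -sum_m0_widen -sumrB; apply: eq_bigr => t _.
    by rewrite /B1n scalerBl.
  rewrite e in H3; have := dvxB (dvxB H1 H2) H3; congr dvx; ring.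
have Es f : E (f * \sum_(t < n.+1) B1n j t *: G t) = 0.
  rewrite mulr_sumr dual_eval_sum big1 // => t _; rewrite -scalerAr dual_evalZ.
  by rewrite E_G ?mulr0 // -ltnS.
have Ea f : E (x * (\sum_(c < n) mxf (Ap n phi) j c *: mus c) * f) =
  \sum_(c < n) mxf (Ap n phi) j c * E (x * mus c * f).
  rewrite mulr_sumr mulr_suml dual_eval_sum; apply: eq_bigr => c _.
  by rewrite -scalerAr -scalerAl dual_evalZ.
apply: mono_cases => [m|c lc]; rewrite mulrBl mulrBl mulrBl !dual_evalB [X in _ - E X - _]mulrC Es subr0 Ea.
  rewrite big1 ?subr0; last by move=> c _; rewrite E_mus_x ?mulr0.
  have sh u p : E (u * p * 'X_[mn3 1 0 0 + m]) = E (x * p * (u * 'X_[m])).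
    by rewrite mpolyXD -varx; congr E; ring.
  rewrite !sh !E_xL //; apply/eqP; rewrite subr_eq0; apply/eqP; congr E.
  by rewrite !mulrA ![m0 _ * _]mulrC zy_m0.
have sh u p : E (u * p * 'X_[mum c]) = E (p * (u * 'X_[mum c])) by congr E; ring.
rewrite !sh z_mum // y_mum // !E_L_m0 //; last exact: ltnW.
rewrite (bigD1 (Ordinal lc)) //= E_mus_mum // eqxx mulr1 big1 ?addr0; last first.
  by move=> i; rewrite -val_eqE /= => ne; rewrite E_mus_mum // (negPf ne) mulr0.
rewrite (mxf_ord _ (Ordinal lj) (Ordinal lc)) !mxE /=.
by rewrite -[X in mxf X c j.+1]rpr_sym mxf_tr; ring.
Qed.

Lemma Q_sym i j : mxf (Qm n phi) i j = mxf (Qm n phi) j i.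
Proof.
rewrite -[in LHS](_ : (Qm n phi)^T = Qm n phi) ?mxf_tr //.
by apply/matrixP => a b; rewrite !mxE -[X in mxf X _ _ = _]pinv_sym mxf_tr.
Qed.

Definition D0n (s t : nat) : k := if ((s < n) && (0 < t))%N then mxf (Qm n phi) s t.-1 else 0.

Definition ymus (t : nat) : R := if t is s.+1 then y * mus s else 0.

(** Modulo [x], [Q] gives the coefficients of [mus_t], and [D0] shifts them according to
    multiplication by [z] or [y]. Against [x m] the two middle terms read the same coefficient of
    [m]; against [mum_c] they give entries of [B0], since [E(m_{0,j} mus_s) = E(x L_j mus_s)] is a
    coefficient of [L_j]. *)
Lemma relation2 t : (t <= n)%N ->
  x * (\sum_(c < n) B1n c t *: mus c) + z * mus t - ymus t +
    \sum_(s < n.+1) (D0n s t - D0n t s) *: G s = 0.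
Proof.
move=> lt.
have hz p i : p \is n.-1.-homog -> var k i * p \is n.-homog.
  by move=> hp; have := dhomogM (homog_var k i) hp; rewrite add1n prednK.
apply: (test_zero_x n0 pU).
- rewrite rpredD ?rpredB ?rpredD ?hz ?mus_homog //.
  + by apply: homog_sum => c _; apply: dhomogZ; apply: mus_homog.
  + by case: t {lt} => [|s]; rewrite /ymus ?rpred0 ?hz ?mus_homog.
  + by apply: homog_sum => s _; apply: dhomogZ; apply: G_homog => //; rewrite -ltnS.
- have H3 : dvx (\sum_(s < n.+1) (D0n s t - D0n t s) *: G s - \sum_(s < n.+1) (D0n s t - D0n t s) *: m0 s).
    rewrite -sumrB; apply: dvx_sum => s _; rewrite -scalerBr -mul_mpolyC.
    by apply: dvxM; apply: G_modx.
  have e : \sum_(s < n.+1) (D0n s t - D0n t s) *: m0 s =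
    \sum_(s < n.+1) D0n s t *: m0 s - \sum_(s < n.+1) D0n t s *: m0 s.
    by rewrite -sumrB; apply: eq_bigr => s _; rewrite scalerBl.
  rewrite e in H3; have Hz : dvx (z * mus t - \sum_(s < n.+1) D0n t s *: m0 s).
    have [ltn|get] := ltnP t n.
      have := dvxM z (mus_modx ltn); rewrite mulrBr -sum_m0_lift; congr (dvx (_ - _)).
      by apply: eq_bigr => s _; rewrite /D0n ltn lt0n; case: eqP.
    rewrite mus_out // big1 => [|s _]; first by rewrite mulr0 subrr; apply: dvx0.
    by rewrite /D0n ltnNge get /= scale0r.
  have Hy : dvx (ymus t - \sum_(s < n.+1) D0n s t *: m0 s).
    case: t lt {H3 Hz e} => [|t] lt.
      rewrite big1 ?subrr => [|s _]; first exact: dvx0.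
      by rewrite /D0n andbF scale0r.
    have := dvxM y (mus_modx lt); rewrite mulrBr -sum_m0_widen; congr (dvx (_ - _)).
    apply: eq_bigr => s _; rewrite /D0n andbT /= Q_sym.
    by have := ltn_ord s; rewrite ltnS leq_eqVlt => /orP[/eqP->|ls]; rewrite ?eqxx ?ltnn // ls ltn_eqF.
  have := dvxD (dvxB (dvxD (dvxx (\sum_(c < n) B1n c t *: mus c)) Hz) Hy) H3; congr dvx.
  ring.
have Es f : E (f * \sum_(s < n.+1) (D0n s t - D0n t s) *: G s) = 0.
  rewrite mulr_sumr dual_eval_sum big1 // => s _; rewrite -scalerAr dual_evalZ.
  by rewrite E_G ?mulr0 // -ltnS.
have Ea f : E (x * (\sum_(c < n) B1n c t *: mus c) * f) = \sum_(c < n) B1n c t * E (x * mus c * f).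
  rewrite mulr_sumr mulr_suml dual_eval_sum; apply: eq_bigr => c _.
  by rewrite -scalerAr -scalerAl dual_evalZ.
apply: mono_cases => [m|c lc]; rewrite mulrDl mulrBl mulrDl !(dual_evalB, dual_evalD) Ea [X in _ + E X]mulrC Es addr0.
  rewrite big1 ?add0r; last by move=> c _; rewrite E_mus_x ?mulr0.
  have sh u p : E (u * p * 'X_[mn3 1 0 0 + m]) = E (x * p * (u * 'X_[m])).
    by rewrite mpolyXD -varx; congr E; ring.
  case: t lt {Es Ea} => [|t] lt.
    rewrite -[ymus 0]/(0 : R) mul0r dual_eval0 subr0 sh E_mus // varz -mpolyXD mcoeffX.
    case: eqP => // /(congr1 (fun m : 'X_{1..3} => m (inord 2))).
    by rewrite mnmDE !mn3E2.
  rewrite -[ymus t.+1]/(y * mus t) !sh (E_mus _ lt) vary -mpolyXD mcoeffX.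
  move: lt; rewrite leq_eqVlt => /orP[/eqP e|lt].
    rewrite mus_out ?e // mulr0 mul0r dual_eval0 sub0r.
    case: eqP => [|_]; last by rewrite oppr0.
    by move=> /(congr1 (fun m : 'X_{1..3} => m (inord 1))); rewrite mnmDE !mn3E1; lia.
  rewrite E_mus // varz -mpolyXD mcoeffX; apply/eqP; rewrite subr_eq0; apply/eqP.
  rewrite [m]mn3_eta /mum !mn3D; congr (nat_of_bool _)%:R.
  move: (m (inord 0)) (m (inord 1)) (m (inord 2)) => a b c.
  by apply/eqP/eqP => /mn3_inj[e0 e1 e2]; congr mn3; lia.
have sh u p : E (u * p * 'X_[mum c]) = E (u * 'X_[mum c] * p) by congr E; ring.
have Em j s : (j <= n)%N -> (s < n)%N -> E (m0 j * mus s) = mxf (B0 n phi) j s.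
  move=> lj ls; rewrite -(E_xL n0 pU) // mulrAC E_mus // -(bm_mum n0 ls) (L_coef _ n0) ?NN_lt //.
  by have lj' : (j < n.+1)%N by []; rewrite [RHS](mxf_ord _ (Ordinal lj') (Ordinal ls)) mxE.
rewrite (bigD1 (Ordinal lc)) //= E_mus_mum // eqxx mulr1 big1 ?addr0; last first.
  by move=> i; rewrite -val_eqE /= => ne; rewrite E_mus_mum // (negPf ne) mulr0.
have -> : E (z * mus t * 'X_[mum c]) = if t == n then 0 else mxf (B0 n phi) c.+1 t.
  have [->|ne] := eqVneq t n; first by rewrite mus_out // mulr0 mul0r dual_eval0.
  by rewrite sh z_mum // Em //; lia.
have -> : E (ymus t * 'X_[mum c]) = if t == 0%N then 0 else mxf (B0 n phi) c t.-1.
  case: t lt {Es Ea} => [|t] lt; first by rewrite -[ymus 0]/(0 : R) mul0r dual_eval0.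
  by rewrite -[ymus t.+1]/(y * mus t) sh y_mum // Em // ltnW.
by rewrite /B1n; ring.
Qed.

End Relations.

(** * Exactness of the complex with middle matrix [b2] *)

Section Exactness.
Variables (k : fieldType) (n : nat) (phi : 'X_{1..3} -> k).
Hypothesis n0 : (0 < n)%N.
Hypothesis pU : pmat n phi \in unitmx.
Local Notation R := (poly3 k).
Local Notation x := (var k 0).
Local Notation y := (var k 1).
Local Notation z := (var k 2).
Local Notation E := (dual_eval n.*2.-1 phi).
Local Notation mus := (mus n phi).
Local Notation L := (L n phi).
Local Notation G := (G n phi).
Local Notation mum := (mum n).
Local Notation m0 := (m0 k n).
Local Notation B := (Bm n phi).
Local Notation B2 := (B2 k n).
Local Notation A' := (Ap n phi).

Definition Gr : 'rV[R]_n.+1 := \row_j G j.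
Definition MU : 'rV[R]_n := \row_c mus c.
Definition hrow : 'rV[R]_(n + n.+1) := row_mx (x *: MU) Gr.

Lemma dvx_scale_add a b (P Q : 'M[R]_(a, b)) i j : x *: P + Q = 0 -> dvx (Q i j).
Proof. by move/eqP; rewrite addrC addr_eq0 -scalerN => /eqP->; rewrite mxE; apply: dvxx. Qed.

Lemma scalex_eq0 a b (P : 'M[R]_(a, b)) : x *: P = 0 -> P = 0.
Proof. by move/eqP; rewrite scalemx_eq0 (negPf (var_neq0 k 0)) => /eqP. Qed.

Lemma B2_row (g : nat -> R) (j : 'I_n) :
  \sum_(t < n.+1) B2 j t * g t = z * g j - y * g j.+1.
Proof.
have lj : (j < n.+1)%N by apply: leq_trans (ltn_ord j) _.
have lj1 : (j.+1 < n.+1)%N by rewrite ltnS.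
transitivity (\sum_(t < n.+1) ((if t == Ordinal lj then z * g t else 0) -
   (if t == Ordinal lj1 then y * g t else 0))).
  apply: eq_bigr => t _; rewrite mxE mulrBl -!val_eqE /=.
  by congr (_ - _); case: eqP; rewrite ?mul0r.
by rewrite sumrB -!big_mkcond !big_pred1_eq.
Qed.

Lemma B2_col (a : nat -> R) (t : 'I_n.+1) : a n = 0 ->
  \sum_(c < n) B2 c t * a c = z * a t - (if t : nat is s.+1 then y * a s else 0).
Proof.
move=> an.
transitivity (\sum_(c < n) (if t == c :> nat then z * a c else 0) -
   \sum_(c < n) (if t == c.+1 :> nat then y * a c else 0)).
  rewrite -sumrB; apply: eq_bigr => c _; rewrite mxE mulrBl.
  by congr (_ - _); case: eqP; rewrite ?mul0r.
congr (_ - _); rewrite -big_mkcond.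
  have := ltn_ord t; rewrite ltnS leq_eqVlt => /orP[/eqP e|lt].
    by rewrite e an mulr0 big_pred0 // => c; apply/negbTE; have := ltn_ord c; lia.
  by rewrite (big_pred1 (Ordinal lt)) // => c; rewrite -val_eqE /= eq_sym.
case: t => [[|t] lt] /=; first by rewrite big_pred0.
by rewrite (big_pred1 (Ordinal (lt : (t < n)%N))) // => c; rewrite -val_eqE /= eqSS eq_sym.
Qed.

Lemma liftkT a b (A : 'M[k]_(a, b)) : (liftk A)^T = liftk A^T.
Proof. by apply/matrixP => i j; rewrite !mxE. Qed.

Lemma liftkN a b (A : 'M[k]_(a, b)) : liftk (- A) = - liftk A.
Proof. by apply/matrixP => i j; rewrite !mxE mpolyCN. Qed.

Lemma liftkM a b c (A : 'M[k]_(a, b)) (C : 'M[k]_(b, c)) : liftk (A *m C) = liftk A *m liftk C.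
Proof.
apply/matrixP => i j; rewrite !mxE rmorph_sum; apply: eq_bigr => l _ /=.
by rewrite !mxE mpolyCM.
Qed.

Lemma liftk1 a : liftk (1%:M : 'M[k]_a) = 1%:M.
Proof. by apply/matrixP => i j; rewrite !mxE; case: eqP => _; rewrite ?mpolyC0 ?mpolyC1. Qed.

Lemma Ap_alt : A'^T = - A'.
Proof. by rewrite /Ap linearB /= trmxK opprB. Qed.

Lemma Ap_diag i : A' i i = 0.
Proof. by rewrite !mxE subrr. Qed.

Lemma Dm_alt : (Dm n phi)^T = - Dm n phi.
Proof. by rewrite /Dm linearZ /= liftkT linearB /= trmxK -opprB liftkN scalerN. Qed.

Lemma Dm_diag i : Dm n phi i i = 0.
Proof. by rewrite !mxE subrr mpolyC0 mulr0. Qed.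

Lemma b2_alt : (b2 n phi)^T = - b2 n phi.
Proof.
rewrite /b2 tr_block_mx opp_block_mx Dm_alt linearN /= trmxK opprK.
by rewrite linearZ /= liftkT Ap_alt liftkN scalerN.
Qed.

Lemma b2_diag i : b2 n phi i i = 0.
Proof.
rewrite -[i]splitK; case: (split i) => j /=.
  by rewrite block_mxEul !mxE subrr mpolyC0 mulr0.
by rewrite block_mxEdr Dm_diag.
Qed.

Lemma b2_mul c (u : 'M[R]_(n, c)) (w : 'M[R]_(n.+1, c)) :
  b2 n phi *m col_mx u w = col_mx (x *: (liftk A' *m u) + B *m w) (Dm n phi *m w - B^T *m u).
Proof. by rewrite /b2 mul_block_col -scalemxAl mulNmx [X in col_mx _ X]addrC. Qed.

Lemma b2_mulr c (w : 'M[R]_(n.+1, c)) : b2 n phi *m col_mx 0 w = col_mx (B *m w) (Dm n phi *m w).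
Proof.
rewrite b2_mul; congr col_mx; first by rewrite mulmx0 scaler0 add0r.
by rewrite mulmx0 subr0.
Qed.

Lemma b2_mull c (u : 'M[R]_(n, c)) :
  b2 n phi *m col_mx u 0 = col_mx (x *: (liftk A' *m u)) (- (B^T *m u)).
Proof.
rewrite b2_mul; congr col_mx; first by rewrite mulmx0 addr0.
by rewrite mulmx0 sub0r.
Qed.

Lemma Bm_mul c (g : 'M[R]_(n.+1, c)) : B *m g = x *: (liftk (B1 n phi) *m g) + B2 *m g.
Proof. by rewrite /Bm mulmxDl scalemxAl. Qed.

Lemma Bt_mul c (g : 'M[R]_(n, c)) : B^T *m g = x *: ((liftk (B1 n phi))^T *m g) + B2^T *m g.
Proof. by rewrite /Bm linearD linearZ /= mulmxDl scalemxAl. Qed.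

(** Since [z m_{0,j} = y m_{0,j+1}], the element [z G_j - y G_{j+1}] is [-x (z L_j - y L_{j+1})],
    and [relation1] rewrites the bracket. *)
Lemma hrow_left : x *: (x *: MU *m liftk A') = Gr *m B^T.
Proof.
apply/rowP => j; rewrite !mxE.
have -> : \sum_t Gr 0 t * B^T t j = x * (\sum_(t < n.+1) B1n n phi j t *: G t) + (z * G j - y * G j.+1).
  rewrite -(B2_row G) mulr_sumr -big_split /=; apply: eq_bigr => t _.
  by rewrite !mxE -/(B1n n phi j t) -mul_mpolyC; ring.
have -> : z * G j - y * G j.+1 = - (x * (z * L j - y * L j.+1)).
  have e : z * m0 j - y * m0 j.+1 = 0 by rewrite zy_m0 // subrr.
  rewrite /G -[RHS]add0r -e; ring.
rewrite relation1 // mulrDr opprD addrA subrr add0r -mulrN; congr (_ * _).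
rewrite mulr_sumr -sumrN; apply: eq_bigr => c _.
rewrite [liftk _ _ _]mxE ![(_ *: MU) _ _]mxE ![MU _ _]mxE mxf_ord.
have -> : A' c j = - A' j c by have /matrixP/(_ j c) := Ap_alt; rewrite !mxE.
by rewrite mpolyCN -mul_mpolyC; ring.
Qed.

Lemma hrow_right : x *: MU *m B = - (Gr *m Dm n phi).
Proof.
apply/eqP; rewrite -subr_eq0 opprK; apply/eqP; rewrite -scalemxAl /Dm -scalemxAr -scalerDr.
apply/rowP => t; rewrite [LHS]mxE [RHS]mxE; apply/eqP; rewrite mulf_eq0; apply/orP; right.
apply/eqP; rewrite [LHS]mxE -[RHS](relation2 n0 pU (t := t)); last by rewrite -ltnS.
have -> : (MU *m B) 0 t = x * (\sum_(c < n) B1n n phi c t *: mus c) + (z * mus t - ymus n phi t).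
  rewrite /ymus -(B2_col (a := mus)) ?mus_out // mulr_sumr -big_split /= mxE.
  by apply: eq_bigr => c _; rewrite !mxE -/(B1n n phi c t) -mul_mpolyC; ring.
rewrite addrA; congr (_ + _); rewrite mxE; apply: eq_bigr => s _.
by rewrite !mxE -/(D0n n phi s t) -/(D0n n phi t s) -mul_mpolyC mulrC.
Qed.

Lemma hrow_b2 : hrow *m b2 n phi = 0.
Proof.
rewrite /hrow /b2 mul_row_block hrow_right -scalemxAr hrow_left mulmxN subrr addNr.
exact: row_mx0.
Qed.

Lemma b2_hrow : b2 n phi *m hrow^T = 0.
Proof. by rewrite -[b2 n phi]opprK -b2_alt mulNmx -trmx_mul hrow_b2 trmx0 oppr0. Qed.

Lemma Gr_homog : mx_homog n Gr.
Proof. by move=> i j; rewrite mxE G_homog // -ltnS. Qed.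

Lemma hrow_homog : mx_homog n hrow.
Proof.
move=> i j; rewrite /hrow mxE; case: split => l; last exact: Gr_homog.
by rewrite !mxE xn1_homog // mus_homog.
Qed.

Lemma xliftk_homog a b (A : 'M[k]_(a, b)) : mx_homog 1 (x *: liftk A).
Proof. by move=> i j; rewrite !mxE; exact: (dhomogM (homog_var k 0) (homog_C (A i j))). Qed.

Lemma B2_homog : mx_homog 1 B2.
Proof. by move=> i j; rewrite mxE rpredB //; case: eqP => _; rewrite ?rpred0 ?homog_var. Qed.

Lemma Bm_homog : mx_homog 1 B.
Proof. by move=> i j; rewrite mxE rpredD ?B2_homog ?xliftk_homog. Qed.

Lemma b2_homog : mx_homog 1 (b2 n phi).
Proof.
move=> i j; rewrite /b2 mxE; case: split => i'; rewrite mxE; case: split => j'.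
- exact: xliftk_homog.
- exact: Bm_homog.
- by rewrite !mxE dhomogN; have := Bm_homog j' i'; rewrite !mxE.
- exact: xliftk_homog.
Qed.

Lemma B2_image (g : 'cV[R]_n.+1) : dvx ((Gr *m g) 0 0) -> exists u g', g = B2^T *m u + x *: g'.
Proof.
move=> H; pose gn t := mxf g t 0%N.
have gnE (t : 'I_n.+1) : gn t = g t 0 by rewrite /gn -[0%N]/(nat_of_ord (@ord0 0)) mxf_ord.
have [|U [U0 Un HU]] := @syzygy_yz k n gn.
  have H2 : dvx (\sum_(t < n.+1) (G t - m0 t) * gn t).
    by apply: dvx_sum => t _; rewrite mulrC; apply/dvxM/G_modx.
  have := dvxB H H2; congr dvx; rewrite mxE -sumrB; apply: eq_bigr => t _.
  by rewrite mxE gnE /m0 /mon3 expr0 mul1r; ring.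
exists (\col_(j < n) U j.+1).
have [|g' eg] := @dvx_mx k _ _ (g - B2^T *m \col_(j < n) U j.+1).
  move=> t c; rewrite !mxE ord1 -gnE; have lt : (t <= n)%N by rewrite -ltnS.
  have := HU t lt; congr (dvx (_ - _)).
  transitivity (z * U t.+1 - (if t : nat is s.+1 then y * U s.+1 else 0)).
    by congr (_ - _); case: (t : nat) => [|s]; rewrite ?U0 ?mulr0.
  rewrite -(B2_col (a := fun c => U c.+1)) //; apply: eq_bigr => c' _.
  by rewrite [B2^T _ _]mxE [(\col_ _ _) _ _]mxE.
by exists g'; rewrite -eg addrC subrK.
Qed.

(** The cokernel of [B2] modulo [x] has finite length, and [E] against [x mus] detects it: sending
    the [c]-th unit vector to [y^c z^(n-1-c)] turns the hypothesis into membership of [P] in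
    [(x, y^n, z^n)]. *)
Lemma B2_onto (a : 'cV[R]_n) : (forall q, E (x * (MU *m a) 0 0 * q) = 0) ->
  exists w a', a = B2 *m w + x *: a'.
Proof.
move=> H; pose an c := mxf a c 0%N.
have anE (c : 'I_n) : an c = a c 0 by rewrite /an -[0%N]/(nat_of_ord (@ord0 0)) mxf_ord.
pose u c := mn3 0 c (n.-1 - c).
pose P := \sum_(c < n) an c * 'X_[u c].
have : in_ideal [seq 'X_[m] | m <- [:: mn3 1 0 0; mn3 0 n 0; mn3 0 0 n]] P.
  apply/in_mono_idealP => m; apply: contraR; rewrite /= !lem_mn3 !leq0n /= !andbT orbF !negb_or -!ltnNge ltnS leqn0.
  move=> /and3P[/eqP mx my mz]; apply/eqP.
  (* For every [c] the exponents satisfy [u c + mum c = m + q], all equal to that of [(yz)^(n-1)];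
     so the coefficient of [mum c] in [a_c q] is that of [m] in [a_c] times the monomial [u c]. *)
  pose q := mn3 0 (n.-1 - m (inord 1)) (n.-1 - m (inord 2)).
  rewrite -(H 'X_[q]) mxE mulr_sumr mulr_suml dual_eval_sum /P raddf_sum.
  apply: eq_bigr => c _ /=; rewrite [MU _ _]mxE mulrA -mulrA E_mus // -anE.
  rewrite -(mcoeffMX _ q) -(mcoeffMX (an c * 'X_[q]) (u c)) -!mulrA ['X_[q] * _]mulrC.
  congr (_@_ _); rewrite [m]mn3_eta mx /u /q /mum !mn3D; have := ltn_ord c => lc.
  by congr mn3; lia.
rewrite /= -varx => /in_ideal3[P' [p1 [p2 eP]]].
(* The terms [z^n p2] and [y^n p1] are absorbed in the two extreme coefficients, so that the [fc]
   form a syzygy modulo [x]. *)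
pose fc c := an c - (if c == 0%N then z * p2 else 0) - (if c == n.-1 then y * p1 else 0).
have uE c : 'X_[u c] = y ^+ c * z ^+ (n.-1 - c) :> R by rewrite -mon3E /mon3 expr0 mul1r.
have eF : \sum_(c < n) y ^+ c * z ^+ (n.-1 - c) * fc c = x * P'.
  have -> : x * P' = P - z ^+ n * p2 - y ^+ n * p1.
    rewrite eP; have -> : 'X_[mn3 0 n 0] = y ^+ n :> R by rewrite -mon3E /mon3 !expr0 mulr1 mul1r.
    have -> : 'X_[mn3 0 0 n] = z ^+ n :> R by rewrite -mon3E /mon3 !expr0 !mul1r.
    by ring.
  have -> : z ^+ n * p2 = \sum_(c < n) (if c == 0%N :> nat then y ^+ c * z ^+ (n.-1 - c) * (z * p2) else 0).
    rewrite -big_mkcond (big_pred1 (Ordinal n0)) => [|c]; last by rewrite /= -val_eqE.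
    by rewrite /= subn0 expr0 mul1r mulrA -exprSr prednK.
  have ln : (n.-1 < n)%N by rewrite prednK.
  have -> : y ^+ n * p1 = \sum_(c < n) (if c == n.-1 :> nat then y ^+ c * z ^+ (n.-1 - c) * (y * p1) else 0).
    rewrite -big_mkcond (big_pred1 (Ordinal ln)) => [|c]; last by rewrite /= -val_eqE.
    by rewrite /= subnn expr0 mulr1 mulrA -exprSr prednK.
  rewrite /P -!sumrB; apply: eq_bigr => c _; rewrite uE /fc.
  by case: eqP; case: eqP => _ _; ring.
have [|U [U0 Un HU]] := @syzygy_yz k n.-1 (fun t => fc (n.-1 - t)%N).
  exists P'; rewrite -eF -(big_mkord xpredT (fun t => y ^+ (n.-1 - t) * z ^+ t * fc (n.-1 - t)%N)).
  rewrite prednK // big_nat_rev big_mkord /= add0n; apply: eq_bigr => c _.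
  have lc := ltn_ord c; have -> : (n.-1 - (n - c.+1))%N = c by lia.
  by have -> : (n - c.+1)%N = (n.-1 - c)%N by lia.
rewrite prednK // in Un.
(* [U] comes from the reversed order of monomials, hence the index [n - t]; the end terms restore
   [p2] and [p1], the latter with a sign because [B2] has [-y] above its diagonal. *)
pose wn t := U (n - t)%N + (if t == 0%N then p2 else 0) - (if t == n then p1 else 0).
exists (\col_(t < n.+1) wn t).
have [|a' ea] := @dvx_mx k _ _ (a - B2 *m \col_(t < n.+1) wn t).
  move=> c i; rewrite !mxE ord1 -anE; have lc := ltn_ord c.
  have -> : \sum_j B2 c j * (\col_(t < n.+1) wn t) j 0 = z * wn c - y * wn c.+1.
    by rewrite -(B2_row wn); apply: eq_bigr => t _; rewrite [(\col_ _ _) _ _]mxE.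
  have lt : (n.-1 - c <= n.-1)%N by lia.
  have := HU _ lt; have -> : (n.-1 - (n.-1 - c))%N = c by lia.
  have -> : (n.-1 - c).+1 = (n - c)%N by lia.
  congr dvx; rewrite /fc /wn (ltn_eqF lc) [c.+1 == 0%N]/=.
  have -> : (c.+1 == n) = (c == n.-1 :> nat) by lia.
  have -> : (n - c.+1)%N = (n.-1 - c)%N by lia.
  by case: eqP; case: eqP => _ _; ring.
by exists a'; rewrite -ea addrC subrK.
Qed.

Lemma ker_hrow (v : 'cV[R]_(n + n.+1)) : hrow *m v = 0 -> exists w, v = b2 n phi *m w.
Proof.
apply: (x_adic_exact hrow_homog b2_homog hrow_b2) => {}v hv.
pose a := usubmx v; pose g := dsubmx v; have ev : v = col_mx a g by rewrite vsubmxK.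
have e0 : x *: (MU *m a) + Gr *m g = 0 by rewrite scalemxAl -mul_row_col -ev.
have [|u [g1 eg]] := @B2_image g.
  exact: dvx_scale_add e0.
(* Adding the boundary of [(u, 0)] makes the second block divisible by [x] and turns the first into
   [a1]. *)
pose a1 := a + x *: (liftk A' *m u).
pose g2 := g1 - (liftk (B1 n phi))^T *m u.
have eg2 : g - B^T *m u = x *: g2.
  by rewrite eg Bt_mul [X in _ - X]addrC /g2 scalerBr opprD addrACA subrr add0r.
clearbody g2.
have ev1 : v + b2 n phi *m col_mx u 0 = col_mx a1 (x *: g2).
  by rewrite ev b2_mull add_col_mx -eg2.
have e1 : MU *m a1 + Gr *m g2 = 0.
  have : hrow *m (v + b2 n phi *m col_mx u 0) = 0 by rewrite mulmxDr hv mulmxA hrow_b2 mul0mx addr0.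
  rewrite ev1 /hrow mul_row_col -scalemxAl -scalemxAr -scalerDr; exact: scalex_eq0.
(* After cancelling [x] the element [MU a1] lies in the ideal of the [G_j], so [E] vanishes on all
   its multiples. *)
have [|w [a2 ea]] := @B2_onto a1.
  move=> q; have -> : (MU *m a1) 0 0 = - (Gr *m g2) 0 0.
    by move/eqP: e1; rewrite addr_eq0 => /eqP->; rewrite mxE.
  rewrite mulrN mulNr mxE mulr_sumr mulr_suml -sumrN dual_eval_sum big1 // => t _.
  rewrite [Gr _ _]mxE (_ : - _ = (- (x * g2 t 0 * q)) * G t); last by ring.
  by rewrite E_G // -ltnS.
pose a3 := a2 - liftk (B1 n phi) *m w.
pose D' := liftk (D0 n phi - (D0 n phi)^T).
exists (col_mx (- u) w), (col_mx a3 (g2 - D' *m w)).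
have -> : col_mx (- u) w = col_mx 0 w - col_mx u 0 by rewrite opp_col_mx add_col_mx oppr0 addr0 sub0r.
rewrite mulmxBr -[v](addrK (b2 n phi *m col_mx u 0)) ev1 addrAC; congr (_ - _).
have e1' : a1 = B *m w + x *: a3.
  rewrite ea Bm_mul /a3 scalerBr [X in _ = X + _]addrC -addrA; congr (_ + _).
  by rewrite [RHS]addrC subrK.
have e2' : x *: g2 = Dm n phi *m w + x *: (g2 - D' *m w).
  by rewrite /Dm -/D' scalerBr -scalemxAl [RHS]addrC subrK.
by rewrite {1}e1' {1}e2' -add_col_mx -scale_col_mx -b2_mulr.
Qed.

Lemma ker_B2 (g : 'cV[R]_n.+1) : (forall j, dvx ((B2 *m g) j 0)) ->
  exists f g', g = Gr^T *m f%:M + x *: g'.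
Proof.
move=> H; pose gn t := mxf g t 0%N.
have gnE (t : 'I_n.+1) : gn t = g t 0 by rewrite /gn -[0%N]/(nat_of_ord (@ord0 0)) mxf_ord.
have [|f Hf] := @kernel_yz k n gn.
  move=> j lj; have := H (Ordinal lj); rewrite mxE; congr dvx.
  by rewrite -(B2_row gn (Ordinal lj)); apply: eq_bigr => t _; rewrite gnE.
exists f; have [|g' eg] := @dvx_mx k _ _ (g - Gr^T *m f%:M).
  move=> t i; rewrite !mxE ord1 big_ord1 !mxE -gnE /=.
  have lt : (t <= n)%N by rewrite -ltnS.
  have := dvxB (Hf t lt) (dvxM f (G_modx n phi t)); congr dvx.
  by rewrite /m0 /mon3 expr0 mul1r mulr1n; ring.
by exists g'; rewrite -eg addrC subrK.
Qed.

Lemma ker_B2t (a : 'cV[R]_n) : (forall t, dvx ((B2^T *m a) t 0)) -> exists a', a = x *: a'.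
Proof.
move=> H; pose an c := mxf a c 0%N.
have anE (c : 'I_n) : an c = a c 0 by rewrite /an -[0%N]/(nat_of_ord (@ord0 0)) mxf_ord.
have an0 : an n = 0 by rewrite /an /mxf insubF // ltnn.
have H' (t : 'I_n.+1) : dvx (z * an t - (if t : nat is s.+1 then y * an s else 0)).
  have := H t; rewrite mxE -(B2_col _ an0); congr dvx; apply: eq_bigr => c _.
  by rewrite [B2^T _ _]mxE anE.
apply: dvx_mx => c i; rewrite ord1 -anE; apply: (@cokernel_yz k n an) => //.
  by have := H' ord0; rewrite /= subr0.
by move=> t lt; have := H' (Ordinal (ltnW lt : (t.+1 < n.+1)%N)).
Qed.

Lemma ker_b2 (v : 'cV[R]_(n + n.+1)) : b2 n phi *m v = 0 -> exists f, v = hrow^T *m f.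
Proof.
have hT : mx_homog n hrow^T by move=> i j; rewrite mxE; apply: hrow_homog.
apply: (x_adic_exact b2_homog hT b2_hrow) => {}v hv.
pose a := usubmx v; pose g := dsubmx v; have ev : v = col_mx a g by rewrite vsubmxK.
move: hv; rewrite ev b2_mul -[0]vsubmxK => /eq_col_mx[].
rewrite linear0 linear0 Bm_mul Bt_mul => e1 e2.
have [|f [g' eg]] := @ker_B2 g.
  move=> j; apply: (@dvx_scale_add _ _ (liftk A' *m a + liftk (B1 n phi) *m g)).
  by rewrite scalerDr -addrA.
have [|a' ea] := @ker_B2t a.
  move=> t; apply: (@dvx_scale_add _ _ ((liftk (B1 n phi))^T *m a - liftk (D0 n phi - (D0 n phi)^T) *m g)).
  apply: oppr_inj; rewrite oppr0 -e2 /Dm -scalemxAl scalerBr.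
  by rewrite addrAC opprB.
exists f%:M, (col_mx (a' - MU^T *m f%:M) g').
rewrite /hrow tr_row_mx mul_col_mx scale_col_mx add_col_mx -eg; congr col_mx.
by rewrite {1}ea scalerBr linearZ /= -scalemxAl addrC subrK.
Qed.

End Exactness.

(** * Generators of the two annihilator ideals *)

Section Ideals.
Variables (k : fieldType) (n : nat) (phi : 'X_{1..3} -> k).
Hypothesis n0 : (0 < n)%N.
Local Notation R := (poly3 k).
Local Notation x := (var k 0).
Local Notation z := (var k 2).
Local Notation E := (dual_eval n.*2.-1 phi).
Local Notation N := (NN n).
Local Notation ms := (ms n phi).
Local Notation mus := (mus n phi).
Local Notation G := (G n phi).
Local Notation bm := (bm n).
Local Notation Gr := (Gr n phi).
Local Notation MU := (MU n phi).

Lemma contractE (p : R) : dual_eval (n.*2 - 2) (contract n.*2.-1 x phi) p = E (x * p).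
Proof.
rewrite dual_eval_mono [X in E (x * X)]mpolyE mulr_sumr dual_eval_sum; apply: eq_bigr => m _.
rewrite -scalerAr dual_evalZ; congr (_ * _); rewrite dual_evalX /contract mulrC.
case: eqP => [//|ne]; rewrite varx -mpolyXD dual_evalX mdegD mdeg_mn3 ifF //.
by apply/negbTE; lia.
Qed.

Lemma IannE p : Iann n phi p <-> Jann n phi (x * p).
Proof.
by split=> H v; have := H v; rewrite ?contractE mulrCA.
Qed.

Lemma in_ideal_size s m (p : R) : size s = m ->
  in_ideal s p <-> exists c : 'I_m -> R, p = \sum_(i < m) c i * s`_i.
Proof. by move=> <-. Qed.

Lemma dual_eval_hc d (psi : 'X_{1..3} -> k) (p : R) : dual_eval d psi (hc d p) = dual_eval d psi p.
Proof.
rewrite [p]mpolyE hc_sum !dual_eval_sum; apply: eq_bigr => m _.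
rewrite /hc linearZ /= pihomogX !dual_evalZ; case: eqP => // ne.
by rewrite dual_eval0 dual_evalX (introF eqP ne).
Qed.

Lemma Jann_hc d p : Jann n phi p -> Jann n phi (hc d p).
Proof.
move=> H v; have [K ->] := hc_partition v; rewrite mulr_suml dual_eval_sum big1 // => e _.
have [ed|ne] := eqVneq (e + d)%N n.*2.-1; last first.
  by apply: (@dual_eval_ne _ _ _ (e + d)) => //; rewrite dhomogM ?hc_homog.
by rewrite -(hcM _ _ (hc_homog e v)) ed dual_eval_hc H.
Qed.

Lemma JannD p q : Jann n phi p -> Jann n phi q -> Jann n phi (p + q).
Proof. by move=> Hp Hq v; rewrite mulrDr dual_evalD Hp Hq addr0. Qed.

Lemma JannM p q : Jann n phi p -> Jann n phi (q * p).
Proof. by move=> Hp v; rewrite mulrA Hp. Qed.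

Lemma Jann_sum (I : Type) (r : seq I) (P : pred I) (F : I -> R) :
  (forall i, P i -> Jann n phi (F i)) -> Jann n phi (\sum_(i <- r | P i) F i).
Proof.
move=> H; apply: (big_ind (Jann n phi)) => //; last exact: JannD.
by move=> v; rewrite mulr0 dual_eval0.
Qed.

(** The ideal generated by the [G_j] and the [x^a mus_c]. The value [a = 1] gives [I], [a = 2] gives
    [J], and [a = 0] is auxiliary. *)
Definition inGM (a : nat) (p : R) :=
  exists (c : 'cV[R]_n.+1) (d : 'cV[R]_n), p = (Gr *m c) 0 0 + x ^+ a * (MU *m d) 0 0.

Lemma addmx_entry a b (A B : 'M[R]_(a, b)) i j : (A + B) i j = A i j + B i j. Proof. by rewrite mxE. Qed.

Lemma inGM0 a : inGM a 0.
Proof. by exists 0, 0; rewrite !mulmx0 !mxE mulr0 addr0. Qed.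

Lemma inGMD a p q : inGM a p -> inGM a q -> inGM a (p + q).
Proof.
move=> [c [d ->]] [c' [d' ->]]; exists (c + c'), (d + d').
by rewrite !mulmxDr !addmx_entry; ring.
Qed.

Lemma inGMM a p q : inGM a p -> inGM a (q * p).
Proof.
move=> [c [d ->]]; exists (q *: c), (q *: d); rewrite -!scalemxAr.
have e (A : 'M[R]_1) : (q *: A) 0 0 = q * A 0 0 by rewrite mxE.
by rewrite !e; ring.
Qed.

Lemma inGM_sum a (I : Type) (r : seq I) (P : pred I) (F : I -> R) :
  (forall i, P i -> inGM a (F i)) -> inGM a (\sum_(i <- r | P i) F i).
Proof. by move=> H; apply: (big_ind (inGM a)) => //; [exact: inGM0|exact: inGMD]. Qed.

Lemma inGMx a b p : inGM b p -> inGM (a + b) (x ^+ a * p).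
Proof.
move=> [c [d ->]]; exists (x ^+ a *: c), d; rewrite -scalemxAr.
have e (A : 'M[R]_1) : (x ^+ a *: A) 0 0 = x ^+ a * A 0 0 by rewrite mxE.
by rewrite e exprD; ring.
Qed.

Lemma inGM_G a (c : 'cV[R]_n.+1) : inGM a ((Gr *m c) 0 0).
Proof. by exists c, 0; rewrite mulmx0 [X in _ + _ * X]mxE mulr0 addr0. Qed.

Lemma inGM_mus a c : (c < n)%N -> inGM a (x ^+ a * mus c).
Proof.
move=> lc; exists 0, (delta_mx (Ordinal lc) 0); rewrite mulmx0 [X in X + _]mxE add0r; congr (_ * _).
by rewrite -colE !mxE.
Qed.

Hypothesis pU : pmat n phi \in unitmx.

Lemma Gr_Jann (c : 'cV[R]_n.+1) : Jann n phi ((Gr *m c) 0 0).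
Proof.
rewrite mxE; apply: Jann_sum => t _; rewrite mulrC; apply: JannM => v.
by rewrite mxE E_G // -ltnS.
Qed.

Lemma x2mus_Jann c : (c < n)%N -> Jann n phi (x * (x * mus c)).
Proof.
move=> lc v; rewrite (_ : v * _ = x * mus c * (x * v)); last by ring.
rewrite E_mus // varx mcoeffXM0 // lem_mn3 mn3E0.
by [].
Qed.

Lemma reduce_step d p : p \is d.-homog -> (n <= d)%N -> exists (c : 'cV[R]_n.+1) p', p = (Gr *m c) 0 0 + x * p'.
Proof.
move=> hp ld.
have : in_ideal [seq 'X_[m] | m <- mn3 1 0 0 :: mkseq (fun t => mn3 0 (n - t) t) n.+1] p.
  apply/in_mono_idealP => m pm.
  have dm : mdeg m = d by apply: (dhomog_mf hp); rewrite mcoeff_msupp.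
  rewrite mdeg3 in dm; apply/hasP; have [m0'|m0'] := ltnP 0%N (m (inord 0)).
    by exists (mn3 1 0 0); rewrite ?inE ?eqxx // lem_mn3 m0'.
  (* A monomial of degree at least [n] without [x] is divisible by some [m_{0,t}]; [t] is the
     exponent of [z] capped at [n]. *)
  exists (mn3 0 (n - minn n (m (inord 2))) (minn n (m (inord 2)))); last by rewrite lem_mn3; lia.
  by rewrite inE; apply/orP; right; apply/mapP; exists (minn n (m (inord 2))) => //; rewrite mem_iota; lia.
rewrite map_cons -varx => /in_ideal_cons[r [t [/(in_ideal_size _ (m := n.+1))]]].
rewrite size_map size_mkseq => /(_ erefl)[c ->] ->.
exists (\col_i c i), (r + \sum_(i < n.+1) c i * L n phi i).
rewrite mxE mulrDr mulr_sumr addrCA -big_split [x * r]mulrC; congr (_ + _).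
apply: eq_bigr => i _; rewrite (nth_map 0%MM) ?size_mkseq // nth_mkseq // -m0E !mxE /= /G; ring.
Qed.

Lemma reduce s p : p \is (n.-1 + s).-homog ->
  exists (c : 'cV[R]_n.+1) f, f \is n.-1.-homog /\ p = (Gr *m c) 0 0 + x ^+ s * f.
Proof.
elim: s p => [|s IH] p hp.
  by exists 0, p; rewrite addn0 in hp; split=> //; rewrite mulmx0 mxE add0r expr0 mul1r.
rewrite addnS in hp; have [|c [p' ep]] := reduce_step hp; first by lia.
have [c1 ec1] := hcmx_image c (n.-1 + s).+1 (Gr_homog phi n0).
have ep' : p = (Gr *m c1) 0 0 + x * hc (n.-1 + s) p'.
  rewrite -(hc_id hp) {1}ep hcD (hcM p' (n.-1 + s) (homog_var k 0)); congr (_ + _).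
  by rewrite -ec1 [RHS]mxE.
have [c2 [f [hf ef]]] := IH _ (hc_homog (n.-1 + s) p').
exists (c1 + x *: c2), f; split=> //; rewrite ep' ef mulmxDr addmx_entry -scalemxAr.
have e (A : 'M[R]_1) : (x *: A) 0 0 = x * A 0 0 by rewrite mxE.
by rewrite e exprS; ring.
Qed.

Lemma E_xf_expand e s p (c : 'cV[R]_n.+1) f : p = (Gr *m c) 0 0 + x ^+ s * f ->
  (forall q, E (x ^+ e * p * q) = 0) -> forall q, E (x ^+ (e + s) * f * q) = 0.
Proof.
move=> ep H q; have := H q; rewrite ep.
have -> : x ^+ e * ((Gr *m c) 0 0 + x ^+ s * f) * q = (x ^+ e * q) * (Gr *m c) 0 0 + x ^+ (e + s) * f * q.
  by rewrite exprD; ring.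
by rewrite dual_evalD Gr_Jann add0r.
Qed.

Lemma bm_xdeg l a : (l < N)%N -> (a <= bm l (inord 0))%N -> exists m, bm l = (mn3 a 0 0 + m)%MM.
Proof.
move=> ll la; exists (bm l - mn3 a 0 0)%MM; rewrite addmC submK // lem_mn3 la !leq0n //.
Qed.

(* [x ms_l - z ms_l'] lies in [I] when [x] divides [m_l] and [m_l' = z m_l / x],
   which lowers the power of [x] needed. *)
Lemma xms_in a l : (l < N)%N -> bm l (inord 0) = a -> inGM 0 (x ^+ a * ms l).
Proof.
elim: a l => [|a IH] l ll la.
  have [c lc ec] := mum_onto n0 (bm_deg n0 ll) la; rewrite -(bm_mum n0 lc) in ec.
  rewrite (bm_inj n0 ll (NN_lt lc) ec); exact: inGM_mus.
have [|m em] := @bm_xdeg l 1 ll; first by rewrite la.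
have dm : mdeg (mn3 0 0 1 + m) = n.-1.
  by rewrite -(bm_deg n0 ll) em !mdegD !mdeg_mn3.
have [l' ll' el'] := bm_onto n0 dm.
have la' : bm l' (inord 0) = a.
  by move: la; rewrite em -el' !mnmDE !mn3E0; lia.
pose f := x * ms l - z * ms l'.
have hf : f \is (n.-1 + 1).-homog.
  by rewrite addnC rpredB // dhomogM ?homog_var ?ms_homog.
have Ef q : E (x ^+ 1 * f * q) = 0.
  rewrite expr1 /f (_ : _ * q = x * ms l * (x * q) - x * ms l' * (z * q)); last by ring.
  by rewrite dual_evalB !E_ms // em -el' varx varz !mcoeffXM subrr.
have [c [f' [hf' ef]]] := reduce hf.
have Ef' := E_xf_expand ef Ef.
have inf : inGM 0 f.
  rewrite ef; apply: inGMD; first exact: inGM_G.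
  apply: inGMM; rewrite (ms_expand n0 pU hf'); apply: inGM_sum => i _.
  (* In the expansion of [f'], the coefficient at [ms_i] is [E(x f' m_i)], which is zero once [x]
     divides [m_i]; only the [mus_c] remain. *)
  have [ei|/eqP nei] := eqVneq (bm i (inord 0)) 0%N.
    have [d ld ed] := mum_onto n0 (bm_deg n0 (ltn_ord i)) ei; rewrite -(bm_mum n0 ld) in ed.
    rewrite -mul_mpolyC; apply: inGMM.
    by rewrite (bm_inj n0 (ltn_ord i) (NN_lt ld) ed) -[ms _]mul1r -(expr0 x); apply: inGM_mus.
  have [|m' em'] := @bm_xdeg i 1 (ltn_ord i); first by lia.
  rewrite mbE // em' mpolyXD -varx (_ : x * f' * _ = x ^+ (1 + 1) * f' * 'X_[m']); last by ring.
  by rewrite Ef' scale0r; apply: inGM0.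
rewrite (_ : _ * ms l = x ^+ a * f + z * (x ^+ a * ms l')); last by rewrite /f exprS; ring.
by apply: inGMD; apply: inGMM => //; apply: IH.
Qed.

(** Multiplying by [x^(n-1-d)] reaches degree [n-1], where the form [E(x f g)] is nondegenerate. *)
Lemma low_degree_zero d p : p \is d.-homog -> (d < n)%N -> (forall q, E (x * p * q) = 0) -> p = 0.
Proof.
move=> hp ld H; suff : x ^+ (n.-1 - d) * p = 0.
  by move/eqP; rewrite mulf_eq0 expf_eq0 (negPf (var_neq0 k 0)) andbF /= => /eqP.
apply: (test_zero n0 pU).
  have := dhomogM (dhomogMn (n.-1 - d) (homog_var k 0)) hp.
  by rewrite mul1n subnK //; lia.
move=> m _; rewrite (_ : x * _ * _ = x * p * (x ^+ (n.-1 - d) * 'X_[m])) ?H //; ring.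
Qed.

(** Treats [J] ([e = 0]) and its colon by [x], which is [I] ([e = 1]), together. *)
Lemma colon_gen e d p : (e <= 1)%N -> p \is d.-homog -> (forall q, E (x ^+ e * p * q) = 0) ->
  inGM (2 - e) p.
Proof.
move=> le hp H; have [ld|gd] := ltnP d n.
  rewrite (low_degree_zero hp ld) => [|q]; first exact: inGM0.
  have := H (x ^+ (1 - e) * q); rewrite (_ : _ * _ * _ = x ^+ (e + (1 - e)) * p * q).
    by rewrite subnKC // expr1.
  by rewrite exprD; ring.
have ed : d = (n.-1 + (d - n.-1))%N by lia.
move: hp; rewrite {1}ed; move es : (d - n.-1)%N => s hp.
have [c [f [hf ef]]] := reduce hp; have Ef := E_xf_expand ef H.
rewrite ef; apply: inGMD; first exact: inGM_G.
rewrite (ms_expand n0 pU hf) mulr_sumr; apply: inGM_sum => l _; rewrite -scalerAr.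
(* If the [x]-exponent of [m_l] is at least [e+s-1], then [x m_l] is a multiple of [x^(e+s)] and the
   coefficient of [ms_l] vanishes. Otherwise that exponent is at most [s-(2-e)], so [x^s ms_l] is
   [x^(2-e)] times a multiple of the element treated by [xms_in]. *)
have [la|ga] := leqP (e + s).-1 (bm l (inord 0)).
  have [m em] := bm_xdeg (ltn_ord l) la.
  rewrite mbE // em mpolyXD (_ : x * f * _ = x ^+ (e + s) * f * 'X_[m]) ?Ef ?scale0r; first exact: inGM0.
  have -> : 'X_[mn3 (e + s).-1 0 0] = x ^+ (e + s).-1 :> R by rewrite -mon3E /mon3 !expr0 !mulr1.
  have -> : x ^+ (e + s) = x * x ^+ (e + s).-1 by rewrite -exprS prednK //; lia.
  by ring.
rewrite -mul_mpolyC; apply: inGMM.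
have -> : s = (2 - e + (s - (2 - e) - bm l (inord 0)) + bm l (inord 0))%N by lia.
rewrite !exprD -!mulrA -[(2 - e)%N]addn0 exprD expr0 mulr1; apply: inGMx; apply: inGMM.
exact: xms_in.
Qed.

Lemma Jann_gen p : Jann n phi p <-> inGM 2 p.
Proof.
split=> [Jp|[c [d ->]]].
  have [K ->] := hc_partition p; apply: inGM_sum => e _.
  apply: (@colon_gen 0 e) => //; first exact: hc_homog.
  by move=> q; rewrite expr0 mul1r mulrC Jann_hc.
apply: JannD; first exact: Gr_Jann.
rewrite mxE mulr_sumr; apply: Jann_sum => t _.
rewrite !mxE (_ : x ^+ 2 * _ = d t 0 * (x * (x * mus t))); last by ring.
by apply/JannM/x2mus_Jann.
Qed.

Lemma Iann_gen p : Iann n phi p <-> inGM 1 p.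
Proof.
rewrite IannE; split=> [Jp|[c [d ->]]].
  have [K ->] := hc_partition p; apply: inGM_sum => e _.
  apply: (@colon_gen 1 e) => //; first exact: hc_homog.
  move=> q; rewrite expr1 mulrC -(hcM p e (homog_var k 0)); exact: Jann_hc.
rewrite mulrDr; apply: JannD; first exact/JannM/Gr_Jann.
rewrite mxE !mulr_sumr; apply: Jann_sum => t _.
rewrite !mxE (_ : x * _ = d t 0 * (x * (x * mus t))); last by ring.
by apply/JannM/x2mus_Jann.
Qed.

End Ideals.

(** * The Pfaffian rows *)

Section PfaffianRows.
Variables (k : fieldType) (n : nat) (phi : 'X_{1..3} -> k).
Hypothesis n0 : (0 < n)%N.
Hypothesis pU : pmat n phi \in unitmx.
Local Notation R := (poly3 k).
Local Notation x := (var k 0).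
Local Notation y := (var k 1).
Local Notation z := (var k 2).
Local Notation Gr := (Gr n phi).
Local Notation MU := (MU n phi).
Local Notation hrow := (hrow n phi).
Local Notation B := (Bm n phi).

Definition evz : R -> k := meval (fun i : 'I_3 => (i == inord 2)%:R).
HB.instance Definition _ := GRing.RMorphism.on evz.

Lemma evz_var i : (i < 3)%N -> evz (var k i) = (i == 2)%:R.
Proof. by move=> li; rewrite /evz /var mevalXU -val_eqE /= !inordK. Qed.

Lemma evzC c : evz c%:MP = c. Proof. exact: mevalC. Qed.

Lemma evz_Bm (i j : nat) : (i < n)%N -> (j <= n)%N -> evz (mxf B i j) = (i == j)%:R.
Proof.
move=> li lj; rewrite (mxf_ord _ (Ordinal li) (Ordinal (lj : (j < n.+1)%N))) !mxE.
rewrite [i == j]eq_sym rmorphD rmorphM /= evz_var // mul0r add0r /=.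
have ez : evz z = 1 by rewrite evz_var.
have ey : evz y = 0 by rewrite evz_var.
by case: eqP => _; case: eqP => _; rewrite rmorphB /= ?ez ?ey ?rmorph0 ?subr0.
Qed.

(** Proportional rows with a nonzero entry of common degree [n] have a proportionality factor of
    degree 0. *)
Lemma scalar_of_homog m (P Q : 'rV[R]_m) (f : R) j :
  P = f *: Q -> P 0 j \is n.-homog -> Q 0 j \is n.-homog -> P 0 j != 0 ->
  exists2 c : k, c != 0 & P = c%:MP *: Q.
Proof.
move=> eP hP hQ nP; have ej : P 0 j = f * Q 0 j by rewrite eP mxE.
have Q0 : Q 0 j != 0 by apply: contraNneq nP; rewrite ej => ->; rewrite mulr0.
have f0 : f = hc 0 f.
  apply: (mulfI Q0); rewrite -(hcM f 0 hQ) addn0 [Q 0 j * f]mulrC -ej hc_id //.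
have [c ec] := homog0_const (hc_homog 0 f).
exists c; last by rewrite eP {1}f0 ec.
by apply: contraNneq nP => c0; rewrite ej f0 ec c0 mpolyC0 mul0r.
Qed.

Lemma evz_b2 (i j : 'I_(n + n)) : evz (mxf (b2 n phi) i j) =
  (block_mx 0 1%:M (- 1%:M) 0 : 'M[k]_(n + n)) i j.
Proof.
have l1 (u : 'I_n) : (u : nat) = @lshift n n.+1 u by [].
have r1 (u : 'I_n) : (n + u)%N = @rshift n n.+1 (widen_ord (leqnSn n) u) by [].
rewrite -[i]splitK -[j]splitK; case: (split i) => u; case: (split j) => v /=.
- by rewrite block_mxEul (l1 u) (l1 v) mxf_ord /b2 block_mxEul !mxE rmorphM /= evz_var // mul0r.
- rewrite block_mxEur (l1 u) (r1 v) mxf_ord /b2 block_mxEur -mxf_ord evz_Bm ?mxE //=.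
  exact: ltnW.
- rewrite block_mxEdl (r1 u) (l1 v) mxf_ord /b2 block_mxEdl !mxE rmorphN /=.
  have := evz_Bm (ltn_ord v) (ltnW (ltn_ord u)).
  have -> : mxf B v u = B v (widen_ord (leqnSn n) u) by rewrite -mxf_ord.
  by rewrite !mxE => ->; rewrite -val_eqE eq_sym.
- by rewrite block_mxEdr (r1 u) (r1 v) mxf_ord /b2 block_mxEdr !mxE rmorphM /= evz_var // mul0r.
Qed.

(** With the last index deleted, [b2] at [(0,0,1)] is the standard symplectic matrix. *)
Lemma b1_last : b1 n phi 0 (rshift n ord_max) != 0.
Proof.
rewrite mxE mulf_eq0 signr_eq0 /=; apply/negP => /eqP/(congr1 evz)/eqP.
rewrite rmorph0 rmorph_pf; apply/negP.
have -> : (n + n.+1).-1 = (n + n)%N by rewrite addnS.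
pose M : 'M[k]_(n + n) := \matrix_(i, j) evz (mxf (b2 n phi) i j).
have [aN a0] := mxf_alt (b2_alt n phi) (@b2_diag k n phi).
apply: (@pf_neq0 _ _ M).
- by rewrite addnn odd_double.
- by apply/matrixP => i j; rewrite !mxE aN rmorphN.
- by move=> i; rewrite mxE a0 rmorph0.
- have -> : M = block_mx 0 1%:M (- 1%:M) 0 by apply/matrixP => i j; rewrite mxE evz_b2.
  have e : block_mx 0 1%:M (- 1%:M) 0 *m block_mx 0 (- 1%:M) 1%:M 0 = 1%:M :> 'M[k]_(n + n).
    by rewrite mulmx_block !mulmx0 !mul0mx !addr0 !add0r mul1mx mulmxN mulNmx mulmx1 opprK -scalar_mx_block.
  by case/mulmx1_unit: e.
by move=> i j; rewrite mxE /del /= !ltn_ord.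
Qed.

Lemma b1_homog : mx_homog n (b1 n phi).
Proof.
move=> i j; rewrite mxE.
have -> : (n + n.+1).-1 = n.*2 by rewrite addnS addnn.
have H : pf n.*2 (fun p q => mxf (b2 n phi) (del j p) (del j q)) \is n.-homog.
  by rewrite -[X in X.-homog]mul1n; apply: pf_homog => p q; apply/mxf_homog/b2_homog.
by rewrite -signr_odd; case: odd; rewrite ?expr1 ?expr0 ?mulN1r ?mul1r ?dhomogN.
Qed.

Lemma b1_hrow : exists2 c : k, c != 0 & b1 n phi = c%:MP *: hrow.
Proof.
have e : b2 n phi *m (b1 n phi)^T = 0.
  apply: trmx_inj; rewrite trmx_mul trmxK b2_alt mulmxN signed_pfaffians_mul ?trmx0 ?oppr0 //.
  - exact: b2_alt.
  - exact: b2_diag.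
have [f ef] := ker_b2 n0 pU e.
apply: (@scalar_of_homog _ _ _ (f 0 0) (rshift n ord_max)).
- by rewrite -[LHS]trmxK ef trmx_mul trmxK [f]mx11_scalar tr_scalar_mx mul_scalar_mx mxE.
- exact: b1_homog.
- exact: hrow_homog.
- exact: b1_last.
Qed.

Lemma hrow_col (d : 'cV[R]_n) (c : 'cV[R]_n.+1) : (hrow *m col_mx d c) 0 0 = (Gr *m c) 0 0 + x * (MU *m d) 0 0.
Proof. by rewrite /hrow mul_row_col -scalemxAl addrC addmx_entry [X in _ + X]mxE. Qed.

Lemma CV_scale (c : k) : c != 0 -> (c%:MP : R) * c^-1%:MP = 1.
Proof. by move=> c0; rewrite -mpolyCM divff. Qed.

Lemma Iann_b1 p : Iann n phi p <-> exists v : 'cV[R]_(n + n.+1), p = (b1 n phi *m v) 0 0.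
Proof.
have [c c0 ->] := b1_hrow; rewrite (Iann_gen n0 pU); split=> [[d [u ep]]|[v ->]].
  exists (c^-1%:MP *: col_mx u d); rewrite -scalemxAl -scalemxAr scalerA CV_scale // scale1r.
  by rewrite hrow_col ep expr1.
rewrite -scalemxAl scalemxAr -[c%:MP *: v]vsubmxK hrow_col.
by exists (dsubmx (c%:MP *: v)), (usubmx (c%:MP *: v)); rewrite expr1.
Qed.

Lemma graded_entryP (p : R) dt ds d : (dt < ds)%N -> (ds - dt = d)%N -> p \is d.-homog -> graded_entry p dt ds.
Proof. by move=> l e h; right; rewrite e. Qed.

Lemma min_free_res_I : min_free_res3 (Iann n phi)
     (fun _ => n) (fun _ => n.+1) (fun _ => n.*2.+1) (b1 n phi) (b2 n phi) (b3 n phi).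
Proof.
have [c c0 eb] := b1_hrow.
split; first by move=> j; apply: (@graded_entryP _ _ _ n) (b1_homog _ _) => //; rewrite subn0.
split; first by move=> i j; apply: (@graded_entryP _ _ _ 1); rewrite ?subSnn //; apply: b2_homog.
split.
  move=> i j; rewrite mxE; apply: (@graded_entryP _ _ _ n) (b1_homog _ _); lia.
split; first exact: Iann_b1.
have e12 : b1 n phi *m b2 n phi = 0 by rewrite eb -scalemxAl hrow_b2 // scaler0.
split=> //; split.
  by apply: trmx_inj; rewrite trmx_mul trmxK b2_alt mulmxN e12 trmx0 oppr0.
split.
  move=> v; rewrite eb -scalemxAl => /eqP; rewrite scalemx_eq0 mpolyC_eq0 (negPf c0) => /eqP.
  exact: ker_hrow.
split.
  move=> v /(ker_b2 n0 pU)[f ->]; exists (c^-1%:MP *: f).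
  have eT : (c%:MP *: hrow)^T = c%:MP *: hrow^T by apply/matrixP => i j; rewrite !mxE.
  by rewrite /b3 eb eT -scalemxAl -scalemxAr scalerA CV_scale // scale1r.
move=> v; rewrite [v]mx11_scalar /b3 mul_mx_scalar => /matrixP/(_ (rshift n ord_max) 0).
rewrite [X in X = _ -> _]mxE [X in _ = X -> _]mxE => /eqP; rewrite mulf_eq0 [_^T _ _]mxE (negPf b1_last) orbF => /eqP ->.
by apply/matrixP => i j; rewrite !mxE mul0rn.
Qed.

End PfaffianRows.

(** * The resolution of [R/J] *)

Section Quadratic.
Variables (k : fieldType) (n : nat) (phi : 'X_{1..3} -> k).
Hypothesis n0 : (0 < n)%N.
Hypothesis pU : pmat n phi \in unitmx.
Local Notation R := (poly3 k).
Local Notation x := (var k 0).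
Local Notation G := (G n phi).
Local Notation Gr := (Gr n phi).
Local Notation MU := (MU n phi).
Local Notation hrow := (hrow n phi).
Local Notation B := (Bm n phi).
Local Notation A' := (Ap n phi).
Local Notation Ai := (liftk (invmx (Ap n phi))).
Local Notation B2 := (B2 k n).

Lemma mcoeff_hc d (p : R) m : mdeg m = d -> (hc d p)@_m = p@_m.
Proof.
move=> dm; rewrite [p]mpolyE hc_sum !raddf_sum; apply: eq_bigr => u _ /=.
rewrite /hc linearZ /= pihomogX !mcoeffZ; case: eqP => // ne.
rewrite mcoeff0 mcoeffX; by case: eqP => // eu; case: ne; rewrite eu.
Qed.

(** Multiples of a form of degree [d] have no terms below degree [d], and in degree [d] they are
    scalar multiples of it. This is what makes minimality of generators visible on coefficients. *)
Lemma mcoeff_mul_homog (q s : R) d m : s \is d.-homog -> (mdeg m <= d)%N -> s@_m = 0 -> (q * s)@_m = 0.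
Proof.
move=> hs; rewrite leq_eqVlt => /orP[/eqP e|lt] sm.
  rewrite -(mcoeff_hc (q * s) erefl) e mulrC -[d]addn0 (hcM q 0 hs).
  by have [c ->] := homog0_const (hc_homog 0 q); rewrite mulrC mcoeffCM sm mulr0.
by rewrite -(mcoeff_hc (q * s) erefl) mulrC (hcM_lt _ hs) ?mcoeff0.
Qed.

Lemma G_coef j t : (t <= n)%N -> (G j)@_(mn3 0 (n - t) t) = (j == t)%:R.
Proof.
move=> lt; rewrite /G mcoeffB m0E mcoeffX varx mcoeffXM0 ?subr0; last by rewrite lem_mn3 mn3E0.
congr (nat_of_bool _)%:R; apply/eqP/eqP => [/mn3_inj[]//|->//].
Qed.

Lemma Gr_free (u : 'cV[k]_n.+1) : Gr *m liftk u = 0 -> u = 0.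
Proof.
move=> e; apply/colP => t; rewrite mxE; have lt : (t <= n)%N by rewrite -ltnS.
move/matrixP/(_ 0 0)/(congr1 (mcoeff (mn3 0 (n - t) t))): e; rewrite !mxE mcoeff0 raddf_sum => e.
rewrite -[RHS]e (bigD1 t) //= !mxE mulrC mcoeffCM G_coef // eqxx mulr1 big1 ?addr0 // => j ne.
by rewrite !mxE mulrC mcoeffCM G_coef // -val_eqE /= in ne *; rewrite (negPf ne) mulr0.
Qed.

Section Invertible.
Hypothesis AU : A' \in unitmx.

Lemma AiA : Ai *m liftk A' = 1%:M. Proof. by rewrite -liftkM mulVmx // liftk1. Qed.
Lemma AAi : liftk A' *m Ai = 1%:M. Proof. by rewrite -liftkM mulmxV // liftk1. Qed.

Lemma invmx_Ap_alt : (invmx A')^T = - invmx A'.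
Proof.
apply: (can_inj (mulKmx AU)); rewrite mulmxN mulmxV //.
have /(congr1 trmx) : invmx A' *m A' = 1%:M by rewrite mulVmx.
by rewrite trmx_mul trmx1 Ap_alt mulNmx => <-; rewrite opprK.
Qed.

Lemma invmx_Ap_diag i : invmx A' i i = 0.
Proof.
have e : invmx A' *m A' *m (invmx A')^T = - invmx A' by rewrite mulVmx // mul1mx invmx_Ap_alt.
have := alt_congruence_diag (invmx A') i (Ap_alt n phi) (@Ap_diag k n phi).
by rewrite e mxE => /eqP; rewrite oppr_eq0 => /eqP.
Qed.

Lemma c2_alt : (c2 n phi)^T = - c2 n phi.
Proof.
rewrite /c2 linearD linearZ /= Dm_alt scalerN !trmx_mul trmxK liftkT invmx_Ap_alt liftkN.
by rewrite mulNmx mulmxN mulmxA -opprD.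
Qed.

Lemma c2_diag i : c2 n phi i i = 0.
Proof.
rewrite /c2 addmx_entry [X in _ + X]mxE Dm_diag mulr0 addr0 -{2}[B]trmxK.
apply: alt_congruence_diag; first by rewrite liftkT invmx_Ap_alt liftkN.
by move=> j; rewrite mxE invmx_Ap_diag mpolyC0.
Qed.

Lemma mx_homogM a b c e e' (M : 'M[R]_(a, b)) (P : 'M[R]_(b, c)) :
  mx_homog e M -> mx_homog e' P -> mx_homog (e + e') (M *m P).
Proof. by move=> hM hP i j; rewrite mxE; apply: homog_sum => l _; apply: dhomogM. Qed.

Lemma c2_homog : mx_homog 2 (c2 n phi).
Proof.
have hB : mx_homog 1 B^T by move=> i j; rewrite mxE; apply: Bm_homog.
have hA : mx_homog 0 Ai by move=> i j; rewrite mxE; apply: homog_C.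
have h1 := mx_homogM (mx_homogM hB hA) (@Bm_homog k n phi).
move=> i j; rewrite /c2 addmx_entry; apply: rpredD; first exact: (h1 i j).
rewrite mxE; exact: (dhomogM (homog_var k 0) (@xliftk_homog _ _ _ _ i j)).
Qed.

(** When [A'] is invertible the generators [x^2 mus_c] of [J] are redundant. *)
Lemma x2MU : x *: (x *: MU) = Gr *m B^T *m Ai.
Proof.
by rewrite -hrow_left // -scalemxAl -(mulmxA (x *: MU)) AAi mulmx1.
Qed.

Lemma Gr_c2 : Gr *m c2 n phi = 0.
Proof.
rewrite /c2 mulmxDr !mulmxA -x2MU -!scalemxAl -scalemxAr -scalerDr.
by rewrite scalemxAl hrow_right // addNr scaler0.
Qed.

Lemma c2_Gr : c2 n phi *m Gr^T = 0.
Proof. by rewrite -[c2 n phi]opprK -c2_alt mulNmx -trmx_mul Gr_c2 trmx0 oppr0. Qed.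

(** With [t = A'^-1 B w], the equation reads [B^T t + x D w = 0]. Modulo [x] it forces [t = 0],
    hence [B w = A' t] vanishes modulo [x], and the kernel of [B2] is known. *)
Lemma ker_c2 (w : 'cV[R]_n.+1) : c2 n phi *m w = 0 -> exists f, w = Gr^T *m f.
Proof.
have hT : mx_homog n Gr^T by move=> i j; rewrite mxE; apply: Gr_homog.
apply: (x_adic_exact c2_homog hT c2_Gr) => {}w cw.
pose t := Ai *m (B *m w).
have e1 : x *: (Dm n phi *m w + (liftk (B1 n phi))^T *m t) + B2^T *m t = 0.
  rewrite scalerDr -addrA -Bt_mul -[RHS]cw /c2 mulmxDl -!mulmxA -/t -scalemxAl.
  exact: addrC.
have [t' et] : exists t', t = x *: t' by apply: (@ker_B2t k n phi) => // i; apply: dvx_scale_add e1.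
have e2 : B *m w = x *: (liftk A' *m t') by rewrite scalemxAr -et /t (mulmxA (liftk A')) AAi mul1mx.
have [|f [w' ew]] := @ker_B2 k n phi w.
  move=> j; move: e2; rewrite Bm_mul => e2.
  apply: (@dvx_scale_add _ _ _ (liftk (B1 n phi) *m w - liftk A' *m t')).
  by rewrite scalerBr addrAC e2 subrr.
by exists f%:M, w'.
Qed.

Lemma scalex_inj a b (P Q : 'M[R]_(a, b)) : x *: P = x *: Q -> P = Q.
Proof.
by move/eqP; rewrite -subr_eq0 -scalerBr => /eqP/scalex_eq0/eqP; rewrite subr_eq0 => /eqP.
Qed.

(** Padding [g] with a zero first block gives [(0, g) = b2 (u, w)]. Eliminating [u] with [A'^-1]
    yields [x g = c2 w], and [w] may be taken divisible by [x] because its part along [Gr^T] is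
    killed by [c2]. *)
Lemma ker_Gr (g : 'cV[R]_n.+1) : Gr *m g = 0 -> exists w, g = c2 n phi *m w.
Proof.
move=> Gg; have : hrow *m col_mx 0 g = 0 by rewrite /hrow mul_row_col mulmx0 add0r.
case/(ker_hrow n0 pU) => v; rewrite -[v]vsubmxK b2_mul.
move: (usubmx v) (dsubmx v) => u w /eq_col_mx[e1 e2].
have [|f [w' ew]] := @ker_B2 k n phi w.
  move=> j; apply: (@dvx_scale_add _ _ _ (liftk A' *m u + liftk (B1 n phi) *m w)).
  by rewrite scalerDr -addrA -Bm_mul -e1.
exists w'; apply: scalex_inj.
have -> : x *: (c2 n phi *m w') = c2 n phi *m w.
  by rewrite ew mulmxDr mulmxA c2_Gr mul0mx add0r scalemxAr.
have eu : x *: u = - (Ai *m (B *m w)).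
  apply/eqP; rewrite -addr_eq0; apply/eqP.
  by rewrite -[x *: u]mul1mx -AiA -mulmxA -scalemxAr -mulmxDr -e1 mulmx0.
rewrite e2 scalerBr scalemxAl /c2 mulmxDl -!mulmxA addrC; congr (_ + _).
by rewrite scalemxAr eu mulmxN opprK.
Qed.

Lemma Jann_Gr p : Jann n phi p <-> exists v : 'cV[R]_n.+1, p = (Gr *m v) 0 0.
Proof.
split=> [/(Jann_gen n0 pU)[c [d ->]]|[v ->]]; last exact: Gr_Jann.
exists (c + B^T *m Ai *m d); rewrite mulmxDr addmx_entry; congr (_ + _).
rewrite !mulmxA -x2MU -!scalemxAl.
by rewrite [RHS]mxE [X in _ = _ * X]mxE mulrA.
Qed.

End Invertible.
End Quadratic.

(** * Quadratic presentation of [J] and the Pfaffians of [c2] *)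

Section QuadraticPresentation.
Variables (k : fieldType) (n : nat) (phi : 'X_{1..3} -> k).
Hypothesis n0 : (0 < n)%N.
Hypothesis pU : pmat n phi \in unitmx.
Local Notation R := (poly3 k).
Local Notation x := (var k 0).
Local Notation G := (G n phi).
Local Notation Gr := (Gr n phi).
Local Notation B := (Bm n phi).
Local Notation A' := (Ap n phi).
Local Notation Ai := (liftk (invmx (Ap n phi))).
Local Notation evz := (@evz k).

Lemma low_degree_Jann d p : p \is d.-homog -> (d < n)%N -> Jann n phi p -> p = 0.
Proof.
move=> hp ld Jp; apply: (low_degree_zero n0 pU hp ld) => q.
by rewrite mulrAC Jp.
Qed.

Lemma sum_evz_B (v : 'I_n -> k) (t : 'I_n.+1) (lt : (t < n)%N) :
  \sum_(p < n) v p * evz (B p t) = v (Ordinal lt).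
Proof.
have e (p : 'I_n) : evz (B p t) = (p == Ordinal lt)%:R.
  by rewrite -mxf_ord evz_Bm // -?val_eqE // -ltnS.
rewrite (bigD1 (Ordinal lt)) //= e eqxx mulr1 big1 ?addr0 // => p ne.
by rewrite e (negPf ne) mulr0.
Qed.

(* A kernel vector of [A'] gives a linear syzygy of the [G]s; over a quadratic
   presentation the constant terms of a change of generators must kill it. *)
Lemma quadratic_unit : quadratically_presented (Jann n phi) -> A' \in unitmx.
Proof.
case=> [a [b [dg [dM [g [M [[hg [_ [Jg [gM kerg]]]] hM]]]]]]].
rewrite -row_free_unit; apply: inj_row_free => v vA.
pose u : 'cV[k]_n := v^T.
have Au : A' *m u = 0 by rewrite -[A']opprK -Ap_alt mulNmx -trmx_mul vA trmx0 oppr0.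
have [V0 HV] : exists V : 'I_n.+1 -> 'cV[R]_a, forall t : 'I_n.+1, G t = (g *m V t) 0 0.
  have H (t : 'I_n.+1) : exists v : 'cV[R]_a, G t = (g *m v) 0 0.
    by apply/Jg => w; apply: E_G => //; rewrite -ltnS.
  by have [V HV] := fin_all_exists H; exists V.
pose V := \matrix_(i < a, t < n.+1) V0 t i 0.
have eV : Gr = g *m V.
  apply/rowP => t; rewrite mxE HV !mxE; apply: eq_bigr => i _; by rewrite mxE.
(* [B^T u] is a syzygy of the [G_j] because [Gr B^T u = x^2 mus A' u = 0]; expressed in the given
   generators it is a combination of columns of [M]. *)
have [w ew] : exists w, V *m (B^T *m liftk u) = M *m w.
  apply: kerg; rewrite mulmxA -eV mulmxA -hrow_left // -scalemxAl -mulmxA -liftkM Au.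
  have -> : liftk (0 : 'cV[k]_n) = 0 :> 'cV[R]_n by apply/matrixP => i j; rewrite !mxE mpolyC0.
  by rewrite mulmx0 scaler0.
have hBu : mx_homog 1 (B^T *m liftk u).
  have hB : mx_homog 1 B^T by move=> i j; rewrite mxE; apply: Bm_homog.
  have hU : mx_homog 0 (liftk u : 'cV[R]_n) by move=> i j; rewrite mxE; apply: homog_C.
  exact: mx_homogM hB hU.
(* [M w] has no linear part, while [B^T u] is linear, so only the constant terms of [V] meet it in
   degree 1. *)
have e1 i : \sum_(t < n.+1) hc 0 (V i t) * (B^T *m liftk u) t 0 = 0.
  move/matrixP/(_ i 0)/(congr1 (hc 1)): ew; rewrite [X in hc 1 X]mxE hc_sum.
  have -> : hc 1 ((M *m w) i 0) = 0.
    by rewrite mxE hc_sum big1 // => j _; apply: (hcM_lt _ (hM i j)).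
  move=> e; rewrite -[RHS]e; apply: eq_bigr => t _.
  by rewrite [V i t * _]mulrC (hcM (V i t) 0 (hBu t 0)) mulrC.
(* [u] followed by 0, the out-of-range default: this is [B^T u] evaluated at [(0,0,1)]. *)
pose u' : 'cV[k]_n.+1 := \col_t mxf u t 0%N.
have e2 i : hc 0 ((V *m liftk u') i 0) = 0.
  have [V0c hV0] : exists V0c : 'I_n.+1 -> k, forall t, hc 0 (V i t) = (V0c t)%:MP.
    have H (t : 'I_n.+1) : exists c : k, hc 0 (V i t) = c%:MP by apply/homog0_const/hc_homog.
    by have [c Hc] := fin_all_exists H; exists c.
  rewrite mxE hc_sum.
  transitivity ((\sum_(t < n.+1) V0c t * u' t 0)%:MP : R).
    rewrite rmorph_sum; apply: eq_bigr => t _ /=.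
    rewrite [liftk u' _ _]mxE mulrC (hcM (V i t) 0 (homog_C (u' t 0))) hV0 mpolyCM.
    exact: mulrC.
  move/(congr1 evz): (e1 i); rewrite rmorph0 rmorph_sum => e.
  suff -> : \sum_(t < n.+1) V0c t * u' t 0 = 0 by rewrite mpolyC0.
  rewrite -[RHS]e.
  apply: eq_bigr => t _; rewrite rmorphM hV0 /= evzC; congr (_ * _).
  rewrite !mxE rmorph_sum /=.
  have [lt|ge] := ltnP t n.
    transitivity (\sum_(p < n) u p 0 * evz (B p t)).
      by rewrite (sum_evz_B (fun p => u p 0) lt) -(mxf_ord u (Ordinal lt) 0).
    by apply: eq_bigr => p _; rewrite [B^T _ _]mxE [liftk u _ _]mxE rmorphM /= evzC mulrC.
  rewrite /mxf insubF; last by apply/negbTE; rewrite -leqNgt.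
  rewrite big1 // => p _; rewrite [B^T _ _]mxE rmorphM /= -mxf_ord evz_Bm //; last by rewrite -ltnS.
  by rewrite ltn_eqF ?mul0r // (leq_trans (ltn_ord p) ge).
have e3 : Gr *m liftk u' = 0.
  apply/matrixP => i j; rewrite !ord1 [RHS]mxE.
  have h : (Gr *m liftk u') 0 0 \is n.-homog.
    rewrite mxE; apply: homog_sum => t _; rewrite mulrC [liftk u' _ _]mxE.
    exact: (dhomogM (homog_C _) (Gr_homog phi n0 0 t)).
  rewrite -(hc_id h) eV -mulmxA mxE hc_sum big1 // => l _.
  have [->|[dl hl]] := hg l; first by rewrite mul0r hc0.
  rewrite subn0 in hl.
  (* [J] has no nonzero form of degree below [n], generators of degree above [n] do not reach degree
     [n], and those of degree [n] meet only the vanishing constant terms of [V u']. *)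
  have [lt|gt|e] := ltngtP (dg l) n.
  - rewrite (low_degree_Jann hl lt) ?mul0r ?hc0 //; apply/Jg.
    by exists (delta_mx l 0); rewrite -colE mxE.
  - exact: (hcM_lt _ hl).
  - by have := hcM ((V *m liftk u') l 0) 0 hl; rewrite addn0 e e2 mulr0.
have u0 := Gr_free e3.
apply/rowP => j; rewrite mxE.
move/matrixP/(_ (widen_ord (leqnSn n) j) 0): u0; rewrite !mxE /= -[0%N]/(nat_of_ord (@ord0 0)) mxf_ord.
by rewrite mxE.
Qed.

Section Invertible.
Hypothesis en : ~~ odd n.
Hypothesis AU : A' \in unitmx.

Lemma evz_c2 (i j : 'I_n) : evz (mxf (c2 n phi) i j) = invmx A' i j.
Proof.
pose wi (i : 'I_n) := widen_ord (leqnSn n) i.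
have -> : mxf (c2 n phi) i j = c2 n phi (wi i) (wi j) by rewrite -mxf_ord.
have wlt (l : 'I_n) : (wi l < n)%N := ltn_ord l.
have wK (l : 'I_n) : Ordinal (wlt l) = l by apply: val_inj.
have eD : evz ((x *: Dm n phi) (wi i) (wi j)) = 0 by rewrite mxE rmorphM /= evz_var // mul0r.
rewrite /c2 addmx_entry rmorphD [X in _ + X]eD addr0.
rewrite mxE rmorph_sum.
transitivity (\sum_(q < n) invmx A' i q * evz (B q (wi j))).
  apply: eq_bigr => q _; rewrite rmorphM; congr (_ * _).
  rewrite mxE rmorph_sum.
  transitivity (\sum_(p < n) invmx A' p q * evz (B p (wi i))).
    by apply: eq_bigr => p _; rewrite [B^T _ _]mxE [Ai _ _]mxE rmorphM /= evzC mulrC.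
  by rewrite (sum_evz_B (fun p => invmx A' p q) (wlt i)) wK.
by rewrite (sum_evz_B (fun q => invmx A' i q) (wlt j)) wK.
Qed.

Lemma c1_last : c1 n phi 0 ord_max != 0.
Proof.
rewrite mxE mulf_eq0 signr_eq0 /=; apply/negP => /eqP/(congr1 evz)/eqP.
rewrite rmorph0 rmorph_pf; apply/negP.
apply: (@pf_neq0 _ _ (invmx A')) => //.
- exact: invmx_Ap_alt.
- exact: invmx_Ap_diag.
- by rewrite unitmx_inv.
by move=> i j; rewrite /del /= !ltn_ord evz_c2.
Qed.

(** The deleted matrices have even order [n] and quadratic entries, so their Pfaffians have degree
    [2 (n/2)]. *)
Lemma c1_homog : mx_homog n (c1 n phi).
Proof.
move=> i j; rewrite mxE /=.
have H : pf n (fun p q => mxf (c2 n phi) (del j p) (del j q)) \is n.-homog.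
  have en2 : n = (n./2).*2 by rewrite even_halfK.
  have := @pf_homog k n./2 2 (fun p q => mxf (c2 n phi) (del j p) (del j q)).
  rewrite mul2n -en2; apply=> p q; apply/mxf_homog; exact: c2_homog.
by rewrite -signr_odd; case: odd; rewrite ?expr1 ?expr0 ?mulN1r ?mul1r ?dhomogN.
Qed.

Lemma c1_Gr : exists2 c : k, c != 0 & c1 n phi = c%:MP *: Gr.
Proof.
have e : c2 n phi *m (c1 n phi)^T = 0.
  apply: trmx_inj; rewrite trmx_mul trmxK c2_alt // mulmxN signed_pfaffians_mul ?trmx0 ?oppr0 //.
  - exact: c2_alt.
  - exact: c2_diag.
have [f ef] := ker_c2 n0 pU AU e.
apply: (@scalar_of_homog _ n _ _ _ (f 0 0) ord_max).
- by rewrite -[LHS]trmxK ef trmx_mul trmxK [f]mx11_scalar tr_scalar_mx mul_scalar_mx mxE.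
- exact: c1_homog.
- exact: Gr_homog.
- exact: c1_last.
Qed.

Lemma Jann_c1 p : Jann n phi p <-> exists v : 'cV[R]_n.+1, p = (c1 n phi *m v) 0 0.
Proof.
have [c c0 ->] := c1_Gr; rewrite (Jann_Gr n0 pU AU); split=> [[v ->]|[v ->]].
  by exists (c^-1%:MP *: v); rewrite -scalemxAl -scalemxAr scalerA CV_scale // scale1r.
by exists (c%:MP *: v); rewrite -scalemxAl scalemxAr.
Qed.

Lemma min_free_res_J : min_free_res3 (Jann n phi)
  (fun _ => n) (fun _ => n.+2) (fun _ => n.*2.+2) (c1 n phi) (c2 n phi) (c3 n phi).
Proof.
have [c c0 eb] := c1_Gr.
split; first by move=> j; apply: (@graded_entryP _ _ _ _ n) (c1_homog _ _) => //; rewrite subn0.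
split.
  move=> i j; apply: (@graded_entryP _ _ _ _ 2); [lia | lia | exact: c2_homog].
split.
  move=> i j; rewrite mxE; apply: (@graded_entryP _ _ _ _ n) (c1_homog _ _); lia.
split; first exact: Jann_c1.
have e12 : c1 n phi *m c2 n phi = 0 by rewrite eb -scalemxAl Gr_c2 // scaler0.
split=> //; split.
  by apply: trmx_inj; rewrite trmx_mul trmxK c2_alt // mulmxN e12 trmx0 oppr0.
split.
  move=> v; rewrite eb -scalemxAl => /eqP; rewrite scalemx_eq0 mpolyC_eq0 (negPf c0) => /eqP.
  exact: ker_Gr.
split.
  move=> v /(ker_c2 n0 pU AU)[f ->]; exists (c^-1%:MP *: f).
  have eT : (c%:MP *: Gr)^T = c%:MP *: Gr^T by apply/matrixP => i j; rewrite !mxE.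
  by rewrite /c3 eb eT -scalemxAl -scalemxAr scalerA CV_scale // scale1r.
move=> v; rewrite [v]mx11_scalar /c3 mul_mx_scalar => /matrixP/(_ ord_max 0).
rewrite [X in X = _ -> _]mxE [X in _ = X -> _]mxE => /eqP; rewrite mulf_eq0 [_^T _ _]mxE (negPf c1_last) orbF => /eqP ->.
by apply/matrixP => i j; rewrite !mxE mul0rn.
Qed.

End Invertible.
End QuadraticPresentation.

Lemma presentation_of_resolution (k : fieldType) e (I : poly3 k -> Prop) r1 r2 r3 d1 d2 d3
    (f1 : 'M[poly3 k]_(1, r1)) (f2 : 'M[poly3 k]_(r1, r2)) (f3 : 'M[poly3 k]_(r2, r3)) :
  min_free_res3 I d1 d2 d3 f1 f2 f3 -> mx_homog e f2 -> presented_in_degree e I.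
Proof.
move=> [h1 [h2 [_ [hI [e12 [_ [ex _]]]]]]] he.
by exists r1, r2, d1, d2, f1, f2.
Qed.

(** * Minimal generators and the Gorenstein property *)

Section Generators.
Variables (k : fieldType) (n : nat) (phi : 'X_{1..3} -> k).
Hypothesis n0 : (0 < n)%N.
Local Notation R := (poly3 k).
Local Notation x := (var k 0).
Local Notation y := (var k 1).
Local Notation z := (var k 2).
Local Notation E := (dual_eval n.*2.-1 phi).
Local Notation N := (NN n).
Local Notation G := (G n phi).
Local Notation Gr := (Gr n phi).
Local Notation mus := (mus n phi).
Local Notation ms := (ms n phi).
Local Notation bm := (bm n).

(** A kernel vector gives [f] of degree [n-1] with [x f] in [J]. Injectivity of [x] on [A_{n-1}]
    puts [f] in [J] at once. Surjectivity does too: every monomial of degree [n] is some [x f']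
    modulo [J], and [E(f x f') = 0]. *)
Lemma pmat_unit : (forall p : R, p \is n.-1.-homog -> Jann n phi p -> p = 0) ->
  weak_lefschetz (Jann n phi) x -> pmat n phi \in unitmx.
Proof.
move=> J0 WL; rewrite -row_free_unit; apply: inj_row_free => v vp.
pose f := \sum_(j < N) v 0 j *: mb k n j.
have hf : f \is n.-1.-homog by apply: homog_sum => j _; apply/dhomogZ/mb_homog.
have Ef m : mdeg m = n.-1 -> E (x * f * 'X_[m]) = 0.
  move=> dm; have [t lt ->] := bm_onto n0 dm; rewrite -(mbE k n0 lt).
  move/rowP/(_ (Ordinal lt)): vp; rewrite !mxE => e; rewrite -[RHS]e.
  rewrite /f mulr_sumr mulr_suml dual_eval_sum; apply: eq_bigr => j _.
  by rewrite -scalerAr -scalerAl dual_evalZ [pmat _ _ _ _]mxE.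
have Exf q : E (x * f * q) = 0.
  rewrite [q]mpolyE mulr_sumr dual_eval_sum big1 // => m _.
  rewrite -scalerAr dual_evalZ; have [dm|ne] := eqVneq (mdeg m) n.-1; first by rewrite Ef // mulr0.
  rewrite (@dual_eval_ne _ _ _ (n + mdeg m)) ?mulr0 //; last by lia.
  by rewrite dhomogM ?dhomogX // xn1_homog.
suff f0 : f = 0.
  apply/rowP => j; rewrite mxE.
  have <- : f@_(bm j) = v 0 j.
    rewrite /f raddf_sum (bigD1 j) //= mcoeffZ mbE // mcoeffX eqxx mulr1 big1 ?addr0 // => i ne.
    rewrite mcoeffZ mbE // mcoeffX; case: eqP => [/bm_inj e|]; last by rewrite mulr0.
    by move: ne; rewrite -val_eqE /= e ?eqxx.
  by rewrite f0 mcoeff0.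
apply: J0 => //; have [inj|sur] := WL n.-1.
  by apply: inj => // q; rewrite mulrC Exf.
move=> q; rewrite [q]mpolyE mulr_suml dual_eval_sum big1 // => m _.
rewrite -scalerAl dual_evalZ; have [dm|ne] := eqVneq (mdeg m) n; last first.
  rewrite (@dual_eval_ne _ _ _ (mdeg m + n.-1)) ?mulr0 //; last by lia.
  by rewrite dhomogM ?dhomogX.
have [|f' [hf' Jf']] := sur 'X_[m]; first by rewrite dhomogX /= dm prednK.
have := Jf' f; rewrite mulrBr dual_evalB (_ : f * (x * f') = x * f * f'); last by ring.
by rewrite Exf subr0 mulrC => ->; rewrite mulr0.
Qed.

Hypothesis pU : pmat n phi \in unitmx.

Lemma N_gt0 : (0 < N)%N. Proof. by rewrite NN_ge addn_gt0 n0 orbT. Qed.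

Lemma E_high d p q : p \is d.-homog -> (n.*2.-1 < d)%N -> E (q * p) = 0.
Proof. by move=> hp ld; rewrite -dual_eval_hc mulrC (hcM_lt _ hp) // dual_eval0. Qed.

Lemma Iann_high d p : p \is d.-homog -> (n.*2.-1 <= d)%N -> Iann n phi p.
Proof.
move=> hp ld; apply/(IannE phi n0) => v; apply: (@E_high d.+1) => //.
by have := dhomogM (homog_var k 0) hp; rewrite add1n.
Qed.

Lemma Iann_not1 : ~ Iann n phi 1.
Proof.
move/(IannE phi n0) => /(_ (ms 0 * 'X_[bm 0])); rewrite mulr1 mulrC mulrA E_ms ?N_gt0 //.
by rewrite mcoeffX eqxx => /eqP; rewrite oner_eq0.
Qed.

Lemma regular_powers M : (0 < M)%N -> regular_seq3 (x ^+ M) (y ^+ M) (z ^+ M).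
Proof.
move=> M0.
have ex : x ^+ M = 'X_[mn3 M 0 0] by rewrite -mon3E /mon3 !expr0 !mulr1.
have ey : y ^+ M = 'X_[mn3 0 M 0] by rewrite -mon3E /mon3 !expr0 mulr1 mul1r.
have ez : z ^+ M = 'X_[mn3 0 0 M] by rewrite -mon3E /mon3 !expr0 !mul1r.
split; [|split; [|split]].
- move=> g /eqP; rewrite mulf_eq0 expf_eq0 (negPf (var_neq0 k 0)) andbF => /eqP //.
- move=> g; rewrite ey ex -[[:: 'X_[_]]]/([seq 'X_[m] | m <- [:: mn3 M 0 0]]).
  apply: in_mono_ideal_cancel => m v; rewrite inE => /eqP ->.
  by rewrite !lem_mn3 !mnmDE mn3E0 mn3E1 mn3E2.
- move=> g; rewrite ez ey ex -[[:: 'X_[_]; 'X_[_]]]/([seq 'X_[m] | m <- [:: mn3 M 0 0; mn3 0 M 0]]).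
  apply: in_mono_ideal_cancel => m v; rewrite !inE => /orP[] /eqP ->;
    by rewrite !lem_mn3 !mnmDE mn3E0 mn3E1 mn3E2.
- rewrite ez ey ex -[[:: 'X_[_]; 'X_[_]; 'X_[_]]]/([seq 'X_[m] | m <- [:: mn3 M 0 0; mn3 0 M 0; mn3 0 0 M]]).
  move=> /in_mono_idealP /(_ 0%MM); rewrite mcoeff1 eqxx oner_eq0 => /(_ isT).
  by rewrite /= !lem_mn3 !mnm0E; lia.
Qed.

Lemma Iann_grade_three : grade_three (Iann n phi).
Proof.
split; first exact: Iann_not1.
have h i : Iann n phi (var k i ^+ n.*2).
  by apply: (Iann_high (dhomogMn n.*2 (homog_var k i))); lia.
exists (x ^+ n.*2), (y ^+ n.*2), (z ^+ n.*2); do 3 (split; first exact: h).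
by apply: regular_powers; lia.
Qed.

(** The generator [s] has degree [2n-2] and [E(x s) = 1]. For a socle element [f], the difference
    [f - E(x f) s] pairs to zero with 1 by the choice of the scalar, and with every other monomial
    because that monomial contains a variable. *)
Lemma Iann_gorenstein : gorenstein_quotient (Iann n phi).
Proof.
pose s := ms 0 * 'X_[bm 0] : R.
have Es : E (x * s) = 1 by rewrite mulrA E_ms ?N_gt0 // mcoeffX eqxx.
have hs : s \is (n.-1 + n.-1).-homog by rewrite dhomogM ?ms_homog ?dhomogX //= bm_deg ?N_gt0.
have so i : Iann n phi (var k i * s).
  by apply: (Iann_high (dhomogM (homog_var k i) hs)); lia.
exists s; split; first by move/(IannE phi n0) => /(_ 1); rewrite mul1r Es => /eqP; rewrite oner_eq0.
split; first by do ! split; apply: so.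
move=> f [fx [fy fz]]; exists (E (x * f)); apply/(IannE phi n0) => v.
set g := f - _.
have gv i : (i < 3)%N -> Iann n phi (var k i * g).
  move=> li; apply/(IannE phi n0).
  have -> : x * (var k i * g) = x * (var k i * f) + - (E (x * f))%:MP * (x * (var k i * s)).
    by rewrite /g; ring.
  apply: JannD; last by apply/JannM/(IannE phi n0)/so.
  by apply/(IannE phi n0); case: i li => [|[|[|i]]].
rewrite [v]mpolyE mulr_suml dual_eval_sum big1 // => m _.
rewrite -scalerAl dual_evalZ; apply/eqP; rewrite mulf_eq0; apply/orP; right; apply/eqP.
have [->|nm] := eqVneq m 0%MM.
  rewrite mpolyX0 mul1r /g mulrBr mulrCA dual_evalB dual_evalCM Es mulr1 subrr //.
have [i mi] : exists i, m i != 0%N.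
  by apply/existsP; apply: contraR nm => /existsPn H; apply/eqP/mnmP => i; rewrite mnm0E; apply/eqP; have := H i; rewrite negbK.
have := gv i (ltn_ord i) => /(IannE phi n0) /(_ 'X_[m - U_(i)]).
rewrite (_ : _ * (x * (var k i * g)) = 'X_[m - U_(i)] * 'X_[U_(i)] * (x * g)).
  rewrite -mpolyXD submK //; apply/mnm_lepP => j; rewrite mnm1E.
  by case: eqP => // <-; rewrite lt0n.
by rewrite /var inord_val; ring.
Qed.

Lemma mem_rem_at (s : seq R) i v : v \in rem_at s i ->
  exists j, [/\ (j < size s)%N, j != i & v = s`_j].
Proof.
rewrite mem_cat => /orP[] /(nthP 0)[j].
  rewrite size_take_min leq_min => /andP[lji ljs] <-; exists j; rewrite nth_take //.
  by split=> //; rewrite ltn_eqF.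
rewrite size_drop ltn_subRL => lj <-; exists (i.+1 + j)%N; rewrite nth_drop.
by split=> //; rewrite gtn_eqF // addSn ltnS leq_addr.
Qed.

Lemma rem_at_sub (s : seq R) i v : (i < size s)%N -> v \in s -> v = s`_i \/ v \in rem_at s i.
Proof.
move=> li; rewrite -{1}(cat_take_drop i s) (drop_nth 0 li) mem_cat inE => /or3P[h|/eqP->|h].
- by right; rewrite mem_cat h.
- by left.
- by right; rewrite mem_cat h orbT.
Qed.

Lemma in_ideal_coef0 (s : seq R) p m :
  (forall v q, v \in s -> (q * v)@_m = 0) -> in_ideal s p -> p@_m = 0.
Proof.
move=> H [c ->]; rewrite raddf_sum big1 //= => i _; apply: H; exact: mem_nth.
Qed.

(** Each element of [s] owns a monomial of degree [d] that occurs in no other element of [s], and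
    [t] lives in degree [d+1], so [s] is never redundant. Redundant elements of [t] are discarded
    one at a time, by induction on its length. *)
Lemma extend_min_gen (J : R -> Prop) (s : seq R) d :
  (forall i, (i < size s)%N -> s`_i \is d.-homog /\
     exists m, [/\ mdeg m = d, (s`_i)@_m != 0 & forall j, (j < size s)%N -> j != i -> (s`_j)@_m = 0]) ->
  forall t : seq R, (forall v, v \in t -> v \is d.+1.-homog) ->
  (forall p, J p <-> in_ideal (s ++ t) p) -> part_of_min_gen_set J s.
Proof.
move=> Hs t; move sm : (size t) => m; elim/ltn_ind: m t sm => m IH t sm ht Ht.
have remE i : rem_at (s ++ t) (size s + i) = s ++ rem_at t i.
  rewrite /rem_at take_cat ltnNge leq_addr /= addKn drop_cat -addnS ltnNge leq_addr /= addKn.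
  by rewrite catA.
(* Ideal membership is not decided here, so the choice is made classically. *)
have [[i [li Hi]]|no] := classic (exists i, (i < size t)%N /\ in_ideal (s ++ rem_at t i) t`_i).
  apply: (IH (size (rem_at t i)) _ (rem_at t i)) => //.
  - by rewrite -sm size_cat size_take_min size_drop; lia.
  - by move=> v /mem_rem_at[j [lj _ ->]]; apply: ht; apply: mem_nth.
  move=> p; rewrite Ht; split; apply: in_ideal_sub => q; rewrite mem_cat => /orP[qs|qt].
  - by apply: in_ideal_mem; rewrite mem_cat qs.
  - have [->//|qr] := rem_at_sub li qt.
    by apply: in_ideal_mem; rewrite mem_cat qr orbT.
  - by apply: in_ideal_mem; rewrite mem_cat qs.
  - apply: in_ideal_mem; have [j [lj _ ->]] := mem_rem_at qt.
    by rewrite mem_cat mem_nth ?orbT.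
have subs j : (size s <= j)%N -> (j < size (s ++ t))%N -> (j - size s < size t)%N.
  by move=> h; rewrite size_cat -{1}(subnKC h) ltn_add2l.
exists t; split; [|split=> //] => i.
  rewrite nth_cat; case: ltnP => li; first by exists d; have [] := Hs i li.
  by exists d.+1; apply/ht/mem_nth/subs.
move: (nat_of_ord i) (ltn_ord i) => {}i lti.
rewrite nth_cat; case: ltnP => li; last first.
  rewrite -{1}(subnKC li) remE => H; apply: no; by exists (i - size s)%N; split=> //; apply: subs.
have [_ [u [du nu zu]]] := Hs i li; move=> /in_ideal_coef0 H; move: nu; rewrite H ?eqxx // => v q.
case/mem_rem_at=> j [lj nj ->]; rewrite nth_cat; case: ltnP => ljs.
  by have [hj _] := Hs j ljs; apply: (mcoeff_mul_homog _ hj); rewrite ?du // zu.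
have hj : t`_(j - size s) \is d.+1.-homog by apply/ht/mem_nth/subs.
apply: (mcoeff_mul_homog _ hj); first by rewrite du.
by apply: dhomog_nemf_coeff hj _; rewrite /= du; lia.
Qed.

Lemma gJ_nth (c : k) : b1 n phi = c%:MP *: hrow n phi ->
  forall i, (i < n.+1)%N -> (gJ n phi)`_i = c%:MP * G i.
Proof.
move=> eb i li; rewrite /gJ (nth_map 0%N) ?size_iota // nth_iota //.
have -> : (n + i)%N = rshift n (Ordinal li) by [].
by rewrite (mxf_ord _ (@ord0 0)) eb mxE /hrow row_mxEr mxE.
Qed.

Lemma size_gJ : size (gJ n phi) = n.+1.
Proof. by rewrite size_map size_iota. Qed.

Lemma scale_cancel (c : k) (a b : R) : c != 0 -> b * a = a * c^-1%:MP * (c%:MP * b).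
Proof.
move=> c0; transitivity ((c%:MP * c^-1%:MP) * (b * a)); last by ring.
by rewrite CV_scale // mul1r.
Qed.

Lemma gJ_part : part_of_min_gen_set (Jann n phi) (gJ n phi).
Proof.
have [c c0 eb] := b1_hrow n0 pU; have gE := gJ_nth eb.
(* The [x^2 mus_c], of degree [n+1], complete the [g_i] to generators of [J]; the private monomial
   of the [i]-th entry is [m_{0,i}]. *)
apply: (@extend_min_gen _ _ n _ (mkseq (fun c => x * (x * mus c)) n)).
- move=> i; rewrite size_gJ => li; rewrite gE //; split.
    by rewrite -[n]add0n dhomogM ?homog_C ?G_homog.
  exists (mn3 0 (n - i) i); split; first by rewrite mdeg_mn3; lia.
    by rewrite mcoeffCM G_coef // eqxx mulr1.
  by move=> j lj nj; rewrite gE // mcoeffCM G_coef // (negPf nj) mulr0.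
- move=> v /mapP[i _ ->].
  have h : mus i \is n.-1.-homog by apply: ms_homog.
  by have := dhomogM (homog_var k 0) (xn1_homog n0 h); rewrite add1n.
move=> p; rewrite (Jann_gen n0 pU); split=> [[d [u ->]]|].
  apply: in_idealD.
    rewrite mxE; apply: in_ideal_sum => t _; rewrite mxE.
    have -> : G t * d t 0 = d t 0 * c^-1%:MP * (gJ n phi)`_t.
      by rewrite gE // -scale_cancel.
    by apply/in_idealM/in_ideal_mem; rewrite mem_cat mem_nth ?size_gJ.
  rewrite mxE mulr_sumr; apply: in_ideal_sum => t _; rewrite mxE.
  have -> : x ^+ 2 * (mus t * u t 0) = u t 0 * (x * (x * mus t)) by ring.
  apply/in_idealM/in_ideal_mem; rewrite mem_cat; apply/orP; right.
  by apply/mapP; exists (t : nat) => //; rewrite mem_iota add0n ltn_ord.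
move=> [cc ->]; apply: inGM_sum => i _; apply: inGMM.
have : (gJ n phi ++ mkseq (fun c => x * (x * mus c)) n)`_i \in gJ n phi ++ mkseq (fun c => x * (x * mus c)) n.
  exact: mem_nth.
rewrite mem_cat => /orP[/(nthP 0)[j]|/mapP[j]].
  rewrite size_gJ => lj <-; rewrite gE //; apply: inGMM.
  have -> : G j = (Gr *m (delta_mx (Ordinal lj) 0 : 'cV[R]_n.+1)) 0 0 by rewrite -colE !mxE.
  exact: inGM_G.
rewrite mem_iota add0n => lj ->; rewrite mulrA -expr2; exact: inGM_mus.
Qed.

Lemma in_gJ p : in_ideal (gJ n phi) p <-> exists v : 'cV[R]_n.+1, p = (Gr *m v) 0 0.
Proof.
have [c c0 eb] := b1_hrow n0 pU; have gE := gJ_nth eb.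
rewrite (in_ideal_size _ size_gJ); split=> [[d ->]|[v ->]].
  exists (\col_i (d i * c%:MP)); rewrite mxE; apply: eq_bigr => i _.
  by rewrite gE // !mxE; ring.
exists (fun i => v i 0 * c^-1%:MP); rewrite mxE; apply: eq_bigr => i _.
by rewrite gE // mxE -scale_cancel.
Qed.

End Generators.

Theorem theorem4p2 (k : fieldType) (n : nat) (phi : 'X_{1..3} -> k) :
  (0 < n)%N -> ~~ odd n ->
  (forall p : poly3 k, p \is (n.-1).-homog -> Jann n phi p -> p = 0) ->
  weak_lefschetz (Jann n phi) (var k 0) ->
  (* (a) *)
  (grade_three_gorenstein (Iann n phi) /\ linearly_presented (Iann n phi) /\
   pmat n phi \in unitmx /\
   min_free_res3 (Iann n phi)
     (fun _ => n) (fun _ => n.+1) (fun _ => n.*2.+1)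
     (b1 n phi) (b2 n phi) (b3 n phi)) /\
  (* (b) *)
  part_of_min_gen_set (Jann n phi) (gJ n phi) /\
  (* (c) *)
  (quadratically_presented (Jann n phi) <-> Ap n phi \in unitmx) /\
  (* (d) *)
  (quadratically_presented (Jann n phi) ->
     (forall p, Jann n phi p <-> in_ideal (gJ n phi) p) /\
     min_free_res3 (Jann n phi)
       (fun _ => n) (fun _ => n.+2) (fun _ => n.*2.+2)
       (c1 n phi) (c2 n phi) (c3 n phi)).
Proof.
move=> n0 en J0 WL; have pU := pmat_unit n0 J0 WL.
have res_I := min_free_res_I n0 pU.
split.
  split; first by split; [exact: Iann_grade_three | exact: Iann_gorenstein].
  by split; first exact: (presentation_of_resolution res_I (@b2_homog k n phi)).
split; first exact: gJ_part.
split.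
  split; first exact: quadratic_unit.
  move=> AU; apply: (presentation_of_resolution (min_free_res_J n0 pU en AU)); exact: c2_homog.
move=> /(quadratic_unit n0 pU) AU; split; last exact: min_free_res_J.
by move=> p; rewrite (Jann_Gr n0 pU AU) (in_gJ n0 pU).
Qed.
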